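(* Let $k$ be $\mathbb{R}$ or $\mathbb{C}$, let $A$ be a finite-dimensional commutative Frobenius algebra over $k$, and let $\mathcal{P}(A)\subset \mathrm{HH}^{2,0}(A,A)\subset\mathrm{HH}^2(A,A)$ be the set of all Lie brackets on $A$ which make $A$ a Poisson algebra. Then each gauge orbit $\mathcal{O}\subset\mathcal{P}(A)\subset \mathrm{HH}^2(A,A)$ (a smooth immersed submanifold) is a Poisson manifold, with Poisson tensor induced by $$\Pi_X(a,b)=(X,\ \delta_X a\wedge\delta_X b),\qquad X\in\mathcal{O},\ a,b\in B^2 .$$
   Context: A commutative Frobenius algebra is a finite-dimensional commutative associative unital $k$-algebra with a non-degenerate symmetric bilinear form $\langle\cdot,\cdot\rangle$ satisfying $\langle ab,c\rangle=\langle a,bc\rangle$. Hochschild (co)homology of a commutative algebra in characteristic zero has a Hodge decomposition $\mathrm{HH}^p(A,A)=\bigoplus_i \mathrm{HH}^{i,p-i}(A,A)$, $\mathrm{HH}_p(A,A)=\bigoplus_i \mathrm{HH}_{i,p-i}(A,A)$, where the $i$-th summand is the eigenspace of the shuffle operator with eigenvalue $2^i-2$. The summand $\mathrm{HH}^{p,0}(A,A)$ consists of the skew-symmetric multiderivations $A^{\times p}\to A$ (each class having a unique skew-symmetric representative cochain). Let $\pi:\mathrm{HH}^p(A,A)\to \mathrm{HH}^{p,0}(A,A)$ be the projection of the Hodge decomposition (antisymmetrization). Put $L^i=\mathrm{HH}^{i+1,0}(A,A)$, with bracket $[\cdot,\cdot]_{\mathcal{G}_1}=\pi[\cdot,\cdot]$,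 where $[\cdot,\cdot]$ is the Gerstenhaber bracket. This is a graded Lie algebra, regarded as a differential graded Lie algebra with zero differential. $\mathcal{P}(A)=\{X\in L^1=\mathrm{HH}^{2,0}(A,A) : [X,X]_{\mathcal{G}_1}=0\}$; its elements are exactly the Lie brackets on $A$ that are derivations of the product in each argument. The Lie algebra $L^0$ of derivations of $A$ acts on $L^1$ by the vector fields $X\mapsto [X,\lambda]_{\mathcal{G}_1}$, $\lambda\in L^0$; their flows preserve $\mathcal{P}(A)$ and decompose it into gauge orbits. Let $B^i=\mathrm{HH}_{i,0}(A,A)$, a graded commutative algebra under the product $\wedge$, which is (up to normalising prefactors) the shuffle product on Hochschild homology. There is a non-degenerate pairing $(\cdot,\cdot):L^{i-1}\times B^{i}\to k$ induced by the pairing of Hochschild cochains and chains $$(\alpha_1\otimes\cdots\otimes\alpha_p\otimes a,\ b\otimes f_1\otimes\cdots\otimes f_p)=\langle a,b\rangle\prod_{i=1}^p\alpha_i(f_i),\qquad \alpha_i\in A^\vee,\ a,b,f_i\in A.$$ For $X\in L^1$ put $d_X=[X,\cdot]_{\mathcal{G}_1}$, and let $\delta_X:B^i\to B^{i-1}$ be its adjoint, $(d_X\,\cdot,\cdot)=(\cdot,\delta_X\,\cdot)$. The pairing identifies $T_X^*L^1=(L^1)^\vee$ with $B^2$, and $T_X^*\mathcal{O}$ with the quotient of $B^2$ by the annihilator of $T_X\mathcal{O}=d_XL^0$. *)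

(* Defs.v *)
From HB Require Import structures.
From mathcomp Require Import all_boot all_order all_algebra all_fingroup all_field.
From mathcomp Require Import all_classical all_reals all_analysis.
From mathcomp Require Import complex.

Set Implicit Arguments.
Unset Strict Implicit.
Unset Printing Implicit Defensive.

Import Order.TTheory GRing.Theory Num.Theory.
Import numFieldNormedType.Exports.

Local Open Scope classical_set_scope.
Local Open Scope ring_scope.

Definition frobenius_form (K : fieldType) (A : falgType K) (form : A -> A -> K) : Prop :=
  [/\ forall (k : K) a a' b, form (k *: a + a') b = k * form a b + form a' b,
      forall a b, form a b = form b a,
      forall a b c, form (a * b) c = form a (b * c)
    & forall a, (forall b, form a b = 0) -> a = 0].

Section Hochschild.
Variables (K : fieldType) (A : falgType K).

Local Notation n := (\dim {:A}).
Local Notation e := (vbasis {:A}).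

(* Both Hom(A^(⊗p), A) and A ⊗ A^(⊗p) are written in coordinates with respect
   to the basis e of A:
   - f : cochain p is the multilinear map with f (e_t1, ..., e_tp) = f t;
   - c : chain p is the tensor \sum_t c t ⊗ e_t1 ⊗ ... ⊗ e_tp. *)
Definition cochain (p : nat) := {ffun p.-tuple 'I_n -> A}.
Definition chain (p : nat) := {ffun p.-tuple 'I_n -> A}.

Definition basis_args p (t : p.-tuple 'I_n) : seq A := [seq e`_(i : 'I_n) | i <- t].

Definition monomial p (t : p.-tuple 'I_n) (x : seq A) : K :=
  \prod_(i < p) coord e (tnth t i) x`_i.

(* f (x_0, ..., x_(p-1)); only the first p items of x are used. *)
Definition capply p (f : cochain p) (x : seq A) : A :=
  \sum_(t : p.-tuple 'I_n) monomial t x *: f t.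

(* a ⊗ x_0 ⊗ ... ⊗ x_(p-1) *)
Definition tensor p (a : A) (x : seq A) : chain p :=
  [ffun t => monomial t x *: a].

(* (α_1 ⊗ ... ⊗ α_p ⊗ a, b ⊗ f_1 ⊗ ... ⊗ f_p) = <a, b> \prod_i α_i (f_i) *)
Definition pairing (form : A -> A -> K) p (f : cochain p) (c : chain p) : K :=
  \sum_(t : p.-tuple 'I_n) form (f t) (c t).

(* On cochains: (x_0, ..., x_(p-1)) |-> f (x_(s 0), ..., x_(s (p-1))).
   On chains: the factor in position i moves to position s i. *)
Definition permute p (s : 'S_p) (f : {ffun p.-tuple 'I_n -> A}) :
    {ffun p.-tuple 'I_n -> A} :=
  [ffun t => f [tuple tnth t (s i) | i < p]].

Definition sgn_perm p (s : 'S_p) : K := (-1) ^+ s.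

Definition skew p (f : cochain p) : Prop :=
  forall s : 'S_p, permute s f = sgn_perm s *: f.

Definition multiderivation p (f : cochain p) : Prop :=
  forall (x : seq A) (i : nat) (a b : A), (i < p)%N ->
    capply f (set_nth 0 x i (a * b)) =
    a * capply f (set_nth 0 x i b) + capply f (set_nth 0 x i a) * b.

(* HH^{p,0}(A,A), each class being given by its unique skew-symmetric
   representative *)
Definition HHcoh (p : nat) : set (cochain p) :=
  [set f | skew f /\ multiderivation f].

(* L^i = HH^{i+1,0}(A,A) *)
Definition L (i : nat) : set (cochain i.+1) := @HHcoh i.+1.

(* the projection of the Hodge decomposition onto HH^{p,0} *)
Definition antisym p (f : cochain p) : cochain p :=
  (p`!%:R)^-1 *: \sum_(s : 'S_p) sgn_perm s *: permute s f.

(* \sum_i (-1)^(i q) f (x_0, .., x_(i-1), g (x_i, .., x_(i+q)), x_(i+q+1), ..)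
   evaluated at x *)
Definition circ p q (f : cochain p.+1) (g : cochain q.+1) (x : seq A) : A :=
  \sum_(i < p.+1) (-1) ^+ (i * q) *
    capply f (take i x ++ capply g (drop i x) :: drop (i + q.+1) x).

Definition gerstenhaber p q (f : cochain p.+1) (g : cochain q.+1) :
    cochain (p + q).+1 :=
  [ffun t => circ f g (basis_args t) - (-1) ^+ (p * q) * circ g f (basis_args t)].

Definition bracketG1 p q (f : cochain p.+1) (g : cochain q.+1) :
    cochain (p + q).+1 := antisym (gerstenhaber f g).

Definition poisson_structures : set (cochain 2) :=
  [set X | @L 1 X /\ bracketG1 (X : cochain 1.+1) (X : cochain 1.+1) = 0].

Definition dX (X : cochain 2) p (Y : cochain p.+1) : cochain p.+2 :=
  bracketG1 (X : cochain 1.+1) Y.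

(* a ⊗ x_0 ⊗ ... ⊗ x_p |->
     a x_0 ⊗ x_1 ⊗ ... ⊗ x_p
     + \sum_(i < p) (-1)^(i+1) a ⊗ x_0 ⊗ ... ⊗ x_i x_(i+1) ⊗ ... ⊗ x_p
     + (-1)^(p+1) x_p a ⊗ x_0 ⊗ ... ⊗ x_(p-1) *)
Definition boundary p (c : chain p.+1) : chain p :=
  \sum_(t : p.+1.-tuple 'I_n)
    let x := basis_args t in
    (tensor p (c t * x`_0) (behead x)
     + \sum_(i < p) (-1) ^+ i.+1 *:
         tensor p (c t) (take i x ++ (x`_i * x`_i.+1) :: drop i.+2 x)
     + (-1) ^+ p.+1 *: tensor p (x`_p * c t) x).

Definition is_shuffle k p (s : 'S_p) : bool :=
  [forall i : 'I_p, forall j : 'I_p,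
     ((i < j)%N && ((j < k)%N || (k <= i)%N)) ==> (s i < s j)%N].

(* signed sum over the (k, p-k)-shuffles *)
Definition shuffle k p (c : chain p) : chain p :=
  \sum_(s : 'S_p | is_shuffle k s) sgn_perm s *: permute s c.

Definition shuffle_operator p (c : chain p) : chain p :=
  \sum_(1 <= k < p) shuffle k c.

(* B^i = HH_{i,0}(A,A) for i = p + 1: the eigenspace of the shuffle operator on
   HH_i(A,A) with eigenvalue 2^i - 2. Its elements are given by representing
   cycles; two such cycles have the same class when they differ by a boundary. *)
Definition HHhom (p : nat) : set (chain p.+1) :=
  [set c | boundary c = 0 /\
     exists d : chain p.+2,
       shuffle_operator c - (2 ^+ p.+1 - 2) *: c = boundary d].

(* (a ⊗ x) (b ⊗ y) |-> a b ⊗ x ⊗ y *)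
Definition concat_chain p q (c : chain p) (d : chain q) : chain (p + q) :=
  \sum_(t : p.-tuple 'I_n) \sum_(t' : q.-tuple 'I_n)
    tensor (p + q) (c t * d t') (basis_args t ++ basis_args t').

(* the shuffle product, with prefactors kappa p q depending on the degrees *)
Definition wedge (kappa : nat -> nat -> K) p q (c : chain p) (d : chain q) :
    chain (p + q) :=
  kappa p q *: shuffle p (concat_chain c d).

Variable form : A -> A -> K.

(* A cycle representing δ_X c, where δ_X : B^{p+2} -> B^{p+1} is the adjoint of
   d_X : L^p -> L^{p+1}. *)
Definition deltaX (X : cochain 2) p (c : chain p.+2) : chain p.+1 :=
  xget 0 [set c' : chain p.+1 | @HHhom p c' /\
    forall Y : cochain p.+1, @L p Y ->
      pairing form (dX X Y) c = pairing form Y c'].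

Definition PiX (kappa : nat -> nat -> K) (X : cochain 2) (a b : chain 2) : K :=
  pairing form X (wedge kappa (deltaX X (a : chain 0.+2)) (deltaX X (b : chain 0.+2))).

End Hochschild.

Arguments L {K} A i.
Arguments HHcoh {K} A p.
Arguments HHhom {K} A p.
Arguments poisson_structures {K} A.
Arguments pairing {K A} form p f c.

Definition real_or_complex (K : numFieldType) : Prop :=
  exists R : realType, K = R :> numFieldType \/ K = R[i] :> numFieldType.

Section Smooth.
Variable K : numFieldType.

Fixpoint Ck (k : nat) (V W : normedModType K) (U : set V) (f : V -> W) : Prop :=
  if k is k'.+1 then
    (forall u, U u -> differentiable f u) /\
    (forall v, Ck k' U (fun u => 'd f u v : W))
  else forall u, U u -> {for u, continuous f}.

Definition smooth_on (V W : normedModType K) (U : set V) (f : V -> W) : Prop :=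
  forall k, Ck k U f.

(* coordinates, to do calculus in a vectType, which carries no norm *)
Definition coords (W : vectType K) (w : W) : 'rV[K]_(\dim {:W}) :=
  passmx.rVof (vbasis {:W}) w.
Definition of_coords (W : vectType K) (v : 'rV[K]_(\dim {:W})) : W :=
  passmx.vecof (vbasis {:W}) v.

(* f'(t) = w for a curve f in W *)
Definition has_velocity (W : vectType K) (f : K -> W) (t : K) (w : W) : Prop :=
  is_derive (t : K^o) (1 : K^o) (fun s : K^o => coords (f s)) (coords w).

(* An inverse chart: the parametrization [par_map], restricted to [par_dom]. *)
Record param (m : nat) (W : vectType K) := Param {
  par_dom : set 'rV[K]_m ;
  par_map : 'rV[K]_m -> W }.

Section Submanifold.
Variables (m : nat) (W : vectType K).
Implicit Types c : param m W.

Definition par_diff c (u v : 'rV[K]_m) : W :=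
  of_coords ('d (fun u' => coords (par_map c u')) u v).

Definition tangent c (u : 'rV[K]_m) : set W := range (par_diff c u).

Definition immersed_param (S : set W) c : Prop :=
  [/\ open (par_dom c),
      smooth_on (par_dom c) (fun u => coords (par_map c u)),
      (forall u v, par_dom c u -> par_dom c v -> par_map c u = par_map c v -> u = v),
      (forall u v, par_dom c u -> par_diff c u v = 0 -> v = 0)
    & forall u, par_dom c u -> S (par_map c u)].

Definition compatible c c' : Prop :=
  let D := [set u | par_dom c u /\ exists2 u', par_dom c' u' & par_map c' u' = par_map c u] in
  open D /\ exists tau : 'rV[K]_m -> 'rV[K]_m,
    smooth_on D tau /\
    forall u, D u -> par_dom c' (tau u) /\ par_map c' (tau u) = par_map c u.

(* The manifold topology on S is the one generated by the images of the charts;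
   it is finer than the topology of W, hence Hausdorff. Countably many charts
   covering S make it second countable. *)
Definition immersed_submanifold (S : set W) (atlas : set (param m W)) : Prop :=
  [/\ (forall c, atlas c -> immersed_param S c),
      (forall c c', atlas c -> atlas c' -> compatible c c')
    & exists2 c : nat -> param m W, (forall i, atlas (c i)) &
        forall w, S w -> exists i, exists2 u, par_dom (c i) u & par_map (c i) u = w].

(* A bivector field \sum_(i, j) P i j ∂_i ⊗ ∂_j on U with vanishing Schouten
   square *)
Definition poisson_bivector (U : set 'rV[K]_m) (P : 'rV[K]_m -> 'M[K]_m) : Prop :=
  let D (l i j : 'I_m) u : K :=
    'd (fun u' => P u' i j : K^o) u (delta_mx 0 l : 'rV[K]_m) in
  [/\ smooth_on U P,
      (forall u, U u -> (P u)^T = - P u)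
    & forall u, U u -> forall i j k,
        \sum_(l < m) (P u i l * D l j k u + P u j l * D l k i u
                      + P u k l * D l i j u) = 0].

(* [Pi w] is a bilinear form on a set [Cov] of covectors of W, acting on W by
   [ev]. It induces a Poisson tensor on the submanifold when, in each chart,
   it is the pullback of a Poisson bivector under the restriction of covectors
   to the tangent spaces; in particular [Pi w a b] only depends on these
   restrictions. *)
Definition induces_poisson_tensor (atlas : set (param m W)) (C : Type)
    (Cov : set C) (ev : W -> C -> K) (Pi : W -> C -> C -> K) : Prop :=
  forall c, atlas c -> exists2 P : 'rV[K]_m -> 'M[K]_m,
    poisson_bivector (par_dom c) P &
    forall u a b, par_dom c u -> Cov a -> Cov b ->
      Pi (par_map c u) a b =
      \sum_(i < m) \sum_(j < m) P u i j * ev (par_diff c u (delta_mx 0 i)) a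
                                        * ev (par_diff c u (delta_mx 0 j)) b.

End Submanifold.
End Smooth.

Section Gauge.
Variables (K : numFieldType) (A : falgType K).

(* An integral curve in L^1 of the vector field X |-> [X, lambda]; the time
   parameter is in K. *)
Definition flow_line (lambda : cochain A 1) (gamma : K -> cochain A 2) : Prop :=
  (forall t, L A 1 (gamma t)) /\
  (forall t, has_velocity gamma t (dX (gamma t) (lambda : cochain A 0.+1))).

Inductive gauge_equiv (X : cochain A 2) : cochain A 2 -> Prop :=
| gauge_refl : gauge_equiv X X
| gauge_step (lambda : cochain A 1) (gamma : K -> cochain A 2) :
    gauge_equiv X (gamma 0) -> L A 0 lambda -> flow_line lambda gamma ->
    gauge_equiv X (gamma 1).

Definition gauge_orbit (O : set (cochain A 2)) : Prop :=
  exists2 X, poisson_structures A X & O = [set Y | gauge_equiv X Y].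

End Gauge.

(* Main.v *)
(* The gauge orbit of X is X G, where G is the group generated by the exponentials
   of the inner actions Y |-> [Y, lambda]. The map
   u |-> X exp (u_1 b_1) ... exp (u_m b_m) is inverted, after a linear projection p,
   by a contraction argument; this gives a slice psi with psi (u) p = u, and the
   charts are the translates psi g with g in G. A curve tangent to the orbits stays
   in the chart: the difference between it and psi of its projection satisfies a
   linear differential inequality. This makes the charts compatible, and countably
   many of them cover the orbit, since G is approximated by the exponentials with
   parameters in a dense sequence.
   In a chart the bivector is V^T B V, with B the matrix of the contraction of two
   covectors with X and V the matrix of the gauge action. Its Schouten square at
   (a, b, c) reduces pointwise to the trace of delta a delta b delta c against the
   Jacobiator of X, hence vanishes. *)

Require Import Defs.
From HB Require Import structures.
From mathcomp Require Import all_boot all_order all_algebra all_fingroup all_field.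
From mathcomp Require Import all_classical all_reals all_analysis.
From mathcomp Require Import complex ring lra zify.
Import Defs.

Set Implicit Arguments.
Unset Strict Implicit.
Unset Printing Implicit Defensive.

Import Order.TTheory GRing.Theory Num.Theory.
Import numFieldNormedType.Exports.

Local Open Scope classical_set_scope.
Local Open Scope ring_scope.

(** The gauge action is linear in the bracket X, so in coordinates it is right multiplication of row
    vectors by constant matrices, and its integral curves are exponentials defined for all time. The
    group G carries no topology here and the orbit is only immersed, so questions about the orbit
    topology are answered by following curves. Smoothness to all orders comes from an autonomous
    equation: the tangent space at Y is the row space of [tan_mx a Y], so the differential of the
    slice is the rational expression [slice_mx a s p Y] in the point Y itself. Rational expressions
    in the slice are then closed under differentiation. The chain [deltaX] is a chosen
    representative, known only through its pairings with derivations. This suffices because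
    contracting X with one chain gives a derivation, [ham_der], so the bivector sees only those
    pairings; the explicit chains [frame_chain] can therefore replace it. The Jacobi identity is
    quadratic in X; it becomes linear on the tensor square of X, where exponentials preserve stable
    subspaces, and this keeps the orbit inside the Poisson structures. *)

(* A common interface for the fields of real and complex numbers, with R-valued
   norm [nK]; [geometric_cvg] is completeness. *)
Record norm_data (R : realType) (K : numFieldType) := NormData {
  emb : {rmorphism R -> K};
  nK : K -> R;
  emb_le : forall x y, (emb x <= emb y) = (x <= y);
  norm_emb : forall x, `|x| = emb (nK x);
  geometric_cvg : forall (u : nat -> K) (C : R),
    (forall n, nK (u n.+1 - u n) <= C / 2 ^+ n) ->
    exists l, forall n, nK (u n - l) <= 4 * C / 2 ^+ n;
  dense_seq : nat -> K;
  dense_seq_dense : forall x (e : R), 0 < e -> exists n, nK (x - dense_seq n) < e }.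

(** * The real and the complex numbers as normed fields *)

Section NormInstances.
Variable R : realType.

(** The limit is the supremum of the lower bounds [u n - 2 * (C / 2 ^+ n)]: the telescoped estimate
    [Hd] places each of them below every [u k + 2 * (C / 2 ^+ k)]. *)
Lemma geometric_limit (u : nat -> R) (C : R) :
  (forall n, `|u n.+1 - u n| <= C / 2 ^+ n) ->
  exists l, forall n, `|u n - l| <= 2 * (C / 2 ^+ n).
Proof.
move=> Hu.
have C0 : 0 <= C by have := Hu 0%N; rewrite expr0 divr1; apply: le_trans.
have Hd n k : `|u (n + k)%N - u n| <= 2 * (C / 2 ^+ n) - 2 * (C / 2 ^+ (n + k)).
  elim: k => [|k IH]; first by rewrite addn0 !subrr normr0.
  rewrite addnS.
  have -> : u (n + k).+1 - u n = (u (n + k).+1 - u (n + k)%N) + (u (n + k)%N - u n) by rewrite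
    subrKA.
  apply: le_trans (ler_normD _ _) _; have := lerD (Hu (n + k)%N) IH.
  have -> : C / 2 ^+ (n + k).+1 = C / 2 ^+ (n + k) / 2 by rewrite exprSr invfM mulrA.
  by move/le_trans; apply; lra.
pose a (n : nat) := u n - 2 * (C / 2 ^+ n).
have pos n : 0 <= C / 2 ^+ n by rewrite divr_ge0 // exprn_ge0.
have a_ub n k : a n <= u k + 2 * (C / 2 ^+ k).
  have Hk := Hd k (n - k)%N; have Hn := Hd n (k - n)%N; rewrite /a.
  have [le|/ltnW le] := leqP k n.
    move: Hk; rewrite subnKC // => /ler_normlP[_ h2].
    by have := pos n; have := pos k; lra.
  move: Hn; rewrite subnKC // => /ler_normlP[h1 _].
  by have := pos n; have := pos k; lra.
exists (sup (range a)) => n.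
have hs : has_sup (range a).
  split; first by exists (a 0%N), 0%N.
  by exists (u 0%N + 2 * (C / 2 ^+ 0)) => _ [k _ <-]; exact: a_ub.
have lo : a n <= sup (range a) by apply: ub_le_sup; [exact: hs.2|exists n].
have hi : sup (range a) <= u n + 2 * (C / 2 ^+ n).
  by apply: ge_sup; [exact: hs.1|move=> _ [k _ <-]; exact: a_ub].
by rewrite ler_norml; move: lo hi; rewrite /a => lo hi; apply/andP; split; lra.
Qed.

Definition rat_seq (n : nat) : R := ratr (odflt 0 (unpickle n)).

Lemma rat_seq_dense (x e : R) : 0 < e -> exists n, `|x - rat_seq n| < e.
Proof.
move=> e0; have [|q] := @rat_in_itvoo R (x - e) (x + e); first by lra.
rewrite in_itv /= => /andP[h1 h2]; exists (pickle q).
by rewrite /rat_seq pickleK /= ltr_norml; apply/andP; split; lra.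
Qed.

Definition norm_data_real : norm_data R R.
Proof.
refine (@NormData R R idfun (fun x => `|x|) _ _ _ rat_seq _) => //.
  move=> u C Hu; have [l Hl] := geometric_limit Hu; exists l => n.
  apply: le_trans (Hl n) _; rewrite -!mulrA; apply: ler_wpM2r; last by lra.
  rewrite divr_ge0 ?exprn_ge0 //; have := Hu 0%N; rewrite expr0 divr1.
  exact: le_trans.
exact: rat_seq_dense.
Defined.

Local Notation C := R[i].

Lemma complex_norm_ge (z : C) : `|complex.Re z| <= complex.Re `|z| /\
  `|complex.Im z| <= complex.Re `|z|.
Proof.
case: z => x y /=; split; rewrite -[leLHS]sqrtr_sqr ler_sqrt ?addr_ge0 ?sqr_ge0 //.
  by rewrite lerDl sqr_ge0.
by rewrite lerDr sqr_ge0.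
Qed.

Lemma complex_norm_le (z : C) :
  complex.Re `|z| <= `|complex.Re z| + `|complex.Im z|.
Proof.
case: z => x y /=; rewrite -(@ler_pXn2r R 2%N) ?nnegrE ?sqrtr_ge0 ?addr_ge0 //.
rewrite sqr_sqrtr ?addr_ge0 ?sqr_ge0 // sqrrD !real_normK ?num_real //.
rewrite lerD2r lerDl.
by rewrite mulrn_wge0 // mulr_ge0.
Qed.

(** Real and imaginary parts converge separately with constant 2 by [geometric_limit], and the
    modulus is at most the sum of their absolute values; hence the constant 4 in [geometric_cvg]. *)
Definition norm_data_complex : norm_data R C.
Proof.
refine (@NormData R C (real_complex R) (fun z => complex.Re `|z|) _ _ _
  (fun n => let q := odflt (0%N, 0%N) (unpickle n) in (rat_seq q.1 +i* rat_seq q.2)%C) _).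
- by move=> x y; rewrite lecR.
- by case=> x y; rewrite normc_def.
- move=> u B Hu.
  have Hr n : `|complex.Re (u n.+1) - complex.Re (u n)| <= B / 2 ^+ n.
    rewrite -raddfB; exact: le_trans (complex_norm_ge _).1 (Hu n).
  have Hi n : `|complex.Im (u n.+1) - complex.Im (u n)| <= B / 2 ^+ n.
    rewrite -raddfB; exact: le_trans (complex_norm_ge _).2 (Hu n).
  have [x Hx] := geometric_limit Hr; have [y Hy] := geometric_limit Hi.
  exists (x +i* y)%C => n; apply: le_trans (complex_norm_le _) _.
  rewrite !raddfB /=; have := lerD (Hx n) (Hy n); lra.
- move=> [x y] e e0; have e2 : 0 < e / 2 by rewrite divr_gt0.
  have [i Hi] := rat_seq_dense x e2; have [j Hj] := rat_seq_dense y e2.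
  exists (pickle (i, j)); rewrite pickleK.
  apply: le_lt_trans (complex_norm_le _) _; rewrite !raddfB /=.
  have := ltrD Hi Hj; lra.
Defined.

End NormInstances.

(** * The entrywise norm of matrices *)

Section Norm.
Variables (R : realType) (K : numFieldType) (nd : norm_data R K).
Local Notation nK := (nK nd).
Local Notation emb := (emb nd).

Lemma emb_lt x y : (emb x < emb y) = (x < y).
Proof. by rewrite !lt_neqAle emb_le (inj_eq (fmorph_inj _)). Qed.

Lemma nK_ge0 x : 0 <= nK x.
Proof. by rewrite -(emb_le nd) rmorph0 -norm_emb. Qed.

Lemma nK0 : nK 0 = 0.
Proof. by apply: (fmorph_inj emb); rewrite -norm_emb normr0 rmorph0. Qed.

Lemma nK1 : nK 1 = 1.
Proof. by apply: (fmorph_inj emb); rewrite -norm_emb normr1 rmorph1. Qed.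

Lemma nKD x y : nK (x + y) <= nK x + nK y.
Proof. by rewrite -(emb_le nd) rmorphD -!norm_emb ler_normD. Qed.

Lemma nKN x : nK (- x) = nK x.
Proof. by apply: (fmorph_inj emb); rewrite -!norm_emb normrN. Qed.

Lemma nKM x y : nK (x * y) = nK x * nK y.
Proof. by apply: (fmorph_inj emb); rewrite rmorphM -!norm_emb normrM. Qed.

Lemma nK_emb t : nK (emb t) = `|t|.
Proof.
apply: (fmorph_inj emb); rewrite -norm_emb.
have [t0|t0] := ger0P t; first by rewrite ger0_norm // -(rmorph0 emb) emb_le.
by rewrite rmorphN ltr0_norm // -(rmorph0 emb) emb_lt.
Qed.

Lemma nKV x : nK x^-1 = (nK x)^-1.
Proof. by apply: (fmorph_inj emb); rewrite fmorphV -!norm_emb normfV. Qed.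

Lemma nK_nat n : nK n%:R = n%:R.
Proof. by rewrite -(rmorph_nat emb) nK_emb normr_nat. Qed.

Lemma nK_eq0 x : nK x = 0 -> x = 0.
Proof. by move=> x0; apply/eqP; rewrite -normr_eq0 (norm_emb nd) x0 rmorph0. Qed.

Lemma nK_sum I (r : seq I) P (F : I -> K) :
  nK (\sum_(i <- r | P i) F i) <= \sum_(i <- r | P i) nK (F i).
Proof.
elim/big_ind2: _ => [|x u y v hx hy|//]; first by rewrite nK0.
by apply: le_trans (nKD _ _) _; rewrite lerD.
Qed.

(** Values are taken in [R] and not in [K], so that real arithmetic applies also over the complex
    numbers. The sum, unlike the maximum, is submultiplicative for all shapes of matrices. *)
Definition mx_norm1 m n (A : 'M[K]_(m, n)) : R := \sum_i \sum_j nK (A i j).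
Local Notation nM := mx_norm1.

Lemma nM_ge0 m n (A : 'M[K]_(m, n)) : 0 <= nM A.
Proof. by apply: sumr_ge0 => i _; apply: sumr_ge0 => j _; apply: nK_ge0. Qed.

Lemma nM0 m n : nM (0 : 'M[K]_(m, n)) = 0.
Proof.
by rewrite /nM big1 // => i _; rewrite big1 // => j _; rewrite mxE nK0.
Qed.

Lemma nMD m n (A B : 'M[K]_(m, n)) : nM (A + B) <= nM A + nM B.
Proof.
rewrite /nM -big_split; apply: ler_sum => i _; rewrite -big_split.
by apply: ler_sum => j _; rewrite mxE nKD.
Qed.

Lemma nMN m n (A : 'M[K]_(m, n)) : nM (- A) = nM A.
Proof.
by apply: eq_bigr => i _; apply: eq_bigr => j _; rewrite mxE nKN.
Qed.

Lemma nMB m n (A B : 'M[K]_(m, n)) : nM (A - B) <= nM A + nM B.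
Proof. by rewrite -(nMN B) nMD. Qed.

Lemma nM_distC m n (A B : 'M[K]_(m, n)) : nM (A - B) = nM (B - A).
Proof. by rewrite -nMN opprB. Qed.

Lemma nM_tri m n (B A C : 'M[K]_(m, n)) : nM (A - C) <= nM (A - B) + nM (B - C).
Proof. by apply: le_trans (nMD _ _); rewrite addrA subrK. Qed.

Lemma nMZ m n a (A : 'M[K]_(m, n)) : nM (a *: A) = nK a * nM A.
Proof.
rewrite /nM mulr_sumr; apply: eq_bigr => i _; rewrite mulr_sumr.
by apply: eq_bigr => j _; rewrite mxE nKM.
Qed.

Lemma nM_entry m n (A : 'M[K]_(m, n)) i j : nK (A i j) <= nM A.
Proof.
rewrite /nM (bigD1 i) //= (bigD1 j) //= -addrA lerDl.
rewrite addr_ge0 ?sumr_ge0 // => k _; first exact: nK_ge0.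
by apply: sumr_ge0 => l _; apply: nK_ge0.
Qed.

Lemma nM_eq0 m n (A : 'M[K]_(m, n)) : nM A <= 0 -> A = 0.
Proof.
move=> A0; apply/matrixP => i j; rewrite mxE; apply: nK_eq0; apply/le_anti.
by rewrite nK_ge0 (le_trans (nM_entry A i j)).
Qed.

Lemma nM_mul m n p (A : 'M[K]_(m, n)) (B : 'M[K]_(n, p)) :
  nM (A *m B) <= nM A * nM B.
Proof.
rewrite /nM mulr_suml; apply: ler_sum => i _.
apply: (@le_trans _ _ (\sum_k \sum_j nK (A i j) * nK (B j k))).
  apply: ler_sum => k _; rewrite mxE; apply: le_trans (nK_sum _ _ _) _.
  by apply: ler_sum => j _; rewrite nKM.
rewrite exchange_big mulr_suml; apply: ler_sum => j _ /=.
rewrite -mulr_sumr ler_wpM2l ?nK_ge0 // (bigD1 j) //= lerDl.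
by apply: sumr_ge0 => l _; apply: sumr_ge0 => k _; apply: nK_ge0.
Qed.

Lemma nM_sum I (r : seq I) P m n (F : I -> 'M[K]_(m, n)) :
  nM (\sum_(i <- r | P i) F i) <= \sum_(i <- r | P i) nM (F i).
Proof.
elim/big_ind2: _ => [|x u y v hx hy|//]; first by rewrite nM0.
by apply: le_trans (nMD _ _) _; rewrite lerD.
Qed.

Lemma nM_linear m n p q (f : {linear 'M[K]_(m, n) -> 'M[K]_(p, q)}) :
  exists2 C, 0 <= C & forall A, nM (f A) <= C * nM A.
Proof.
pose C := \sum_i \sum_j nM (f (delta_mx i j)).
have C0 : 0 <= C by apply: sumr_ge0 => i _; apply: sumr_ge0 => j _; apply: nM_ge0.
exists C => // A; rewrite {1}(matrix_sum_delta A) linear_sum /=.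
apply: le_trans (nM_sum _ _ _) _; rewrite mulr_suml; apply: ler_sum => i _.
rewrite linear_sum; apply: le_trans (nM_sum _ _ _) _.
rewrite mulr_suml; apply: ler_sum => j _; rewrite linearZ nMZ mulrC.
by rewrite ler_wpM2l ?nM_ge0 ?nM_entry.
Qed.

Lemma geometric_cvg_mx m n (u : nat -> 'M[K]_(m, n)) (C : R) :
  (forall k, nM (u k.+1 - u k) <= C / 2 ^+ k) ->
  exists l, forall k, nM (u k - l) <= (m * n)%:R * (4 * C) / 2 ^+ k.
Proof.
move=> uC.
have H i j : exists l, forall k, nK (u k i j - l) <= 4 * C / 2 ^+ k.
  apply: geometric_cvg => k; apply: le_trans (uC k).
  by have := nM_entry (u k.+1 - u k) i j; rewrite !mxE.
have {H} [l Hl] : exists l : 'M[K]_(m, n), forall i j k,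
    nK (u k i j - l i j) <= 4 * C / 2 ^+ k.
  exists (\matrix_(i, j) projT1 (cid (H i j))) => i j k; rewrite mxE.
  by case: (cid (H i j)) => l /= Hl; apply: Hl.
exists l => k.
rewrite /nM natrM -!mulrA mulr_natl -[X in _ *+ X]card_ord -sumr_const.
apply: ler_sum => i _; rewrite mulr_natl -[X in _ *+ X]card_ord -sumr_const.
by apply: ler_sum => j _; rewrite !mxE mulrA; apply: Hl.
Qed.

Lemma ltr_exp2_nat (k : nat) : (k%:R : R) < 2 ^+ k.
Proof. by rewrite -natrX ltr_nat ltn_expl. Qed.

(** Limits below come with an error [C / 2 ^+ k]; this is how such an estimate, valid for all [k],
    becomes an exact statement. It rests on the Archimedean property and [k < 2 ^+ k]. *)
Lemma halves_to0 (x C : R) : (forall k, x <= C / 2 ^+ k) -> x <= 0.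
Proof.
move=> H; rewrite leNgt; apply/negP => x0.
have C0 : 0 <= C by have := H 0; rewrite expr0 divr1; lra.
have /archi_boundP : 0 <= C / x by rewrite divr_ge0 // ltW.
set k := Num.bound _ => Hk; have := H k.
rewrite ler_pdivlMr ?exprn_gt0 // leNgt => /negP; apply.
rewrite mulrC -ltr_pdivrMr //; apply: lt_trans Hk _; exact: ltr_exp2_nat.
Qed.

End Norm.

(** * Derivatives over a normed field *)

Section Derivative.
Variables (R : realType) (K : numFieldType) (nd : norm_data R K).
Local Notation nK := (nK nd).
Local Notation nM := (mx_norm1 nd).
Local Notation emb := (emb nd).

Section General.
Variables (V : zmodType) (nV : V -> R).
Hypothesis nV_ge0 : forall h, 0 <= nV h.

(** A Fréchet derivative whose candidate [L] is a bare bounded function, and whose domain has an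
    arbitrary size function [nV]: one notion covers curves in [K] and maps between row vectors. *)
Definition hasD m n (f : V -> 'M[K]_(m, n)) u (L : V -> 'M[K]_(m, n)) :=
  (exists C, forall h, nM (L h) <= C * nV h) /\
  forall e, 0 < e -> exists2 d, 0 < d &
    forall h, nV h < d -> nM (f (u + h) - f u - L h) <= e * nV h.

Lemma hasD_bound m n (f : V -> 'M[K]_(m, n)) u L : hasD f u L ->
  exists2 C, 0 < C & forall h, nM (L h) <= C * nV h.
Proof.
case=> -[C HC] _; exists (`|C| + 1); first by have := normr_ge0 C; lra.
move=> h; apply: le_trans (HC h) _; apply: ler_wpM2r => //.
by have := ler_norm C; lra.
Qed.

Lemma hasD_cont m n (f : V -> 'M[K]_(m, n)) u L : hasD f u L ->
  forall e, 0 < e -> exists2 d, 0 < d &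
    forall h, nV h < d -> nM (f (u + h) - f u) < e.
Proof.
move=> Hf e e0; have [C C0 HC] := hasD_bound Hf.
have [d d0 Hd] := Hf.2 1 ltr01.
have C1 : 0 < C + 1 by lra.
exists (Num.min d (e / (C + 1))); first by rewrite lt_min d0 divr_gt0.
move=> h; rewrite lt_min ltr_pdivlMr // => /andP[/Hd h1 h2].
have := nMD nd (f (u + h) - f u - L h) (L h); rewrite subrK.
have := HC h; nra.
Qed.

Lemma hasD_eq m n (f g : V -> 'M[K]_(m, n)) u L L' :
  (forall v, f v = g v) -> (forall h, L h = L' h) -> hasD f u L -> hasD g u L'.
Proof. by move=> /funext -> /funext ->. Qed.

Lemma hasD_cst m n (c : 'M[K]_(m, n)) u : hasD (fun=> c) u (fun=> 0).
Proof.
split=> [|e e0]; first by exists 0 => h; rewrite nM0 mul0r.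
by exists 1 => // h _; rewrite subrr subr0 nM0 mulr_ge0 // ltW.
Qed.

Lemma hasD_add m n (f g : V -> 'M[K]_(m, n)) u L L' :
  hasD f u L -> hasD g u L' ->
  hasD (fun v => f v + g v) u (fun h => L h + L' h).
Proof.
move=> [[C HC] Hf] [[C' HC'] Hg]; split.
  exists (C + C') => h; apply: le_trans (nMD _ _ _) _.
  by rewrite mulrDl lerD.
move=> e e0; have e20 : 0 < e / 2 by lra.
have [d d0 Hd] := Hf _ e20; have [d' d'0 Hd'] := Hg _ e20.
exists (Num.min d d'); first by rewrite lt_min d0.
move=> h; rewrite lt_min => /andP[/Hd h1 /Hd' h2].
have -> : f (u + h) + g (u + h) - (f u + g u) - (L h + L' h) =
  (f (u + h) - f u - L h) + (g (u + h) - g u - L' h).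
  by apply/matrixP => i j; rewrite !mxE; ring.
by apply: le_trans (nMD _ _ _) _; lra.
Qed.

Lemma hasD_lin m n p q (F : {linear 'M[K]_(m, n) -> 'M[K]_(p, q)}) f u L :
  hasD f u L -> hasD (fun v => F (f v)) u (fun h => F (L h)).
Proof.
move=> Hf; have [C C0 HC] := hasD_bound Hf.
have [B B0 HB] := nM_linear nd F; split.
  exists (B * C) => h; apply: le_trans (HB _) _.
  by rewrite -mulrA ler_wpM2l.
move=> e e0; have eB : 0 < e / (B + 1) by rewrite divr_gt0 //; lra.
have [d d0 Hd] := Hf.2 _ eB; exists d => // h /Hd h1.
rewrite -!linearB; apply: le_trans (HB _) _.
have -> : e * nV h = (B + 1) * (e / (B + 1) * nV h).
  by rewrite mulrA [(B + 1) * _]mulrC divfK //; lra.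
apply: ler_pM => //; [exact: nM_ge0|lra].
Qed.

Lemma hasD_sub m n (f g : V -> 'M[K]_(m, n)) u L L' :
  hasD f u L -> hasD g u L' ->
  hasD (fun v => f v - g v) u (fun h => L h - L' h).
Proof.
move=> Hf Hg; apply: hasD_add => //.
exact: (@hasD_lin _ _ _ _ (@GRing.opp 'M[K]_(m, n))).
Qed.

Lemma hasD_mul m n p (f : V -> 'M[K]_(m, n)) (g : V -> 'M[K]_(n, p)) u L L' :
  hasD f u L -> hasD g u L' ->
  hasD (fun v => f v *m g v) u (fun h => L h *m g u + f u *m L' h).
Proof.
move=> Hf Hg.
have [C C0 HC] := hasD_bound Hf; have [C' C'0 HC'] := hasD_bound Hg.
split.
  exists (C * nM (g u) + nM (f u) * C') => h; apply: le_trans (nMD _ _ _) _.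
  rewrite mulrDl; apply: lerD; apply: le_trans (nM_mul _ _ _) _.
    by rewrite mulrAC ler_wpM2r ?nM_ge0.
  by rewrite -mulrA ler_wpM2l ?nM_ge0.
move=> e e0.
(* The summands are the factors that appear in the bounds [n1], [n2] and [n3] of the three pieces of
   the remainder. *)
pose B := nM (g u) + 1 + C + nM (f u).
have B0 : 0 < B by have := nM_ge0 nd (g u); have := nM_ge0 nd (f u); rewrite /B; lra.
have eB : 0 < e / B by rewrite divr_gt0.
have [d1 d10 H1] := Hf.2 _ eB; have [d2 d20 H2] := Hg.2 _ eB.
have [d3 d30 H3] := hasD_cont Hg ltr01.
have [d4 d40 H4] := hasD_cont Hg eB.
exists (Num.min (Num.min d1 d2) (Num.min d3 d4)); first by rewrite !lt_min d10 d20 d30.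
move=> h; rewrite !lt_min => /andP[/andP[/H1 h1 /H2 h2] /andP[/H3 h3 /H4 h4]].
have -> : f (u + h) *m g (u + h) - f u *m g u - (L h *m g u + f u *m L' h) =
  (f (u + h) - f u - L h) *m g (u + h) + L h *m (g (u + h) - g u)
  + f u *m (g (u + h) - g u - L' h).
  rewrite !mulmxBl !mulmxBr; set a := f (u + h) *m _; set b := f u *m g (u + h).
  set c := f u *m g u; set x := L h *m _; set y := L h *m _; set z := f u *m _.
  by apply/matrixP => i j; rewrite !mxE; ring.
have n1 : nM ((f (u + h) - f u - L h) *m g (u + h)) <=
          e / B * nV h * (nM (g u) + 1).
  apply: le_trans (nM_mul _ _ _) _; apply: ler_pM; rewrite ?nM_ge0 //.
  by have := nMD nd (g (u + h) - g u) (g u); rewrite subrK; lra.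
have n2 : nM (L h *m (g (u + h) - g u)) <= C * nV h * (e / B).
  by apply: le_trans (nM_mul _ _ _) _; apply: ler_pM; rewrite ?nM_ge0 // ltW.
have n3 : nM (f u *m (g (u + h) - g u - L' h)) <= nM (f u) * (e / B * nV h).
  by apply: le_trans (nM_mul _ _ _) _; rewrite ler_wpM2l ?nM_ge0.
apply: le_trans (nMD _ _ _) _.
have := nMD nd ((f (u + h) - f u - L h) *m g (u + h)) (L h *m (g (u + h) - g u)).
have -> : e * nV h = (e / B) * B * nV h by rewrite divfK // gt_eqF.
by rewrite {2}/B => n4; lra.
Qed.

Lemma hasD_mull m n p (f : V -> 'M[K]_(m, n)) (B : 'M[K]_(n, p)) u L :
  hasD f u L -> hasD (fun v => f v *m B) u (fun h => L h *m B).
Proof. exact: (@hasD_lin _ _ _ _ (mulmxr B)). Qed.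

Lemma hasD_mulr m n p (f : V -> 'M[K]_(m, n)) (B : 'M[K]_(p, m)) u L :
  hasD f u L -> hasD (fun v => B *m f v) u (fun h => B *m L h).
Proof. exact: (@hasD_lin _ _ _ _ (mulmx B)). Qed.

End General.

Local Notation hasJ f u J := (hasD (@mx_norm1 _ _ nd _ _) f u (fun h => h *m J)).
Local Notation hasd f t D := (hasD nK f t (fun h : K => h *: D)).

Lemma hasD_comp (V : zmodType) (nV : V -> R) n p (g : V -> 'rV[K]_n)
    (f : 'rV[K]_n -> 'rV[K]_p) u L J :
  (forall h, 0 <= nV h) -> hasD nV g u L -> hasJ f (g u) J ->
  hasD nV (fun v => f (g v)) u (fun h => L h *m J).
Proof.
move=> nV0 Hg Hf.
have [C C0 HC] := hasD_bound nV0 Hg.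
split.
  exists (C * nM J) => h; apply: le_trans (nM_mul _ _ _) _.
  by rewrite mulrAC ler_wpM2r ?nM_ge0.
move=> e e0.
pose B := C + 1 + nM J; have J0 := nM_ge0 nd J.
have B0 : 0 < B by rewrite /B; lra.
have eB : 0 < e / B by rewrite divr_gt0.
have [d1 d10 H1] := Hf.2 _ eB.
have [d2 d20 H2] := hasD_cont nV0 Hg d10.
have [d3 d30 H3] := Hg.2 _ eB.
have [d4 d40 H4] := Hg.2 _ ltr01.
exists (Num.min d4 (Num.min d2 d3)); first by rewrite !lt_min d20 d30 d40.
move=> h; rewrite !lt_min => /andP[/H4 h4 /andP[/H2/H1 + /H3 h3]].
rewrite (addrC (g u)) subrK => h1.
have -> : f (g (u + h)) - f (g u) - L h *m J =
  (f (g (u + h)) - f (g u) - (g (u + h) - g u) *m J) +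
  (g (u + h) - g u - L h) *m J.
  by rewrite (mulmxBl _ (L h)) addrA subrK.
have n1 : nM (g (u + h) - g u) <= (C + 1) * nV h.
  have := nMD nd (g (u + h) - g u - L h) (L h); rewrite subrK.
  by have := HC h; lra.
have n2 : nM ((g (u + h) - g u - L h) *m J) <= e / B * nV h * nM J.
  by apply: le_trans (nM_mul _ _ _) _; rewrite ler_wpM2r.
apply: le_trans (nMD _ _ _) _.
have -> : e * nV h = (e / B) * B * nV h by rewrite divfK // gt_eqF.
rewrite {2}/B; have : e / B * nM (g (u + h) - g u) <= e / B * ((C + 1) * nV h).
  by rewrite ler_wpM2l // ltW.
lra.
Qed.

Lemma hasd_line n p (f : 'rV[K]_n -> 'rV[K]_p) u h (s : K) J :
  hasJ f (u + s *: h) J -> hasd (fun s => f (u + s *: h)) s (h *m J).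
Proof.
move=> H; apply: hasD_eq (hasD_comp (@nK_ge0 _ _ nd) (L := fun k => k *: h) _ H) => //.
  by move=> k; rewrite -scalemxAl.
split; first by exists (nM h) => k; rewrite nMZ mulrC.
move=> e e0; exists 1 => // k _.
by rewrite scalerDl addrA (addrC (u + _)) addrK subrr nM0 mulr_ge0 ?nK_ge0 // ltW.
Qed.

Lemma hasJ_id n (u : 'rV[K]_n) : hasJ id u 1%:M.
Proof.
split; first by exists 1 => h; rewrite mulmx1 mul1r.
by move=> e e0; exists 1 => // h _; rewrite mulmx1 [u + h]addrC addrK subrr nM0 mulr_ge0 ?nM_ge0
  ?ltW.
Qed.

(** Let [S] be the set of times at which the increment from 0 has slope at most [M + e]. The local
    estimate at its supremum, read to the left, puts the supremum in [S]; read to the right, it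
    prevents the supremum from lying below 1. *)
Lemma mean_value01 m n (g : R -> 'M[K]_(m, n)) M :
  (forall t e, 0 <= t <= 1 -> 0 < e -> exists2 d, 0 < d &
     forall t', 0 <= t' <= 1 -> `|t' - t| < d ->
       nM (g t' - g t) <= (M + e) * `|t' - t|) ->
  nM (g 1 - g 0) <= M.
Proof.
move=> H; apply/ler_addgt0Pr => e e0.
pose S := [set t | 0 <= t <= 1 /\ nM (g t - g 0) <= (M + e) * t].
have S0 : S 0 by split; rewrite ?lexx ?ler01 // subrr nM0 mulr0.
have Sub : ubound S 1 by move=> t [/andP[]].
have hS : has_sup S by split; [exists 0|exists 1].
set s := sup S.
have s0 : 0 <= s by apply: ub_le_sup S0; exists 1.
have s1 : s <= 1 by apply: ge_sup Sub; exists 0.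
have s01 : 0 <= s <= 1 by rewrite s0.
have [d d0 Hd] := H s e s01 e0.
have Ss : S s.
  split=> //; have [t St ts] := sup_adherent d0 hS.
  have [/andP[t0 t1] gt] := St.
  have tles : t <= s by apply: ub_le_sup St; exists 1.
  have : `|t - s| < d by rewrite ler0_norm -/s; move: ts; rewrite -/s; lra.
  move=> /Hd; rewrite t0 t1 => /(_ isT); rewrite nM_distC ler0_norm; last by lra.
  move=> h; apply: le_trans (nM_tri _ (g t) _ _) _.
  by rewrite opprB in h; lra.
have [s_lt1|] := ltP s 1; last first.
  move=> s_ge1; have s_1 : s = 1 by lra.
  by have := Ss.2; rewrite s_1 mulr1.
have [t [ts t1 tsd]] : exists t, [/\ s < t, t <= 1 & t <= s + d / 2].
  exists (Num.min 1 (s + d / 2)); rewrite lt_min s_lt1 !ge_min !lexx orbT.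
  by split=> //=; lra.
have t01 : 0 <= t <= 1 by lra.
have tn : `|t - s| = t - s by rewrite ger0_norm //; lra.
have td : `|t - s| < d by rewrite tn; lra.
have := Hd t t01 td; rewrite tn => h.
suff /(ub_le_sup (ex_intro _ 1 Sub)) : S t by rewrite -/s; lra.
split=> //; apply: le_trans (nM_tri _ (g s) _ _) _.
by have := Ss.2; lra.
Qed.

(** Restricting [f] to the segment from 0 to [x], with a real parameter embedded in [K], reduces to
    [mean_value01] over either field. *)
Lemma mean_value m n (f : K -> 'M[K]_(m, n)) D M x :
  nK x <= 1 -> (forall s, nK s <= 1 -> hasd f s (D s) /\ nM (D s) <= M) ->
  nM (f x - f 0) <= M.
Proof.
move=> x1 H.
have := @mean_value01 m n (fun t => f (emb t * x)) M.
rewrite rmorph1 rmorph0 mul1r mul0r; apply => t e t01 e0.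
have tx1 : nK (emb t * x) <= 1.
  rewrite nKM nK_emb ger0_norm; last by lra.
  by have := nK_ge0 nd x; nra.
have [[_ /(_ _ e0)[d d0 Hd]] HM] := H _ tx1.
exists d => // t' _ t'd.
have E : nK (emb (t' - t) * x) <= `|t' - t|.
  rewrite nKM nK_emb; have := normr_ge0 (t' - t).
  by have := nK_ge0 nd x; nra.
have := Hd (emb (t' - t) * x) (le_lt_trans E t'd).
rewrite -mulrDl -rmorphD [t + _]addrC subrK => h.
have := nMD nd (f (emb t' * x) - f (emb t * x) - (emb (t' - t) * x) *: D (emb t * x))
  ((emb (t' - t) * x) *: D (emb t * x)).
rewrite subrK nMZ => h2.
have h3 : nK (emb (t' - t) * x) * nM (D (emb t * x)) <= `|t' - t| * M.
  by apply: ler_pM; rewrite ?nK_ge0 ?nM_ge0.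
have h4 : e * nK (emb (t' - t) * x) <= e * `|t' - t| by rewrite ler_wpM2l // ltW.
lra.
Qed.

End Derivative.
Notation hasJ nd f u J := (hasD nd (@mx_norm1 _ _ nd _ _) f u (fun h => h *m J)).
Notation hasd nd f t D := (hasD nd (nK nd) f t (fun h => h *: D)).

(** * The matrix exponential *)

Section Exponential.
Variables (R : realType) (K : numFieldType) (nd : norm_data R K).
Local Notation nK := (nK nd).
Local Notation nM := (mx_norm1 nd).
Local Notation hasd f t D := (hasd nd f t D).

Lemma hasd_affine m n (f : K -> 'M[K]_(m, n)) a h s D :
  hasd f (a + s * h) D -> hasd (fun s => f (a + s * h)) s (h *: D).
Proof.
move=> [[C HC] H]; split.
  by exists (nM (h *: D)) => k; rewrite nMZ mulrC.
move=> e e0.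
have h1 : 0 < nK h + 1 by have := nK_ge0 nd h; lra.
have eh : 0 < e / (nK h + 1) by rewrite divr_gt0.
have [d d0 Hd] := H _ eh.
exists (d / (nK h + 1)); first by rewrite divr_gt0.
move=> k; rewrite ltr_pdivlMr // => kd.
have kh : nK (k * h) <= nK k * (nK h + 1).
  by rewrite nKM ler_wpM2l ?nK_ge0 //; lra.
rewrite mulrDl addrA scalerA; apply: le_trans (Hd _ (le_lt_trans kh kd)) _.
apply: le_trans (ler_wpM2l (ltW eh) kh) _.
by rewrite [nK k * _]mulrC mulrA divfK // gt_eqF.
Qed.

Lemma mean_value_seg m n (f : K -> 'M[K]_(m, n)) D a h M :
  (forall s, nK (s - a) <= nK h -> hasd f s (D s) /\ nM (D s) <= M) ->
  nM (f (a + h) - f a) <= nK h * M.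
Proof.
move=> H.
have := @mean_value _ _ nd _ _ (fun s => f (a + s * h)) (fun s => h *: D (a + s * h))
  (nK h * M) 1.
rewrite nK1 lexx mul1r mul0r addr0; apply=> // s s1.
have [|h1 h2] := H (a + s * h).
  by rewrite [a + _]addrC addrK nKM; have := nK_ge0 nd h; nra.
by split; [exact: hasd_affine|rewrite nMZ ler_wpM2l ?nK_ge0].
Qed.

Lemma der0_cst m n (f : K -> 'M[K]_(m, n)) t :
  (forall s, hasd f s 0) -> f t = f 0.
Proof.
move=> H; apply/eqP; rewrite -subr_eq0; apply/eqP; apply: (@nM_eq0 _ _ nd).
have := @mean_value_seg m n f (fun=> 0) 0 t 0; rewrite add0r mulr0.
by apply=> s _; rewrite nM0.
Qed.

Variable d : nat.
Implicit Types A B : 'M[K]_d.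

Definition mpow A k : 'M[K]_d := iter k (fun B => B *m A) 1%:M.
Definition exp_sum A n : 'M[K]_d := \sum_(k < n) (k`!%:R)^-1 *: mpow A k.

Lemma mpow_comm A k : A *m mpow A k = mpow A k *m A.
Proof.
by elim: k => [|k IH]; rewrite ?mulmx1 ?mul1mx //= mulmxA IH.
Qed.

Lemma nM_mpow A k : nM (mpow A k) <= nM (1%:M : 'M[K]_d) * nM A ^+ k.
Proof.
elim: k => [|k IH]; first by rewrite mulr1.
rewrite exprSr mulrA; apply: le_trans (nM_mul _ _ _) _.
by rewrite ler_wpM2r ?nM_ge0.
Qed.

(** Origin of [exp_cst]: if the norm of [A] is at most [c / 2], the k-th term of the exponential
    series is at most a constant times [c ^ k / (2 ^ k k!)], hence times [c ^ c / 2 ^ k]. This is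
    the geometric decay that [geometric_cvg] asks for. *)
Lemma expn_le_fact c k : (c ^ k <= c ^ c * k`!)%N.
Proof.
case: c => [|c]; first by case: k => // k; rewrite exp0n.
elim: k => [|k IH]; first by rewrite muln1 expn_gt0.
have [kc|ck] := leqP k.+1 c.+1.
  apply: (@leq_trans (c.+1 ^ c.+1)); first by rewrite leq_pexp2l.
  by rewrite leq_pmulr // fact_gt0.
rewrite expnS factS mulnCA; apply: leq_mul => //; lia.
Qed.

Definition exp_cst (c : nat) : R := nM (1%:M : 'M[K]_d) * (c ^ c)%:R.

Lemma exp_cst_ge0 c : 0 <= exp_cst c.
Proof. by rewrite mulr_ge0 ?nM_ge0. Qed.

Lemma exp_term_bound A (c : nat) k : nM A <= c%:R / 2 ->
  nM (exp_sum A k.+1 - exp_sum A k) <= exp_cst c / 2 ^+ k.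
Proof.
move=> Ac; rewrite /exp_sum big_ord_recr /= [_ + _ *: _]addrC addrK nMZ nKV nK_nat.
rewrite mulrC ler_pdivrMr ?ltr0n ?fact_gt0 //.
apply: le_trans (nM_mpow _ _) _; rewrite /exp_cst -!mulrA ler_wpM2l ?nM_ge0 //.
apply: (@le_trans _ _ ((c%:R / 2) ^+ k)); first by rewrite lerXn2r ?nnegrE ?nM_ge0 // divr_ge0.
rewrite exprMn exprVn mulrCA mulrC ler_wpM2l ?invr_ge0 ?exprn_ge0 //.
by rewrite -natrX -natrM ler_nat expn_le_fact.
Qed.

Lemma nat_double_bound (x : R) : exists c : nat, x <= c%:R / 2.
Proof.
exists (Num.bound (2 * `|x|)).
have /archi_boundP : 0 <= 2 * `|x| by rewrite mulr_ge0.
by have := ler_norm x; lra.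
Qed.

(** One limit must satisfy the error bound of every admissible [c]: limits obtained from different
    [c] agree, being approached by the same sums. This freedom in [c] makes [mexp_bound] uniform on
    balls. *)
Lemma exp_sum_cvg A : exists l, forall c : nat, nM A <= c%:R / 2 -> forall k,
  nM (exp_sum A k - l) <= (d * d)%:R * (4 * exp_cst c) / 2 ^+ k.
Proof.
have [c0 Hc0] := nat_double_bound (nM A).
have [l Hl] := geometric_cvg_mx (fun k => exp_term_bound k Hc0).
exists l => c Hc; have [l' Hl'] := geometric_cvg_mx (fun k => exp_term_bound k Hc).
suff -> : l = l' by [].
apply/eqP; rewrite -subr_eq0; apply/eqP; apply: (@nM_eq0 _ _ nd).
apply: (@halves_to0 _ _ ((d * d)%:R * (4 * exp_cst c0) + (d * d)%:R * (4 * exp_cst c))) => k.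
apply: le_trans (nM_tri _ (exp_sum A k) _ _) _; rewrite mulrDl.
by rewrite nM_distC lerD.
Qed.

Definition mexp A : 'M[K]_d := projT1 (cid (exp_sum_cvg A)).

Lemma mexp_lim A (c : nat) k : nM A <= c%:R / 2 ->
  nM (exp_sum A k - mexp A) <= (d * d)%:R * (4 * exp_cst c) / 2 ^+ k.
Proof. by rewrite /mexp; case: cid => l /= Hl /Hl; apply. Qed.

Lemma exp_sum_bound A (c : nat) k : nM A <= c%:R / 2 ->
  nM (exp_sum A k) <= 2 * ((d * d)%:R * (4 * exp_cst c)).
Proof.
move=> Hc; have H0 := mexp_lim 0 Hc; have Hk := mexp_lim k Hc.
rewrite {1}/exp_sum big_ord0 sub0r nMN expr0 divr1 in H0.
have := nMD nd (exp_sum A k - mexp A) (mexp A); rewrite subrK => h.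
have : (d * d)%:R * (4 * exp_cst c) / 2 ^+ k <= (d * d)%:R * (4 * exp_cst c).
  rewrite ler_pdivrMr ?exprn_gt0 // ler_peMr //.
    by rewrite !mulr_ge0 ?nM_ge0 ?exp_cst_ge0.
  by apply: exprn_ege1; lra.
by lra.
Qed.

Lemma mexp_bound r : exists2 B, 0 <= B & forall A, nM A <= r -> nM (mexp A) <= B.
Proof.
have [c Hc] := nat_double_bound r.
exists ((d * d)%:R * (4 * exp_cst c)); first by rewrite !mulr_ge0 ?nM_ge0 ?exp_cst_ge0.
move=> A Ar; have := @mexp_lim A c 0 (le_trans Ar Hc).
by rewrite {1}/exp_sum big_ord0 sub0r nMN expr0 divr1.
Qed.

Lemma mexp_cvg A : exists C, forall k, nM (exp_sum A k - mexp A) <= C / 2 ^+ k.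
Proof.
have [c Hc] := nat_double_bound (nM A).
by exists ((d * d)%:R * (4 * exp_cst c)) => k; apply: mexp_lim.
Qed.

Lemma lim_le m n (u : nat -> 'M[K]_(m, n)) l C b :
  (forall k, nM (u k - l) <= C / 2 ^+ k) -> (forall k, nM (u k) <= b) -> nM l <= b.
Proof.
move=> H1 H2; rewrite -subr_le0; apply: (@halves_to0 _ _ C) => k.
have := nMD nd (l - u k) (u k); rewrite subrK nM_distC.
by have := H1 k; have := H2 k; lra.
Qed.

Lemma lim_linear m n p q (F : {linear 'M[K]_(m, n) -> 'M[K]_(p, q)}) u l C :
  (forall k : nat, nM (u k - l) <= C / 2 ^+ k) ->
  exists C', forall k, nM (F (u k) - F l) <= C' / 2 ^+ k.
Proof.
move=> H; have [B B0 HB] := nM_linear nd F; exists (B * C) => k.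
by rewrite -linearB -mulrA; apply: le_trans (HB _) _; rewrite ler_wpM2l.
Qed.

(** Linear conditions are closed: what all partial sums of the exponential satisfy, the exponential
    satisfies. *)
Lemma lim_ker m n p q (F : {linear 'M[K]_(m, n) -> 'M[K]_(p, q)}) u l C :
  (forall k : nat, nM (u k - l) <= C / 2 ^+ k) -> (forall k, F (u k) = 0) -> F l = 0.
Proof.
move=> H F0; have [C' HC'] := lim_linear F H; apply: (@nM_eq0 _ _ nd).
by apply: lim_le HC' _ => k; rewrite F0 nM0.
Qed.

Lemma mexp_comm A : A *m mexp A = mexp A *m A.
Proof.
have [C HC] := mexp_cvg A; apply/eqP; rewrite -subr_eq0; apply/eqP.
have L : linear (fun B : 'M[K]_d => A *m B - B *m A).
  by move=> a B B'; rewrite mulmxDr mulmxDl -scalemxAr -scalemxAl scalerBr opprD addrACA.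
pose F := HB.pack_for {linear 'M[K]_d -> 'M[K]_d} (fun B : 'M[K]_d => A *m B - B *m A)
  (GRing.isLinear.Build _ _ _ _ _ L).
apply: (@lim_ker _ _ _ _ F _ _ _ HC) => k; apply/eqP; rewrite subr_eq0; apply/eqP.
rewrite /exp_sum mulmx_suml mulmx_sumr; apply: eq_bigr => i _.
by rewrite -scalemxAr -scalemxAl mpow_comm.
Qed.

(** A subspace, presented as the left kernel of [C], that is stable under [A] is stable under every
    power of [A], hence under the partial sums and their limit. *)
Lemma mexp_stable A p (C : 'M[K]_(d, p)) (y : 'rV[K]_d) :
  (forall v : 'rV[K]_d, v *m C = 0 -> v *m A *m C = 0) ->
  y *m C = 0 -> y *m mexp A *m C = 0.
Proof.
move=> H yC; have [B HB] := mexp_cvg A.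
have L : linear (fun B : 'M[K]_d => y *m B *m C).
  by move=> a B1 B2; rewrite mulmxDr mulmxDl -scalemxAr -scalemxAl.
pose F := HB.pack_for {linear 'M[K]_d -> 'M[K]_(1, p)} (fun B : 'M[K]_d => y *m B *m C)
  (GRing.isLinear.Build _ _ _ _ _ L).
apply: (@lim_ker _ _ _ _ F _ _ _ HB) => k /=.
rewrite /exp_sum mulmx_sumr mulmx_suml big1 // => i _.
rewrite -scalemxAr -scalemxAl; suff -> : y *m mpow A i *m C = 0 by rewrite scaler0.
by elim: (nat_of_ord i) => [|j IH] /=; rewrite ?mulmx1 // mulmxA; apply: H.
Qed.

Lemma mexp0 : mexp 0 = 1%:M.
Proof.
have [C HC] := mexp_cvg 0; apply/esym/eqP; rewrite -subr_eq0; apply/eqP.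
apply: (@nM_eq0 _ _ nd); apply: (@halves_to0 _ _ (C + C)) => k.
have := HC k.+1; rewrite /exp_sum big_ord_recl /= invr1 scale1r big1 ?addr0.
  move=> /le_trans; apply; rewrite exprS invfM.
  have := nM_ge0 nd (exp_sum 0 0 - mexp 0); have := HC 0%N; rewrite expr0 divr1 => h1 h2.
  have : 0 <= (2 ^+ k)^-1 :> R by rewrite invr_ge0 exprn_ge0.
  have C0 : 0 <= C by lra.
  by nra.
by move=> i _; rewrite mulmx0 scaler0.
Qed.

Lemma hasd_scale A t : hasd (fun t => t *: A) t A.
Proof.
split; first by exists (nM A) => h; rewrite nMZ mulrC.
move=> e e0; exists 1 => // h _.
by rewrite scalerDl [_ *: _ + _]addrC addrK subrr nM0 mulr_ge0 ?nK_ge0 // ltW.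
Qed.

Lemma hasd_mpow A k t :
  hasd (fun t => mpow (t *: A) k.+1) t (k.+1%:R *: (mpow (t *: A) k *m A)).
Proof.
elim: k => [|k IH].
  apply: hasD_eq (hasd_scale A t) => [v|h]; first by rewrite /= mul1mx.
  by rewrite /= mul1mx scale1r.
apply: hasD_eq (hasD_mul (@nK_ge0 _ _ nd) IH (hasd_scale A t)) => [//|h].
rewrite -[mpow _ k.+1]/(mpow (t *: A) k *m (t *: A)).
set P := mpow _ _; rewrite -!scalemxAl -!scalemxAr -!scalemxAl !scalerA -scalerDl.
by congr (_ *: _); rewrite [k.+2%:R]mulrS; ring.
Qed.

Lemma hasd_exp_sum A n t :
  hasd (fun t => exp_sum (t *: A) n.+1) t (exp_sum (t *: A) n *m A).
Proof.
elim: n => [|n IH].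
  apply: hasD_eq (hasD_cst nd (@nK_ge0 _ _ nd) (1%:M : 'M[K]_d) t) => [v|h].
    by rewrite /exp_sum big_ord1 /= invr1 scale1r.
  by rewrite /exp_sum big_ord0 mul0mx scaler0.
have H := hasD_lin (@nK_ge0 _ _ nd) (@GRing.scale K 'M[K]_d (n.+1`!%:R)^-1) (hasd_mpow A n t).
apply: hasD_eq (hasD_add IH H) => [v|h].
  by rewrite /exp_sum [RHS]big_ord_recr.
have -> : exp_sum (t *: A) n.+1 = exp_sum (t *: A) n + (n`!%:R)^-1 *: mpow (t *: A) n.
  by rewrite /exp_sum big_ord_recr.
rewrite mulmxDl scalerDr; congr (_ + _).
rewrite -scalemxAl /= !scalerA; congr (_ *: _).
by rewrite factS natrM; field; rewrite -mulrS !pnatr_eq0 -lt0n fact_gt0.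
Qed.

(** The second-order remainder is bounded uniformly in [n]; this allows the limit in [n] to be taken
    at fixed [h] in [mexp_der]. *)
Lemma exp_sum_taylor A t : exists M, forall n h, nK h <= 1 ->
  nM (exp_sum ((t + h) *: A) n.+2 - exp_sum (t *: A) n.+2
      - h *: (exp_sum (t *: A) n.+1 *m A)) <= M * nK h ^+ 2.
Proof.
have [c Hc] := nat_double_bound ((nK t + 1) * nM A).
pose B := 2 * ((d * d)%:R * (4 * exp_cst c)).
have HB s n : nK (s - t) <= 1 -> nM (exp_sum (s *: A) n) <= B.
  move=> st; apply: exp_sum_bound; apply: le_trans Hc; rewrite nMZ.
  rewrite ler_wpM2r ?nM_ge0 //; have := nKD nd (s - t) t; rewrite subrK; lra.
exists (B * nM A * nM A) => n h h1.
(* The first-order part at [t] is subtracted, so the derivative [D] of [G] vanishes to first order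
   at [t] up to truncation-free terms; a second mean value estimate bounds it by a multiple of
   [nK h]. *)
pose G s := exp_sum (s *: A) n.+2 - (s - t) *: (exp_sum (t *: A) n.+1 *m A).
pose D s := exp_sum (s *: A) n.+1 *m A - exp_sum (t *: A) n.+1 *m A.
have EG : G (t + h) - G t = exp_sum ((t + h) *: A) n.+2 - exp_sum (t *: A) n.+2
      - h *: (exp_sum (t *: A) n.+1 *m A).
  by rewrite /G subrr scale0r subr0 [t + h - t]addrC addKr addrAC.
have H := @mean_value_seg _ _ G D t h (nK h * (B * nM A) * nM A).
rewrite -EG; apply: le_trans (H _) _; last by rewrite expr2; lra.
move=> s sh; split.
  apply: hasD_eq (hasD_sub (@nK_ge0 _ _ nd) (hasd_exp_sum A n.+1 s)
   (hasD_lin (@nK_ge0 _ _ nd) (mulmx (exp_sum (t *: A) n.+1))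
     (hasD_sub (@nK_ge0 _ _ nd) (hasd_scale A s) (hasD_cst nd (@nK_ge0 _ _ nd) (t *: A) s)))) =>
       v.
    by rewrite -scalerBl /= -scalemxAr.
  by rewrite subr0 /= /D scalerBr -scalemxAr.
rewrite /D -mulmxBl; apply: le_trans (nM_mul _ _ _) _; rewrite ler_wpM2r ?nM_ge0 //.
have := @mean_value_seg _ _ (fun s => exp_sum (s *: A) n.+1) (fun s => exp_sum (s *: A) n *m A)
  t (s - t) (B * nM A).
rewrite [t + _]addrC subrK => H2.
apply: le_trans (H2 _) _.
  move=> s' s's; split; first exact: hasd_exp_sum.
  apply: le_trans (nM_mul _ _ _) _; rewrite ler_wpM2r ?nM_ge0 // HB //; lra.
rewrite ler_wpM2r ?mulr_ge0 ?nM_ge0 // /B !mulr_ge0 ?nM_ge0 ?exp_cst_ge0 //; lra.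
Qed.

Lemma mexp_der A t : hasd (fun t => mexp (t *: A)) t (mexp (t *: A) *m A).
Proof.
split; first by exists (nM (mexp (t *: A) *m A)) => h; rewrite nMZ mulrC.
have [M HM] := exp_sum_taylor A t.
have H h : nK h <= 1 -> nM (mexp ((t + h) *: A) - mexp (t *: A)
      - h *: (mexp (t *: A) *m A)) <= M * nK h ^+ 2.
  move=> h1.
  have [C1 H1] := mexp_cvg ((t + h) *: A); have [C2 H2] := mexp_cvg (t *: A).
  apply: (@lim_le _ _ (fun n => exp_sum ((t + h) *: A) n.+2 - exp_sum (t *: A) n.+2
      - h *: (exp_sum (t *: A) n.+1 *m A)) _ (C1 + C2 + nK h * (C2 * nM A))); last by move=> n;
        apply: HM.
  move=> k.
  have C10 : 0 <= C1 by have := H1 0%N; rewrite expr0 divr1;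
    have := nM_ge0 nd (exp_sum ((t + h) *: A) 0 - mexp ((t + h) *: A)); lra.
  have C20 : 0 <= C2 by have := H2 0%N; rewrite expr0 divr1;
    have := nM_ge0 nd (exp_sum (t *: A) 0 - mexp (t *: A)); lra.
  (* The sums occur with indices [k.+1] and [k.+2]; their errors are weakened to the common index
     [k]. *)
  have mono (C : R) j : 0 <= C -> C / 2 ^+ (j + k) <= C / 2 ^+ k.
    move=> C0; rewrite ler_wpM2l // lef_pV2 ?posrE ?exprn_gt0 //.
    by rewrite ler_weXn2l ?leq_addl //; lra.
  have -> : exp_sum ((t + h) *: A) k.+2 - exp_sum (t *: A) k.+2
      - h *: (exp_sum (t *: A) k.+1 *m A) - (mexp ((t + h) *: A) - mexp (t *: A)
      - h *: (mexp (t *: A) *m A)) = (exp_sum ((t + h) *: A) k.+2 - mexp ((t + h) *: A)) -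
        (exp_sum (t *: A) k.+2 - mexp (t *: A)) - h *:
          ((exp_sum (t *: A) k.+1 - mexp (t *: A)) *m A).
    rewrite mulmxBl scalerBr; set x := h *: _; set y := h *: _.
    by apply/matrixP => i j; rewrite !mxE; ring.
  apply: le_trans (nMB _ _ _) _; rewrite mulrDl; apply: lerD.
    apply: le_trans (nMB _ _ _) _; rewrite mulrDl.
    apply: lerD; [apply: le_trans (H1 _) _|apply: le_trans (H2 _) _]; exact: (mono _ 2%N).
  rewrite nMZ -mulrA ler_wpM2l ?nK_ge0 // mulrAC; apply: le_trans (nM_mul _ _ _) _.
  rewrite ler_wpM2r ?nM_ge0 //; apply: le_trans (H2 _) _; exact: (mono _ 1%N).
move=> e e0.
have M1 : 0 < `|M| + 1 by have := normr_ge0 M; lra.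
exists (Num.min 1 (e / (`|M| + 1))); first by rewrite lt_min ltr01 divr_gt0.
move=> h; rewrite lt_min ltr_pdivlMr // => /andP[/ltW /H h1 h2].
apply: le_trans h1 _; rewrite expr2 mulrA ler_wpM2r ?nK_ge0 //.
by have := nK_ge0 nd h; have := ler_norm M; nra.
Qed.

End Exponential.

(** * Linear differential equations with constant coefficients *)

Section Flow.
Variables (R : realType) (K : numFieldType) (nd : norm_data R K).
Local Notation hasd f t D := (hasd nd f t D).
Local Notation mexp := (mexp nd).
Local Notation nK0 := (@nK_ge0 _ _ nd).

(** Multiplying a solution by the exponential of [- t A] gives a function with zero derivative. *)
Lemma ode_unique m d (A : 'M[K]_d) (y : K -> 'M[K]_(m, d)) :
  (forall t, hasd y t (y t *m A)) -> forall t, y t *m mexp (t *: - A) = y 0.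
Proof.
move=> H t; pose f t := y t *m mexp (t *: - A).
have <- : f 0 = y 0 by rewrite /f scale0r mexp0 mulmx1.
apply: (@der0_cst _ _ nd _ _ f) => s.
apply: hasD_eq (hasD_mul nK0 (H s) (mexp_der nd (- A) s)) => // h.
rewrite -scalemxAl -scalemxAr scaler0 -scalerDr mulmxN mulmxN.
suff -> : mexp (s *: - A) *m A = A *m mexp (s *: - A).
  by rewrite !mulmxA subrr scaler0.
(* Commutation with [A] is obtained from commutation with [s *: - A] by cancelling [s], whence the
   separate case of 0. *)
have [->|s0] := eqVneq s 0; first by rewrite !scale0r mexp0 mul1mx mulmx1.
have /eqP := mexp_comm nd (s *: - A).
rewrite -scalemxAl -scalemxAr mulNmx mulmxN !scalerN eqr_opp => /eqP/(scalerI s0).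
by [].
Qed.

Lemma mexpN d (A : 'M[K]_d) : mexp A *m mexp (- A) = 1%:M.
Proof.
have := ode_unique (mexp_der nd A) 1; rewrite !scale1r scale0r mexp0; exact.
Qed.

Lemma mexpK m d (A : 'M[K]_d) (y : 'M[K]_(m, d)) : y *m mexp A *m mexp (- A) = y.
Proof. by rewrite -mulmxA mexpN mulmx1. Qed.

Lemma mexpNK m d (A : 'M[K]_d) (y : 'M[K]_(m, d)) : y *m mexp (- A) *m mexp A = y.
Proof. by rewrite -{2}(opprK A) mexpK. Qed.

Lemma mexp_unit d (A : 'M[K]_d) : mexp A \in unitmx.
Proof. by case: (mulmx1_unit (mexpN A)). Qed.

Lemma ode_uniqueE m d (A : 'M[K]_d) (y : K -> 'M[K]_(m, d)) :
  (forall t, hasd y t (y t *m A)) -> forall t, y t = y 0 *m mexp (t *: A).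
Proof. by move=> H t; rewrite -(ode_unique H t) scalerN mexpNK. Qed.

(** Conjugation by an exponential is the exponential of the commutator: the conjugate of [B] at time
    [t], as a vector, solves the linear equation with matrix [ad]. A subspace stable under [ad] is
    therefore stable under conjugation. *)
Lemma mexp_conj_stable d p (A B : 'M[K]_d) (C : 'M[K]_(d * d, p)) :
  (forall Z : 'M[K]_d, mxvec Z *m C = 0 -> mxvec (Z *m A - A *m Z) *m C = 0) ->
  mxvec B *m C = 0 -> mxvec (mexp (- A) *m B *m mexp A) *m C = 0.
Proof.
move=> H BC.
pose y t := mxvec (mexp (t *: - A) *m B *m mexp (t *: A)).
pose ad := lin_mulmxr A - lin_mulmx A.
have adE (Z : 'M[K]_d) : mxvec Z *m ad = mxvec (Z *m A - A *m Z).
  by rewrite mulmxBr !mul_vec_lin /= linearB.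
have Hy t : hasd y t (y t *m ad).
  rewrite adE; have := hasD_lin nK0 mxvec (hasD_mul nK0 (hasD_mull nK0 B (mexp_der nd (- A) t))
    (mexp_der nd A t)).
  have CM : mexp (t *: - A) *m A = A *m mexp (t *: - A).
    have [->|s0] := eqVneq t 0; first by rewrite !scale0r mexp0 mul1mx mulmx1.
    have /eqP := mexp_comm nd (t *: - A).
    by rewrite -scalemxAl -scalemxAr mulNmx mulmxN !scalerN eqr_opp => /eqP/(scalerI s0).
  apply: hasD_eq => // h; rewrite -[RHS]linearZ; congr (mxvec _).
  by rewrite mulmxN CM -!scalemxAl -scalemxAr -scalerDr !mulNmx addrC !mulmxA.
have := ode_uniqueE Hy 1; rewrite /y !scale1r !scale0r mexp0 mul1mx mulmx1 => ->.
apply: mexp_stable BC => v; rewrite -[v]vec_mxK adE; exact: H.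
Qed.

End Flow.

(** * Slices of the orbits of a matrix group *)

Section Orbit.
Variables (R : realType) (K : numFieldType) (nd : norm_data R K).
Local Notation nK := (nK nd).
Local Notation nM := (@mx_norm1 _ _ nd _ _).
Local Notation hasd f t D := (hasd nd f t D).
Local Notation hasJ f u J := (hasJ nd f u J).
Local Notation mexp := (mexp nd).
Local Notation nMp := (fun m n => @nM_ge0 _ _ nd m n).

(** Applied to [tan_mx X]: [s] selects independent gauge directions spanning the tangent space at
    [X], and [p] is a linear projection restricting to coordinates on it. *)
Lemma rank_factor m n (A : 'M[K]_(m, n)) :
  exists s : 'M[K]_(\rank A, m), exists p, s *m A *m p = 1%:M.
Proof.
have /submxP[s Es] : (row_base A <= A)%MS by rewrite eq_row_base.
have /row_freeP[p Ep] := row_base_free A.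
by exists s, p; rewrite -Es.
Qed.

(** From [A = A Q - A (Q - 1)]. It yields both invertibility of [Q], with [A] its kernel, and the
    bound on the inverse, with [A] that inverse. *)
Lemma near1_bound k m (A : 'M[K]_(k, m)) (Q : 'M[K]_m) :
  nM (Q - 1%:M) <= 1 / 2 -> nM A <= 2 * nM (A *m Q).
Proof.
move=> HQ; have := nMB nd (A *m Q) (A *m (Q - 1%:M)).
rewrite mulmxBr mulmx1 opprB addrC subrK => h.
have := nM_mul nd A (Q - 1%:M); rewrite mulmxBr mulmx1 => h2.
by have := nMp _ _ A; nra.
Qed.

Lemma near1_unit m (Q : 'M[K]_m) : nM (Q - 1%:M) <= 1 / 2 -> Q \in unitmx.
Proof.
move=> HQ; rewrite -row_free_unit -kermx_eq0; apply/eqP/(@nM_eq0 _ _ nd).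
by have := near1_bound (kermx Q) HQ; rewrite mulmx_ker nM0 mulr0.
Qed.

Lemma near1_inv m (Q : 'M[K]_m) : nM (Q - 1%:M) <= 1 / 2 ->
  nM (invmx Q) <= 2 * nM (1%:M : 'M[K]_m).
Proof.
by move=> HQ; have := near1_bound (invmx Q) HQ; rewrite mulVmx ?near1_unit.
Qed.

Lemma hasD_coord m n k (f : K -> 'M[K]_(m, n)) (u : 'rV[K]_k) i D :
  hasd f (u 0 i) D -> hasD nd nM (fun u => f (u 0 i)) u (fun h => h 0 i *: D).
Proof.
move=> [[C HC] H]; split.
  by exists (nM D) => h; rewrite nMZ mulrC ler_wpM2l ?nMp // nM_entry.
move=> e e0; have [d d0 Hd] := H e e0; exists d => // h hd; rewrite mxE.
have h1 := nM_entry nd h 0 i.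
by apply: le_trans (Hd _ (le_lt_trans h1 hd)) _; rewrite ler_wpM2l // ltW.
Qed.

Variables (d N : nat) (a : 'I_N -> 'M[K]_d) (X : 'rV[K]_d).

Definition gen_mx (c : 'rV[K]_N) : 'M[K]_d := \sum_i c 0 i *: a i.
Local Notation gmat := gen_mx.

Lemma gmat_is_linear : linear gmat.
Proof.
move=> k c c'; rewrite /gmat scaler_sumr -big_split; apply: eq_bigr => i _.
by rewrite !mxE scalerDl scalerA.
Qed.
HB.instance Definition _ := GRing.isLinear.Build K _ _ _ gmat gmat_is_linear.

Lemma gmat_delta i : gmat (delta_mx 0 i) = a i.
Proof.
rewrite /gmat (bigD1 i) //= mxE !eqxx scale1r big1 ?addr0 // => j ji.
by rewrite mxE (negbTE ji) andbF scale0r.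
Qed.

Hypothesis gmat_bracket : forall c c', exists c'',
  gmat c *m gmat c' - gmat c' *m gmat c = gmat c''.

Definition gspan : 'M[K]_(N, d * d) := \matrix_i mxvec (a i).

(** Presents the span of the generators as a kernel, the shape required by [mexp_conj_stable]. *)
Lemma gspanP (Z : 'M[K]_d) :
  mxvec Z *m cokermx gspan = 0 <-> exists c, Z = gmat c.
Proof.
have gE c : mxvec (gmat c) = c *m gspan.
  rewrite linear_sum mulmx_sum_row; apply: eq_bigr => i _.
  by rewrite linearZ rowK.
split=> [/eqP|[c ->]]; last by rewrite gE -mulmxA mulmx_coker mulmx0.
by rewrite -submxE => /submxP[c]; rewrite -gE => /(can_inj mxvecK) ->; exists c.
Qed.

Lemma mexp_conj c c' : exists c'', mexp (- gmat c) *m gmat c' *m mexp (gmat c) = gmat c''.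
Proof.
apply/gspanP; apply: mexp_conj_stable; last by apply/gspanP; exists c'.
by move=> _ /gspanP[z ->]; apply/gspanP/gmat_bracket.
Qed.

Inductive exp_group : 'M[K]_d -> Prop :=
| Ggen1 : exp_group 1%:M
| GgenS g c : exp_group g -> exp_group (g *m mexp (gmat c)).

Lemma exp_group_mul g h : exp_group g -> exp_group h -> exp_group (g *m h).
Proof.
move=> Gg; elim=> [|h' c _ IH]; first by rewrite mulmx1.
by rewrite mulmxA; apply: GgenS.
Qed.

Lemma exp_group_exp c : exp_group (mexp (gmat c)).
Proof. by rewrite -[mexp _]mul1mx; apply/GgenS/Ggen1. Qed.

Lemma exp_group_unit g : exp_group g -> g \in unitmx.
Proof.
by elim=> [|h c _ IH]; rewrite ?unitmx1 // unitmx_mul IH mexp_unit.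
Qed.

Lemma exp_group_inv g : exp_group g -> exp_group (invmx g).
Proof.
elim=> [|h c Gh IH]; first by rewrite invmx1; apply: Ggen1.
have -> : invmx (h *m mexp (gmat c)) = mexp (gmat (- c)) *m invmx h.
  have U : h *m mexp (gmat c) \in unitmx by rewrite unitmx_mul exp_group_unit ?mexp_unit.
  suff E : h *m mexp (gmat c) *m (mexp (gmat (- c)) *m invmx h) = 1%:M.
    by rewrite -[invmx _]mulmx1 -E mulKmx.
  by rewrite linearN /= mulmxA mexpK mulmxV // exp_group_unit.
by apply: exp_group_mul => //; apply: exp_group_exp.
Qed.

(** The adjoint action of the group, written on coefficients. The generators may be dependent, so
    coefficients are chosen for each generator and extended linearly. *)
Lemma exp_group_conj g : exp_group g -> exists Ad : 'M[K]_N, forall c,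
  gmat c *m g = g *m gmat (c *m Ad).
Proof.
have lin (h : 'M[K]_d) : (forall i, exists c, a i *m h = h *m gmat c) ->
    exists Ad : 'M[K]_N, forall c, gmat c *m h = h *m gmat (c *m Ad).
  move=> /choice[F HF]; exists (\matrix_i F i) => c.
  rewrite [c *m _]mulmx_sum_row [gmat (\sum_i _)]linear_sum mulmx_sumr [X in X *m h]/gmat
    mulmx_suml.
  by apply: eq_bigr => i _; rewrite linearZ /= rowK -scalemxAl HF scalemxAr.
elim=> [|h c _ [Ad HAd]].
  by exists 1%:M => c; rewrite mulmx1 mul1mx mulmx1.
have [Ad' HAd'] : exists Ad' : 'M[K]_N, forall c',
    gmat c' *m mexp (gmat c) = mexp (gmat c) *m gmat (c' *m Ad').
  apply: lin => i; have [c' Hc'] := mexp_conj c (delta_mx 0 i).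
  exists c'; rewrite -Hc' gmat_delta !mulmxA -[mexp _ *m mexp _]mul1mx.
  by rewrite mulmxA mexpK mul1mx.
by exists (Ad *m Ad') => c'; rewrite mulmxA HAd -mulmxA HAd' !mulmxA.
Qed.

(** Its row space is the tangent space at [Y] of the orbit through [Y]. *)
Definition tan_mx (Y : 'rV[K]_d) : 'M[K]_(N, d) := \matrix_i (Y *m a i).

Lemma tan_mxE c Y : c *m tan_mx Y = Y *m gmat c.
Proof.
rewrite mulmx_sum_row mulmx_sumr; apply: eq_bigr => i _.
by rewrite rowK -scalemxAr.
Qed.

Lemma tan_mx_is_linear : linear tan_mx.
Proof.
by move=> k Y Y'; apply/row_matrixP => i; rewrite linearP /= !rowK mulmxDl scalemxAl.
Qed.
HB.instance Definition _ := GRing.isLinear.Build K _ _ _ tan_mx tan_mx_is_linear.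

Lemma tan_mx_Ggen g : exp_group g ->
  exists Ad : 'M[K]_N, forall Y, tan_mx Y *m g = Ad *m tan_mx (Y *m g).
Proof.
move=> /exp_group_conj[Ad HAd]; exists Ad => Y; apply/row_matrixP => i.
rewrite !rowE !mulmxA tan_mxE -mulmxA HAd.
by rewrite [RHS]tan_mxE mulmxA.
Qed.

(** By equivariance, [g] maps the tangent space at [Y] into the one at [Y *m g], and its inverse
    maps back. The constant rank is what makes the slice fill out the tangent spaces in
    [Smx_psi]. *)
Lemma tan_mx_rank g Y : exp_group g -> \rank (tan_mx (Y *m g)) = \rank (tan_mx Y).
Proof.
have le h Z : exp_group h -> (\rank (tan_mx Z) <= \rank (tan_mx (Z *m h)))%N.
  move=> Gh; have [Ad HAd] := tan_mx_Ggen Gh.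
  rewrite -(mxrankMfree (tan_mx Z) (_ : row_free h)) ?row_free_unit ?exp_group_unit //.
  by rewrite HAd mxrankS // submxMl.
move=> Gg; apply/eqP; rewrite eqn_leq le // andbT.
by have := le _ (Y *m g) (exp_group_inv Gg); rewrite mulmxK // exp_group_unit.
Qed.

Section Chart.
Variables (m : nat) (s : 'M[K]_(m, N)) (p : 'M[K]_(d, m)).
Hypothesis rank_m : \rank (tan_mx X) = m.
Hypothesis sXp : s *m tan_mx X *m p = 1%:M.

Let b i := gmat (row i s).

(** Recursion on the list of indices turns the product rule into an induction; the head of the list
    acts last. *)
Fixpoint flow (l : seq 'I_m) (u : 'rV[K]_m) : 'rV[K]_d :=
  if l is i :: l' then flow l' u *m mexp (u 0 i *: b i) else X.

Fixpoint flow_jac (l : seq 'I_m) (u : 'rV[K]_m) : 'M[K]_(m, d) :=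
  if l is i :: l' then
    flow_jac l' u *m mexp (u 0 i *: b i) + (delta_mx i 0 : 'cV_m) *m (flow (i :: l') u *m b i)
  else 0.

Lemma flow_hasJ l u : hasJ (flow l) u (flow_jac l u).
Proof.
elim: l => [|i l IH] /=.
  by apply: hasD_eq (hasD_cst nd (@nMp _ _) X u) => // h; rewrite mulmx0.
apply: hasD_eq (hasD_mul (@nMp _ _) IH (hasD_coord (mexp_der nd (b i) (u 0 i)))) => // h.
rewrite mulmxDr !mulmxA; congr (_ + _).
rewrite -scalemxAr -colE /= !mulmxA.
suff -> : col i h = (h 0 i)%:M by rewrite mul_scalar_mx !scalemxAl.
by apply/matrixP => j k; rewrite !ord1 !mxE eqxx mulr1n.
Qed.

(** Serves for the continuity of the Jacobian at 0. *)
Lemma flow_jac_hasD l u : exists L, hasD nd nM (flow_jac l) u L.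
Proof.
elim: l => [|i l [L IH]] /=.
  by exists (fun=> 0); exact: (hasD_cst nd (@nMp 1 m)).

have H1 := hasD_mul (@nMp _ _) IH (hasD_coord (mexp_der nd (b i) (u 0 i))).
have H2 := hasD_mulr (@nMp _ _) (delta_mx i 0 : 'cV[K]_m)
  (hasD_mull (@nMp _ _) (b i) (flow_hasJ (i :: l) u)).
by eexists; exact: (hasD_add H1 H2).
Qed.

Lemma flow_orbit l u : exists2 g, exp_group g & flow l u = X *m g.
Proof.
elim: l => [|i l [g Gg IH]] /=; first by exists 1%:M; [exact: Ggen1|rewrite mulmx1].
exists (g *m mexp (gmat (u 0 i *: row i s))); first exact: GgenS.
by rewrite IH linearZ mulmxA.
Qed.

Lemma flow_jac_tangent l u : (flow_jac l u <= tan_mx (flow l u))%MS.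
Proof.
elim: l => [|i l IH] /=; first exact: sub0mx.
apply: addmx_sub.
  rewrite /b -linearZ.
  have [Ad HAd] := tan_mx_Ggen (exp_group_exp (u 0 i *: row i s)).
  by apply: submx_trans (submxMr _ IH) _; rewrite HAd submxMl.
by apply: mulmx_sub; rewrite -tan_mxE submxMl.
Qed.

Lemma flow0 l : flow l 0 = X.
Proof. by elim: l => //= i l ->; rewrite mxE scale0r mexp0 mulmx1. Qed.

Lemma flow_jac0 : flow_jac (enum 'I_m) 0 = s *m tan_mx X.
Proof.
have -> : flow_jac (enum 'I_m) 0 = \sum_(i <- enum 'I_m) (delta_mx i 0 : 'cV_m) *m (X *m b i).
  elim: (enum _) => [|i l IH]; first by rewrite big_nil.
  by rewrite big_cons /= flow0 mxE scale0r mexp0 !mulmx1 IH addrC.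
rewrite big_enum /=; apply/row_matrixP => i.
rewrite [RHS]row_mul tan_mxE -/(b i) linear_sum (bigD1 i) //= big1 ?addr0.
  by rewrite row_mul rowE mul_delta_mx (_ : delta_mx 0 0 = 1%:M) ?mul1mx //;
    apply/matrixP => x y; rewrite !ord1 !mxE.
by move=> j ji; rewrite row_mul rowE mul_delta_mx_cond eq_sym (negbTE ji) mulr0n mul0mx.
Qed.

Let f := flow (enum 'I_m).
Let J := flow_jac (enum 'I_m).
Let Q u := J u *m p.
Let w0 := X *m p.
Let Nw (Y : 'rV[K]_d) := s *m tan_mx Y *m p.

(** Where the inverted factor is a unit, this is a matrix [S] with rows tangent at [Y] and
    [S *m p = 1]. It will be the Jacobian of the slice, and it depends rationally on the point [Y]
    alone. *)
Definition slice_mx (Y : 'rV[K]_d) : 'M[K]_(m, d) := invmx (s *m tan_mx Y *m p) *m s *m tan_mx Y.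
Local Notation Smx := slice_mx.

(** The factor 3 leaves room for [phi_contract]: the mean value inequality runs over the whole disc
    [v + t *: h] with [t] of norm at most 1, and [h] can have norm up to [2 * r]. *)
Lemma small_radius : exists2 r, 0 < r & forall u, nM u < 3 * r ->
  [/\ nM (Q u - 1%:M) <= 1 / 2, nM (Nw (f u) - 1%:M) <= 1 / 2 & nM (f u - X) <= 1].
Proof.
have [L HL] := flow_jac_hasD (enum 'I_m) 0.
have HQ := hasD_mull (@nMp _ _) p HL.
have half : 0 < 1 / 2 :> R by lra.
have [d1 d10 H1] := hasD_cont (@nMp _ _) HQ half.
have HT : linear (fun Y => Nw Y).
  by move=> k Y Y'; rewrite /Nw linearP mulmxDr mulmxDl -scalemxAr -scalemxAl.
pose F := HB.pack_for {linear 'rV[K]_d -> 'M[K]_m} (fun Y => Nw Y)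
  (GRing.isLinear.Build _ _ _ _ _ HT).
have [d2 d20 H2] := hasD_cont (@nMp _ _) (hasD_lin (@nMp _ _) F (flow_hasJ (enum 'I_m) 0)) half.
have [d3 d30 H3] := hasD_cont (@nMp _ _) (flow_hasJ (enum 'I_m) 0) ltr01.
exists (Num.min d1 (Num.min d2 d3) / 3); first by rewrite divr_gt0 // !lt_min d10 d20.
move=> u; rewrite [3 * _]mulrC divfK // !lt_min => /andP[/H1 h1 /andP[/H2 h2 /H3 h3]].
rewrite add0r in h1 h2 h3; rewrite flow0 in h2 h3; rewrite flow_jac0 sXp in h1.
by rewrite /= [Nw X]sXp in h2; rewrite !ltW.
Qed.

Section Inverse.
Variable r : R.
Hypothesis r0 : 0 < r.
Hypothesis Hr : forall u, nM u < 3 * r ->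
  [/\ nM (Q u - 1%:M) <= 1 / 2, nM (Nw (f u) - 1%:M) <= 1 / 2 & nM (f u - X) <= 1].
Let phi u := f u *m p.

Lemma small_radius1 u : nM u < r ->
  [/\ nM (Q u - 1%:M) <= 1 / 2, nM (Nw (f u) - 1%:M) <= 1 / 2 & nM (f u - X) <= 1].
Proof. move=> ur; apply: Hr; apply: lt_trans ur _. have r00 := r0. lra. Qed.

Lemma phi_hasJ u : hasJ phi u (Q u).
Proof.
by apply: hasD_eq (hasD_mull (@nMp _ _) p (flow_hasJ _ u)) => // h; rewrite mulmxA.
Qed.

Lemma phi_contract u v : nM u < r -> nM v < r ->
  nM ((phi u - phi v) - (u - v)) <= 1 / 2 * nM (u - v).
Proof.
move=> ur vr; pose h := u - v.
have H := @mean_value _ _ nd _ _ (fun t : K => phi (v + t *: h) - t *: h)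
  (fun t => h *m (Q (v + t *: h) - 1%:M)) (1 / 2 * nM h) 1.
rewrite nK1 lexx !scale1r !scale0r addr0 subr0 [v + h]addrC subrK in H.
have -> : (phi u - phi v) - (u - v) = phi u - h - phi v by rewrite addrAC.
apply: H => // t t1; split.
  apply: hasD_eq (hasD_sub (@nK_ge0 _ _ nd) (hasd_line (phi_hasJ (v + t *: h)))
    (hasD_lin (@nK_ge0 _ _ nd) (mulmx (1%:M : 'M[K]_1))
      (hasd_line (u := 0) (s := t) (h := h) (hasJ_id nd _)))) => [k|k /=].
    by rewrite /= mul1mx add0r.
  by rewrite mulmx1 mul1mx -scalerBr mulmxBr mulmx1.
apply: le_trans (nM_mul _ _ _) _; rewrite mulrC ler_wpM2r ?nMp //.
have [|//] := Hr (u := v + t *: h).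
apply: le_lt_trans (nMD _ _ _) _; rewrite nMZ.
have := nMB nd u v; rewrite -/h; have := nMp _ _ h; have := nK_ge0 nd t; nra.
Qed.

Lemma phi_inj_bound u v : nM u < r -> nM v < r -> nM (u - v) <= 2 * nM (phi u - phi v).
Proof.
move=> ur vr; have := phi_contract ur vr.
have := nMB nd (phi u - phi v) ((phi u - phi v) - (u - v)).
rewrite opprB addrC subrK; lra.
Qed.

Lemma phi_lip u v : nM u < r -> nM v < r -> nM (phi u - phi v) <= 2 * nM (u - v).
Proof.
move=> ur vr; have := phi_contract ur vr.
have := nMD nd ((phi u - phi v) - (u - v)) (u - v).
by rewrite subrK; have := nMp _ _ (u - v); lra.
Qed.

Lemma phi0 : phi 0 = w0.
Proof. by rewrite /phi /f flow0. Qed.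

Lemma phi_surj w : nM (w - w0) < r / 2 -> exists2 u, nM u < r & phi u = w.
Proof.
move=> wr; pose e := nM (w - w0).
(* A fixed point of this map solves [phi u = w]. Since [phi] minus the identity is a
   1/2-contraction, successive steps halve and the iterates stay within [2 * e < r]. *)
pose U n := iter n (fun u => u - phi u + w) (0 : 'rV[K]_m).
have e0 : 0 <= e by apply: nMp.
have He : 2 * e < r by rewrite /e; lra.
have bnd n : nM (U n) <= 2 * e * (1 - 1 / 2 ^+ n) /\ nM (U n.+1 - U n) <= e / 2 ^+ n.
  elim: n => [|n [IH1 IH2]].
    rewrite nM0 expr0 !divr1 subrr mulr0 lexx /= sub0r phi0 subr0 addrC.
    by rewrite /e; split.
  have pn : 0 < 1 / 2 ^+ n :> R by rewrite divr_gt0 // exprn_gt0.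
  have E : e / 2 ^+ n.+1 = e * (1 / 2 ^+ n) / 2 by rewrite exprS; field; rewrite expf_neq0.
  have E' : 1 / 2 ^+ n.+1 = (1 / 2 ^+ n) / 2 :> R by rewrite exprS; field; rewrite expf_neq0.
  have IH2' : nM (U n.+1 - U n) <= e * (1 / 2 ^+ n) by rewrite mulrA mulr1.
  have n1 : nM (U n.+1) <= 2 * e * (1 - 1 / 2 ^+ n.+1).
    have := nMD nd (U n.+1 - U n) (U n); rewrite subrK E'; lra.
  split=> //; rewrite E.
  have lt1 : nM (U n) < r by apply: le_lt_trans IH1 _; nra.
  have lt2 : nM (U n.+1) < r.
    apply: le_lt_trans n1 _; rewrite E'; nra.
  have -> : U n.+2 - U n.+1 = - ((phi (U n.+1) - phi (U n)) - (U n.+1 - U n)).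
    rewrite -[U n.+2]/(U n.+1 - phi (U n.+1) + w).
    have -> : - U n.+1 = - (U n - phi (U n) + w) by [].
    by apply/matrixP => i j; rewrite !mxE; ring.
  by rewrite nMN; apply: le_trans (phi_contract lt2 lt1) _; lra.
have [l Hl] := geometric_cvg_mx (fun n => (bnd n).2).
have lr : nM l <= 2 * e.
  apply: (lim_le Hl) => n; apply: le_trans (bnd n).1 _.
  have : 0 < 1 / 2 ^+ n :> R by rewrite divr_gt0 // exprn_gt0.
  nra.
have lr' : nM l < r by lra.
exists l => //; apply/eqP; rewrite -subr_eq0; apply/eqP/(@nM_eq0 _ _ nd).
apply: (@halves_to0 _ _ (2 * ((1 * m)%:R * (4 * e)) + e)) => n.
have Ur : nM (U n) < r.
  apply: le_lt_trans (bnd n).1 _.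
  have : 0 < 1 / 2 ^+ n :> R by rewrite divr_gt0 // exprn_gt0.
  nra.
apply: le_trans (nM_tri _ (phi (U n)) _ _) _; rewrite mulrDl; apply: lerD.
  apply: le_trans (phi_lip lr' Ur) _; rewrite nM_distC -mulrA.
  by rewrite ler_wpM2l //; exact: Hl.
have -> : phi (U n) - w = - (U n.+1 - U n).
  by rewrite /=; apply/matrixP => i j; rewrite !mxE; ring.
by rewrite nMN; exact: (bnd n).2.
Qed.

Definition qinv w := xget 0 [set u | nM u < r /\ phi u = w].

Lemma qinvP w : nM (w - w0) < r / 2 -> nM (qinv w) < r /\ phi (qinv w) = w.
Proof.
by move=> /phi_surj[u ur uw]; rewrite /qinv; case: xgetP => [v _ //|/(_ u)[]].
Qed.

Lemma qinv_hasJ w : nM (w - w0) < r / 2 -> hasJ qinv w (invmx (Q (qinv w))).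
Proof.
move=> wr; have [qr qE] := qinvP wr; set q := qinv w in qr qE *.
have [HQ _ _] := small_radius1 qr.
have Qu := near1_unit HQ.
split.
  by exists (nM (invmx (Q q))) => h; rewrite mulrC nM_mul.
(* In the constant [2 * (B + 1)], the 2 is the Lipschitz constant of the inverse from
   [phi_inj_bound], and [B + 1] bounds the inverse Jacobian while staying positive. *)
move=> e e0; set B := nM (invmx (Q q)).
have B0 : 0 < 2 * (B + 1) by have := nMp _ _ (invmx (Q q)); rewrite -/B; lra.
have eB : 0 < e / (2 * (B + 1)) by rewrite divr_gt0.
have [dl dl0 Hd] := (phi_hasJ q).2 _ eB.
exists (Num.min (dl / 2) (r / 2 - nM (w - w0))); first by rewrite lt_min divr_gt0 // subr_gt0.
move=> k; rewrite lt_min => /andP[k1 k2].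
have wk : nM (w + k - w0) < r / 2.
  by rewrite addrAC; apply: le_lt_trans (nMD _ _ _) _; lra.
have [qr' qE'] := qinvP wk; pose h := qinv (w + k) - q.
have hk : nM h <= 2 * nM k.
  by apply: le_trans (phi_inj_bound qr' qr) _; rewrite qE' qE [w + k]addrC addrK.
have hd : nM h < dl by lra.
have H : nM (k - h *m Q q) <= e / (2 * (B + 1)) * nM h.
  by have := Hd h hd; rewrite {1}/h addrCA subrr addr0 qE' qE [w + k]addrC addrK.
rewrite -[qinv _ - q]/h.
have -> : h - k *m invmx (Q q) = - ((k - h *m Q q) *m invmx (Q q)).
  by rewrite mulmxBl mulmxK // opprB.
rewrite nMN; apply: le_trans (nM_mul _ _ _) _.
apply: (@le_trans _ _ (e / (2 * (B + 1)) * (2 * nM k) * (B + 1))); last first.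
  have -> : e / (2 * (B + 1)) * (2 * nM k) * (B + 1) = e * nM k.
    by field; rewrite gt_eqF //; lra.
  by [].
apply: ler_pM; rewrite ?nMp // -/B; last by lra.
by apply: le_trans H _; rewrite ler_wpM2l // ltW.
Qed.

Definition psi w := f (qinv w).

Lemma psi_unit w : nM (w - w0) < r / 2 -> s *m tan_mx (psi w) *m p \in unitmx.
Proof.
by move=> /qinvP[qr _]; have [_ HN _] := small_radius1 qr; exact: near1_unit HN.
Qed.

Lemma psi_inv_bound w : nM (w - w0) < r / 2 ->
  nM (invmx (s *m tan_mx (psi w) *m p)) <= 2 * nM (1%:M : 'M[K]_m).
Proof.
by move=> /qinvP[qr _]; have [_ HN _] := small_radius1 qr; exact: near1_inv HN.
Qed.

Lemma psi_p w : nM (w - w0) < r / 2 -> psi w *m p = w.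
Proof. by move=> /qinvP[]. Qed.

Lemma psi_bound w : nM (w - w0) < r / 2 -> nM (psi w) <= nM X + 1.
Proof.
move=> /qinvP[qr _]; have [_ _ H] := small_radius1 qr.
by have := nMD nd (psi w - X) X; rewrite subrK; lra.
Qed.

Lemma psi_w0 : psi w0 = X.
Proof.
have W : nM (w0 - w0) < r / 2 by rewrite subrr nM0 divr_gt0.
have [qr qE] := qinvP W.
rewrite /psi; suff -> : qinv w0 = 0; first exact: flow0.
apply/(@nM_eq0 _ _ nd); have r' : nM (0 : 'rV[K]_m) < r by rewrite nM0.
by have := phi_inj_bound qr r'; rewrite qE phi0 subr0 subrr nM0 mulr0.
Qed.

Lemma psi_orbit w : exists2 g, exp_group g & psi w = X *m g.
Proof. exact: flow_orbit. Qed.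

(** The Jacobian [S] given by the chain rule has tangent rows and [S *m p = 1], so it has rank [m],
    which is the rank of the tangent space all along the orbit. Its rows thus span the tangent
    space, and both formulas follow. *)
Lemma Smx_psi w : nM (w - w0) < r / 2 ->
  invmx (Q (qinv w)) *m J (qinv w) = Smx (psi w) /\
  tan_mx (psi w) = tan_mx (psi w) *m p *m Smx (psi w).
Proof.
move=> wr; have [qr qE] := qinvP wr.
have [HQ _ _] := small_radius1 qr; have Qu := near1_unit HQ.
set S := invmx _ *m _.
have Sp : S *m p = 1%:M by rewrite -mulmxA mulVmx.
have ST : (S <= tan_mx (psi w))%MS by rewrite mulmx_sub // flow_jac_tangent.
have rS : \rank S = m.
  by apply/eqP; apply/row_freeP; exists p.
have rT : \rank (tan_mx (psi w)) = m.
  by have [g Gg ->] := psi_orbit w; rewrite tan_mx_rank.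
have /andP[_ TS] : (S == tan_mx (psi w))%MS.
  by rewrite -(geq_leqif (mxrank_leqif_eq ST)) rT rS.
have /submxP[D ED] := TS.
have E : tan_mx (psi w) = tan_mx (psi w) *m p *m S.
  by rewrite {1 2}ED -(mulmxA D S p) Sp mulmx1.
suff -> : Smx (psi w) = S by [].
rewrite /Smx {2}E; set Nm := s *m _ *m p.
have -> : invmx Nm *m s *m (tan_mx (psi w) *m p *m S) = invmx Nm *m Nm *m S.
  by rewrite /Nm !mulmxA.
by rewrite mulVmx ?mul1mx // psi_unit.
Qed.

Lemma psi_hasJ w : nM (w - w0) < r / 2 -> hasJ psi w (Smx (psi w)).
Proof.
move=> wr; have [<- _] := Smx_psi wr.
apply: hasD_eq (hasD_comp (@nMp _ _) (qinv_hasJ wr) (flow_hasJ _ _)) => // h.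
by rewrite mulmxA.
Qed.

End Inverse.

(** Everything later about the slice is drawn from this package. The uniform bound [B] feeds the
    differential inequality; the radius is [r / 2] because [phi_surj] covers a ball of that size. *)
Lemma chart_exists : exists (ps : 'rV[K]_m -> 'rV[K]_d) (r B : R),
  [/\ 0 < r, 0 <= B, ps (X *m p) = X & forall w, nM (w - X *m p) < r ->
    [/\ ps w *m p = w /\ s *m tan_mx (ps w) *m p \in unitmx,
        hasJ ps w (Smx (ps w)),
        tan_mx (ps w) = tan_mx (ps w) *m p *m Smx (ps w),
        (exists2 g, exp_group g & ps w = X *m g)
      & nM (ps w) <= B /\ nM (invmx (s *m tan_mx (ps w) *m p)) <= B]].
Proof.
have [r r0 Hr] := small_radius.
exists (psi r), (r / 2), (nM X + 1 + 2 * nM (1%:M : 'M[K]_m)).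
have X0 := nMp _ _ X; have m0 := nMp _ _ (1%:M : 'M[K]_m).
split; [lra|lra|exact: psi_w0|move=> w wr; split].
- by split; [exact: psi_p|exact: psi_unit].
- exact: psi_hasJ.
- by have [] := Smx_psi r0 Hr wr.
- exact: psi_orbit.
- by have := psi_bound r0 Hr wr; have := psi_inv_bound r0 Hr wr; split; lra.
Qed.

End Chart.
End Orbit.

(** * Curves tangent to the orbits, overlaps of charts, countable covers *)

Section Cover.
Variables (R : realType) (K : numFieldType) (nd : norm_data R K).
Local Notation nK := (nK nd).
Local Notation nM := (@mx_norm1 _ _ nd _ _).
Local Notation hasd f t D := (hasd nd f t D).
Local Notation hasJ f u J := (hasJ nd f u J).
Local Notation mexp := (mexp nd).
Local Notation nMp := (fun m n => @nM_ge0 _ _ nd m n).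
Local Notation nKp := (@nK_ge0 _ _ nd).

Variables (d N m : nat) (a : 'I_N -> 'M[K]_d) (X : 'rV[K]_d).
Hypothesis gmat_bracket : forall c c', exists c'',
  gen_mx a c *m gen_mx a c' - gen_mx a c' *m gen_mx a c = gen_mx a c''.
Variables (s : 'M[K]_(m, N)) (p : 'M[K]_(d, m)).
Variables (ps : 'rV[K]_m -> 'rV[K]_d) (r B : R).
Local Notation w0 := (X *m p).
Local Notation Smx := (slice_mx a s p).
Local Notation tan_mx := (tan_mx a).
Local Notation gmat := (gen_mx a).
Local Notation exp_group := (exp_group nd a).
Hypotheses (r0 : 0 < r) (B0 : 0 <= B) (psX : ps w0 = X).
Hypothesis Hps : forall w, nM (w - w0) < r ->
    [/\ ps w *m p = w /\ s *m tan_mx (ps w) *m p \in unitmx,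
        hasJ ps w (Smx (ps w)),
        tan_mx (ps w) = tan_mx (ps w) *m p *m Smx (ps w),
        (exists2 g, exp_group g & ps w = X *m g)
      & nM (ps w) <= B /\ nM (invmx (s *m tan_mx (ps w) *m p)) <= B].

Lemma half_ratio (x : R) : 0 <= x -> 1 / (2 * (x + 1)) * x <= 1 / 2.
Proof.
move=> x0; have x1 : 0 < 2 * (x + 1) by lra.
by rewrite mulrAC mul1r ler_pdivrMr //; lra.
Qed.

(** Inserting [F G H = 1] writes the velocity of a conjugated curve as the curve times a generator,
    the form required by [tangent_curve_in_chart]. *)
Lemma conj_velocity (k : K) (P : 'rV[K]_d) (E L M F G H : 'M[K]_d) :
  (F *m G) *m H = 1%:M ->
  (P *m (k *: (E *m L)) *m F + P *m E *m (k *: (- M *m F))) *m G =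
  k *: (P *m E *m (F *m G) *m (H *m (L - M) *m (F *m G))).
Proof.
move=> FGH; have -> : P *m E *m (F *m G) *m (H *m (L - M) *m (F *m G)) =
    P *m E *m (F *m G *m H) *m (L - M) *m (F *m G) by rewrite !mulmxA.
rewrite FGH mulmx1 -!scalemxAr -!scalemxAl -scalerDr -scalemxAl; congr (_ *: _).
by rewrite mulmxDl mulmxBr mulmxBl mulNmx mulmxN mulNmx !mulmxA.
Qed.

Lemma gmat_bound : exists2 C, 0 <= C & forall c, nM (gmat c) <= C * nM c.
Proof. exact: (nM_linear nd (gmat : {linear 'rV[K]_N -> 'M[K]_d})). Qed.

Lemma Smx_bound : exists2 C, 0 <= C & forall w, nM (w - w0) < r -> nM (Smx (ps w)) <= C.
Proof.
have [C C0 HC] := nM_linear nd (tan_mx : {linear 'rV[K]_d -> 'M[K]_(N, d)}).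
exists (B * nM s * (C * B)); first by rewrite !mulr_ge0 ?nMp.
move=> w /Hps[_ _ _ _ [b1 b2]].
apply: le_trans (nM_mul _ _ _) _; apply: ler_pM; rewrite ?nMp //.
  by apply: le_trans (nM_mul _ _ _) _; rewrite ler_wpM2r ?nMp.
by apply: le_trans (HC _) _; rewrite ler_wpM2l.
Qed.

(* The difference [e] between a curve tangent to the orbits and its projection
   to the chart satisfies a linear differential inequality. *)
Lemma tangent_curve_in_chart v0 C : nM (v0 - w0) < r -> 0 <= C ->
  exists2 eta, 0 < eta & forall (z : K -> 'rV[K]_d) (A : K -> 'M[K]_d),
    z 0 = ps v0 ->
    (forall t, nK t <= 1 -> [/\ exists c, A t = gmat c, hasd z t (z t *m A t),
       nM (A t) <= eta & nM (z t) <= C]) ->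
    nM (z 1 *m p - w0) < r /\ z 1 = ps (z 1 *m p).
Proof.
move=> v0r C0; have [D D0 HD] := Smx_bound.
pose P := nM (1%:M : 'M[K]_d) + nM p * D.
have P0 : 0 <= P by rewrite addr_ge0 ?mulr_ge0 ?nMp.
have rv : 0 < r - nM (v0 - w0) by lra.
(* The speed will be at most [C * (e1 / 2)], so up to time 1 the projection by [p] moves by less
   than [r - nM (v0 - w0)] and stays in the domain. *)
pose e1 := (r - nM (v0 - w0)) / (C * nM p + 1).
have Cp : 0 < C * nM p + 1 by rewrite ltr_wpDl ?mulr_ge0 ?nMp.
have e10 : 0 < e1 by rewrite divr_gt0.
exists (Num.min (e1 / 2) (1 / (2 * (P + 1)))).
  by rewrite lt_min divr_gt0 // divr_gt0 //; lra.
move=> z A z0 HA.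
have e12 : e1 * (C * nM p + 1) = r - nM (v0 - w0) by rewrite divfK // gt_eqF.
have inU t : nK t <= 1 -> nM (z t *m p - w0) < r.
  move=> t1.
  have H : nM (z (0 + t) - z 0) <= nK t * (C * (e1 / 2)).
    apply: (@mean_value_seg _ _ nd _ _ z (fun t => z t *m A t)) => t'.
    rewrite subr0 => t't; have [_ h1 h2 h3] := HA t' (le_trans t't t1).
    split=> //; apply: le_trans (nM_mul _ _ _) _; apply: ler_pM; rewrite ?nMp //.
    by apply: le_trans h2 _; rewrite ge_min lexx.
  rewrite add0r z0 in H.
  have [[pv _] _ _ _ _] := Hps v0r.
  have -> : z t *m p - w0 = (z t - ps v0) *m p + (v0 - w0).
    by rewrite mulmxBl pv addrA subrK.
  apply: le_lt_trans (nMD _ _ _) _.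
  have h1 := nM_mul nd (z t - ps v0) p.
  have h2 : nM (z t - ps v0) * nM p <= (C * (e1 / 2)) * nM p.
    rewrite ler_wpM2r ?nMp //; apply: le_trans H _.
    by rewrite ler_piMl // mulr_ge0 //; lra.
  have h3 : 0 <= C * nM p by rewrite mulr_ge0 ?nMp.
  nra.
split; first by apply: inU; rewrite nK1.
pose e t := z t - ps (z t *m p).
(* At the chart point [Y] the vector [Y A] is tangent, hence equal to [Y A p S] with [S] the
   Jacobian; so the difference satisfies [e' = e A (1 - p S)]. The second entry of the minimum makes
   this coefficient at most 1/2. *)
have He t : nK t <= 1 -> exists2 Z, hasd e t (e t *m Z) & nM Z <= 1 / 2.
  move=> t1; have [[c Ec] h1 h2 h3] := HA t t1.
  have [[pv _] HJ HT _ _] := Hps (inU t t1).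
  set Y := ps (z t *m p) in HJ HT *.
  exists (A t *m (1%:M - p *m Smx Y)).
    apply: hasD_eq (hasD_sub nKp h1 (hasD_comp nKp (hasD_mull nKp p h1) HJ)) => // h.
    rewrite -!scalemxAl -scalerBr; congr (_ *: _).
    rewrite /e -/Y mulmxBl.
    have -> : Y *m (A t *m (1%:M - p *m Smx Y)) = 0.
      rewrite Ec mulmxA -tan_mxE -mulmxA mulmxBr mulmx1 mulmxA -HT subrr mulmx0.
      by [].
    by rewrite subr0 !mulmxBr mulmx1 !mulmxA.
  apply: le_trans (nM_mul _ _ _) _.
  apply: (@le_trans _ _ (1 / (2 * (P + 1)) * P)).
    apply: ler_pM; rewrite ?nMp //; first by apply: le_trans h2 _; rewrite ge_min lexx orbT.
    apply: le_trans (nMB _ _ _) _; rewrite lerD2l.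
    by apply: le_trans (nM_mul _ _ _) _; rewrite ler_wpM2l ?nMp // HD // inU.
  exact: half_ratio.
(* Gronwall by iteration: as [e] vanishes at 0, each use of the mean value inequality halves the
   bound. *)
have bnd n t : nK t <= 1 -> nM (e t) <= (C + B) / 2 ^+ n.
  elim: n t => [|n IH] t t1.
    have [_ _ _ h] := HA t t1; have [_ _ _ _ [h' _]] := Hps (inU t t1).
    by rewrite expr0 divr1; apply: le_trans (nMB _ _ _) _; rewrite lerD.
  have e0 : e 0 = 0.
    by rewrite /e z0; have [[-> _] _ _ _ _] := Hps v0r; rewrite subrr.
  have /choice[Z HZ] : forall t, exists Z, nK t <= 1 -> hasd e t (e t *m Z) /\ nM Z <= 1 / 2.
    move=> t'; have [/He[Z h1 h2]|_] := lerP (nK t') 1; first by exists Z.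
    by exists 0.
  have := @mean_value _ _ nd _ _ e (fun t => e t *m Z t) ((C + B) / 2 ^+ n.+1) t t1.
  rewrite e0 subr0; apply=> t' t'1; have [h1 h2] := HZ t' t'1; split=> //.
  apply: le_trans (nM_mul _ _ _) _.
  rewrite exprSr invfM mulrA; apply: ler_pM; rewrite ?nMp ?IH //; lra.
apply/eqP; rewrite -subr_eq0; apply/eqP/(@nM_eq0 _ _ nd).
by apply: (@halves_to0 _ _ (C + B)) => n; apply: bnd; rewrite nK1.
Qed.

(** The image under [ps] and [g] of the straight segment from [u] to [u'] is tangent to the orbits,
    with a generator of size proportional to [u' - u]; starting at [ps v], it remains in the
    slice. *)
Lemma translate_open g v u : exp_group g -> nM (u - w0) < r -> nM (v - w0) < r ->
  ps u *m g = ps v ->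
  exists2 e, 0 < e & forall u', nM (u' - u) < e ->
    nM (u' - w0) < r /\ exists2 v', nM (v' - w0) < r & ps u' *m g = ps v'.
Proof.
move=> Gg ur vr E.
have C0 : 0 <= B * nM g by rewrite mulr_ge0 ?nMp.
have [eta eta0 Heta] := tangent_curve_in_chart vr C0.
have [Cg Cg0 HCg] := gmat_bound.
have [Ad HAd] := exp_group_conj gmat_bracket Gg.
have ru : 0 < r - nM (u - w0) by lra.
pose Q := B * nM s * nM Ad * Cg.
have Q0 : 0 <= Q by rewrite !mulr_ge0 ?nMp.
exists (Num.min (r - nM (u - w0)) (eta / (Q + 1))).
  by rewrite lt_min ru divr_gt0 //; lra.
move=> u'; rewrite lt_min => /andP[h1 h2].
rewrite ltr_pdivlMr in h2; last by lra.
have inU t : nK t <= 1 -> nM (u + t *: (u' - u) - w0) < r.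
  move=> t1; rewrite addrAC; apply: le_lt_trans (nMD _ _ _) _; rewrite nMZ.
  have := nMp _ _ (u' - u); nra.
have u'r : nM (u' - w0) < r.
  by have := inU 1; rewrite scale1r [u + _]addrC subrK nK1; apply.
split=> //.
pose z t := ps (u + t *: (u' - u)) *m g.
pose c t := (u' - u) *m invmx (s *m tan_mx (ps (u + t *: (u' - u))) *m p) *m s *m Ad.
have := Heta z (fun t => gmat (c t)).
rewrite /z scale0r addr0 scale1r [u + _]addrC subrK => /(_ E)[].
  move=> t t1; have [[_ Nu] HJ _ _ [b1 b2]] := Hps (inU t t1).
  split; first by exists (c t).
  - apply: hasD_eq (hasD_mull nKp g (hasd_line HJ)) => // h.
    rewrite -scalemxAl; congr (_ *: _); rewrite -[in RHS]mulmxA -HAd mulmxA.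
    by rewrite -tan_mxE /Smx !mulmxA.
  - apply: le_trans (HCg _) _.
    have : nM (c t) <= nM (u' - u) * B * nM s * nM Ad.
      do 2![apply: le_trans (nM_mul _ _ _) _; rewrite ler_wpM2r ?nMp //].
      by apply: le_trans (nM_mul _ _ _) _; rewrite ler_wpM2l ?nMp.
    move=> /(ler_wpM2l Cg0) /le_trans; apply.
    have -> : Cg * (nM (u' - u) * B * nM s * nM Ad) = nM (u' - u) * Q by rewrite /Q; ring.
    by have := nMp _ _ (u' - u); lra.
  - by apply: le_trans (nM_mul _ _ _) _; rewrite ler_wpM2r ?nMp.
by move=> h3 h4; exists (ps u' *m g *m p).
Qed.

(** The curve from [ps v] obtained by applying [g], the exponential of [t c], that of [- t c'] and
    the inverse of [g] has as generator a conjugate of [c - c']. When this is small, its end point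
    is a point [ps v'] of the slice. *)
Lemma step_approx v g c : exp_group g -> nM (v - w0) < r ->
  exists2 e, 0 < e & forall c', nM (c - c') < e ->
    exists2 v', nM (v' - w0) < r &
      ps v *m g *m mexp (gmat c) = ps v' *m (g *m mexp (gmat c')).
Proof.
move=> Gg vr.
have [Cg Cg0 HCg] := gmat_bound.
have [E E0 HE] := mexp_bound nd d (Cg * (nM c + 1)).
have C0 : 0 <= B * nM g * E * E * nM (invmx g) by rewrite !mulr_ge0 ?nMp.
have [eta eta0 Heta] := tangent_curve_in_chart vr C0.
pose Q := nM g * E * Cg * E * nM (invmx g).
have Q0 : 0 <= Q by rewrite !mulr_ge0 ?nMp.
exists (Num.min 1 (eta / (Q + 1))).
  by rewrite lt_min ltr01 divr_gt0 //; lra.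
move=> c'; rewrite lt_min => /andP[h1 h2].
rewrite ltr_pdivlMr in h2; last by lra.
have c'1 : nM c' <= nM c + 1.
  by have := nMB nd c (c - c'); rewrite opprB addrC subrK; lra.
have bE t k : nK t <= 1 -> nM k <= nM c + 1 -> nM (mexp (t *: gmat k)) <= E.
  move=> t1 k1; apply: HE; rewrite nMZ.
  apply: le_trans (ler_piMl (nMp _ _ _) t1) _; apply: le_trans (HCg _) _.
  by rewrite ler_wpM2l.
have c1 : nM c <= nM c + 1 by lra.
have gu := exp_group_unit Gg.
pose h t := g *m mexp (t *: gmat c').
pose h' t := mexp (t *: - gmat c') *m invmx g.
have hh t : h' t *m h t = 1%:M.
  rewrite /h /h' !mulmxA mulmxKV // -{2}(opprK (gmat c')).
  by rewrite [t *: - - _]scalerN mexpN.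
have Gh t : exp_group (h t) by rewrite /h -linearZ; apply: GgenS.
have h'E t : h' t = invmx (h t).
  by rewrite -[RHS]mul1mx -(hh t) mulmxK ?(exp_group_unit (Gh t)).
pose z t := ps v *m g *m mexp (t *: gmat c) *m h' t.
pose A t := h t *m gmat (c - c') *m h' t.
have := Heta z A; rewrite /z /h' !scale0r mexp0 mul1mx mulmx1 mulmxK // => /(_ erefl)[].
  move=> t t1; split.
  - have [Ad HAd] := exp_group_conj gmat_bracket (exp_group_inv (Gh t)).
    exists ((c - c') *m Ad); rewrite /A h'E -mulmxA HAd mulmxA mulmxV ?mul1mx //.
    exact: (exp_group_unit (Gh t)).
  - have H := hasD_mull nKp (invmx g) (hasD_mul nKp
    (hasD_mulr nKp (ps v *m g) (mexp_der nd (gmat c) t)) (mexp_der nd (- gmat c') t)).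
    apply: hasD_eq H => [k|k]; first by rewrite !mulmxA.
    rewrite /A -/(h' t).
    have -> : mexp (t *: - gmat c') *m - gmat c' = - gmat c' *m mexp (t *: - gmat c').
      have [->|t0] := eqVneq t 0; first by rewrite !scale0r mexp0 mul1mx mulmx1.
      have /eqP := mexp_comm nd (t *: - gmat c').
      by rewrite -scalemxAl -scalemxAr => /eqP/(scalerI t0).
    have -> : gmat (c - c') = gmat c - gmat c' := linearB (gmat : {linear _ -> _}) c c'.
    exact: conj_velocity (hh t).
  - have h'b : nM (h' t) <= E * nM (invmx g).
      apply: le_trans (nM_mul _ _ _) _; rewrite ler_wpM2r ?nMp // scalerN -scaleNr.
      by apply: bE; rewrite ?nKN.
    have hb : nM (h t) <= nM g * E.
      by apply: le_trans (nM_mul _ _ _) _; rewrite ler_wpM2l ?nMp // bE.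
    apply: (@le_trans _ _ (nM g * E * (Cg * nM (c - c')) * (E * nM (invmx g)))).
      apply: le_trans (nM_mul _ _ _) _; apply: ler_pM; rewrite ?nMp //.
      by apply: le_trans (nM_mul _ _ _) _; apply: ler_pM; rewrite ?nMp.
    have -> : nM g * E * (Cg * nM (c - c')) * (E * nM (invmx g)) = nM (c - c') * Q.
      by rewrite /Q; ring.
    by have := nMp _ _ (c - c'); lra.
  - have [_ _ _ _ [b1 _]] := Hps vr.
    have -> : B * nM g * E * E * nM (invmx g) = B * nM g * E * (E * nM (invmx g)).
      by ring.
    apply: le_trans (nM_mul _ _ _) _; apply: ler_pM; rewrite ?nMp //.
      apply: le_trans (nM_mul _ _ _) _; apply: ler_pM; rewrite ?nMp // ?bE //.
      by apply: le_trans (nM_mul _ _ _) _; rewrite ler_wpM2r ?nMp.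
    apply: le_trans (nM_mul _ _ _) _; rewrite ler_wpM2r ?nMp // scalerN -scaleNr.
    by apply: bE; rewrite ?nKN.
rewrite !scale1r => h3 h4; eexists; first exact: h3.
rewrite -h4 !mulmxA mulmxKV // -{2}(opprK (gmat c')) mexpK.
by [].
Qed.

Definition gword (l : seq ('I_N -> nat)) : 'M[K]_d :=
  foldl (fun g t => g *m mexp (gmat (\row_i dense_seq nd (t i)))) 1%:M l.

Lemma gword_exp_group l : exp_group (gword l).
Proof.
elim/last_ind: l => [|l t IH]; first exact: Ggen1.
by rewrite /gword foldl_rcons; apply: GgenS.
Qed.

Lemma dense_seq_dense_row (c : 'rV[K]_N) e : 0 < e ->
  exists t : 'I_N -> nat, nM (c - \row_i dense_seq nd (t i)) < e.
Proof.
move=> e0; have eN : 0 < e / (N.+1%:R) by rewrite divr_gt0.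
have /choice[t Ht] : forall i, exists n, nK (c 0 i - dense_seq nd n) < e / N.+1%:R.
  by move=> i; apply: dense_seq_dense.
exists t; rewrite /mx_norm1 big_ord1.
apply: (@le_lt_trans _ _ (\sum_(i < N) e / N.+1%:R)).
  by apply: ler_sum => i _; rewrite !mxE ltW.
rewrite sumr_const card_ord -[_ *+ N]mulr_natr [_ / _ * _]mulrAC ltr_pdivrMr // ltr_pM2l //.
by rewrite ltr_nat.
Qed.

(** Each exponential of a word is replaced by one with parameters in the dense sequence, and the
    error is absorbed by moving [v] inside the slice. *)
Lemma countable_cover h : exp_group h ->
  exists l, exists2 v, nM (v - w0) < r & X *m h = ps v *m gword l.
Proof.
elim=> [|h' c Gh [l [v vr E]]].
  exists [::], w0; last by rewrite psX !mulmx1.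
  by rewrite subrr nM0.
have [e e0 He] := step_approx c (gword_exp_group l) vr.
have [t Ht] := dense_seq_dense_row c e0; have [v' v'r E'] := He _ Ht.
exists (rcons l t), v' => //; rewrite mulmxA E E'.
by rewrite /gword foldl_rcons.
Qed.

End Cover.

(** * Smoothness of rational functions of a slice *)

Section Convert.
Variables (R : realType) (K : numFieldType) (nd : norm_data R K).
Local Notation nK := (nK nd).
Local Notation nM := (@mx_norm1 _ _ nd _ _).
Local Notation emb := (emb nd).

Lemma mx_norm_le m n (A : 'M[K]_(m, n)) : `|A| <= emb (nM A).
Proof.
have [->|A0] := eqVneq `|A| 0; first by rewrite -(rmorph0 emb) emb_le nM_ge0.
have [i Hi] := @mx_norm_neq0 K m n A A0.
by rewrite (Hi : `|A| = _) (norm_emb nd) emb_le nM_entry.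
Qed.

Lemma entry_le_mx_norm m n (A : 'M[K]_(m, n)) i j : `|A i j| <= `|A|.
Proof.
rewrite -[`|A|]/(mx_norm A) mx_normE -[leLHS]nngE num_le; apply/bigmax_geP; right.
by exists (i, j).
Qed.

Lemma le_mx_norm m n (A : 'M[K]_(m, n)) : emb (nM A) <= (m * n)%:R * `|A|.
Proof.
rewrite /mx_norm1 rmorph_sum natrM -mulrA mulr_natl -[X in _ *+ X]card_ord -sumr_const.
apply: ler_sum => i _; rewrite rmorph_sum mulr_natl -[X in _ *+ X]card_ord -sumr_const.
by apply: ler_sum => j _; rewrite -norm_emb entry_le_mx_norm.
Qed.

Lemma nbhs0_nM m n (P : set 'M[K]_(m, n)) :
  (\forall h \near (0 : 'M[K]_(m, n)), P h) <->
  exists2 e, 0 < e & forall h, nM h < e -> P h.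
Proof.
split=> [/nbhs_norm0P[e e0 He]|[e e0 He]].
  have Ee : e = emb (nK e) by rewrite -norm_emb gtr0_norm.
  exists (nK e); first by rewrite -(emb_lt nd) -Ee rmorph0.
  move=> h he; apply: He => /=; rewrite Ee; apply: le_lt_trans (mx_norm_le h) _.
  by rewrite emb_lt.
(* The successor keeps the denominator nonzero for empty matrices. *)
apply/nbhs_norm0P; exists (emb e / (m * n).+1%:R).
  by rewrite /= divr_gt0 // -(rmorph0 emb) emb_lt.
move=> h /=; rewrite ltr_pdivlMr // => h1; apply: He.
rewrite -(emb_lt nd); apply: le_lt_trans (le_mx_norm h) _.
by apply: le_lt_trans h1; rewrite mulrC ler_wpM2l // ler_nat.
Qed.

Lemma nbhs0_nK (P : set K) :
  (\forall h \near (0 : K^o), P h) <-> exists2 e, 0 < e & forall h, nK h < e -> P h.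
Proof.
split=> [/nbhs_norm0P[e e0 He]|[e e0 He]].
  have Ee : e = emb (nK e) by rewrite -norm_emb gtr0_norm.
  exists (nK e); first by rewrite -(emb_lt nd) -Ee rmorph0.
  by move=> h he; apply: He => /=; rewrite Ee (norm_emb nd) emb_lt.
apply/nbhs_norm0P; exists (emb e); first by rewrite /= -(rmorph0 emb) emb_lt.
by move=> h /=; rewrite (norm_emb nd) emb_lt => /He.
Qed.

Lemma open_nM m n (U : set 'M[K]_(m, n)) :
  (forall u, U u -> exists2 e, 0 < e & forall h, nM (h - u) < e -> U h) -> open U.
Proof.
move=> H; rewrite openE => u /H[e e0 He]; rewrite /interior.
suff : \forall h \near u, U h by [].
apply/(nbhs0P (V := 'M[K]_(m, n)))/nbhs0_nM; exists e => // h he; apply: He.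
by rewrite [u + h]addrC addrK.
Qed.

(** The bound contained in [hasD] makes [L] continuous; uniqueness of the differential then
    identifies it. *)
Lemma hasD_diff m n p q (f : 'M[K]_(m, n) -> 'M[K]_(p, q))
    (L : {linear 'M[K]_(m, n) -> 'M[K]_(p, q)}) u :
  hasD nd nM f u L -> differentiable f u /\ 'd f u = L :> (_ -> _).
Proof.
move=> [[C HC] H].
have Lc : continuous L.
  apply/linear_bounded_continuous; apply/bounded_funP => r.
  have [r0|r0] := boolP (0 <= r); last first.
    exists 0 => x xr; case/negP: r0; exact: le_trans xr.
  exists (emb `|C| * ((m * n)%:R * r)) => x xr.
  apply: le_trans (mx_norm_le _) _.
  apply: (@le_trans _ _ (emb (`|C| * nM x))).
    by rewrite emb_le (le_trans (HC x)) // ler_wpM2r ?nM_ge0 // ler_norm.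
  rewrite rmorphM ler_wpM2l //; first by rewrite -(rmorph0 emb) emb_le.
  by apply: le_trans (le_mx_norm x) _; rewrite ler_wpM2l.
have E : f \o shift u = cst (f u) + L +o_ (0 : 'M[K]_(m, n)) id.
  apply/eqaddoP => e e0; apply/nbhs0_nM.
  have Ee : e = emb (nK e) by rewrite -norm_emb gtr0_norm.
  have e0' : 0 < nK e / (m * n).+1%:R.
    by rewrite divr_gt0 // -(emb_lt nd) -Ee rmorph0.
  have [d d0 Hd] := H _ e0'; exists d => // h /Hd h1.
  rewrite /= fctE /= opprD addrA [h + u]addrC; apply: le_trans (mx_norm_le _) _.
  apply: (@le_trans _ _ (emb (nK e / (m * n).+1%:R * nM h))).
    by rewrite emb_le.
  rewrite rmorphM rmorphM -Ee fmorphV rmorph_nat -mulrA.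
  apply: ler_wpM2l; first exact: ltW.
  rewrite ler_pdivrMl ?ltr0Sn //; apply: le_trans (le_mx_norm h) _.
  by rewrite ler_wpM2r // ler_nat.
have D : 'd f u = L :> (_ -> _) by apply: diff_unique.
by split=> //; apply/diff_locallyP; rewrite D.
Qed.

Lemma hasd_is_derive m n (f : K -> 'M[K]_(m, n)) t D :
  hasd nd f t D -> is_derive (t : K^o) (1 : K^o) (f : K^o -> 'M[K]_(m, n)) D.
Proof.
move=> [_ H].
have L : (fun h : K^o => h^-1 *: (f (h *: (1 : K^o) + t) - f t)) @ 0^' --> D.
  apply/cvgrPdist_le => e e0; rewrite near_withinE.
  have Ee : e = emb (nK e) by rewrite -norm_emb gtr0_norm.
  have e0' : 0 < nK e by rewrite -(emb_lt nd) -Ee rmorph0.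
  have [d d0 Hd] := H _ e0'; apply/nbhs0_nK; exists d => // h /Hd h1 h0.
  rewrite -normrN opprB; apply: le_trans (mx_norm_le _) _; rewrite Ee emb_le.
  have -> : h^-1 *: (f (h *: (1 : K^o) + t) - f t) - D =
            h^-1 *: (f (t + h) - f t - h *: D).
    by rewrite [RHS]scalerBr scalerA mulVf // scale1r [h *: _]mulr1 [h + t]addrC.
  rewrite nMZ nKV ler_pdivrMl; last first.
    by rewrite lt_neqAle nK_ge0 andbT eq_sym; apply: contra h0 => /eqP/nK_eq0/eqP.
  by rewrite mulrC.
by apply: DeriveDef; [apply/cvg_ex; exists D|apply: cvg_lim].
Qed.

Lemma is_derive_hasd m n (f : K -> 'M[K]_(m, n)) t D :
  is_derive (t : K^o) (1 : K^o) (f : K^o -> 'M[K]_(m, n)) D -> hasd nd f t D.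
Proof.
move=> [/derivable_nbhsP/eqaddoP H DE]; split; first by exists (nM D) => h; rewrite nMZ mulrC.
move=> e e0; have e0' : 0 < emb (e / (m * n).+1%:R).
  by rewrite -(rmorph0 emb) emb_lt divr_gt0.
have /nbhs0_nK[d d0 Hd] := H _ e0'; exists d => // h /Hd.
rewrite /= fctE /= DE opprD addrA [h *: (1 : K^o)]mulr1 [h + t]addrC => h1.
rewrite -(emb_le nd); apply: le_trans (le_mx_norm _) _.
apply: (@le_trans _ _ ((m * n).+1%:R * (emb (e / (m * n).+1%:R) * `|h|))).
  by apply: ler_pM => //; rewrite ler_nat.
by rewrite mulrA !rmorphM fmorphV rmorph_nat [_.+1%:R * _]mulrC divfK ?(norm_emb nd) ?pnatr_eq0.
Qed.

End Convert.

Section Rational.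
Variables (K : numFieldType) (m : nat) (U : set 'rV[K]_m).
Hypothesis oU : open U.

(** Formulas for differentials of the slice are available on the open set [U] only; this transports
    derivatives across such local identities. *)
Lemma near_eq_diff (V W : normedModType K) (f g : V -> W) u :
  (\forall x \near u, f x = g x) -> differentiable f u ->
  differentiable g u /\ forall v, 'd g u v = 'd f u v.
Proof.
move=> fg df; have E : g \o shift u = cst (g u) + 'd f u +o_ (0 : V) id.
  apply/eqaddoP => e e0.
  have /eqaddoP /(_ e e0) H := diff_locally df.
  have : \forall h \near (0 : V), f (u + h) = g (u + h). by apply/(nbhs0P (fun x => f x = g x)).

  apply: filter_app; apply: filter_app H; near=> h => /= + Eh.
  by rewrite /= !fctE /= [h + u]addrC Eh (nbhs_singleton fg).
have D : 'd g u = 'd f u :> (V -> W) by apply: diff_unique E; exact: diff_continuous.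
split; last by move=> v; rewrite D.
by apply/diff_locallyP; rewrite D; split=> //; exact: diff_continuous.
Unshelve. all: by end_near. Qed.

Lemma diff_entry p q (F : 'rV[K]_m -> 'M[K]_(p, q)) u v i j :
  differentiable F u -> ('d F u v) i j = 'd (fun u => F u i j : K^o) u v.
Proof.
move=> dF.
have lin : linear (fun N : 'M[K]_(p, q) => N i j : K^o) by move=> k A B; rewrite !mxE.
pose c := HB.pack_for {linear 'M[K]_(p, q) -> K^o} (fun N : 'M[K]_(p, q) => N i j : K^o)
  (GRing.isLinear.Build _ _ _ _ _ lin).
have cc : continuous c by exact: coord_continuous.
have := diff_comp dF (linear_differentiable (F u) cc).
by rewrite (diff_lin _ cc) => /(congr1 (fun h => h v)) /= <-.
Qed.

Lemma differentiable_mx p q (F : 'rV[K]_m -> 'M[K]_(p, q)) u :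
  (forall i j, differentiable (fun u => F u i j : K^o) u) -> differentiable F u.
Proof.
move=> H.
have -> : F = \sum_(i < p) \sum_(j < q) (fun u => (F u i j : K^o) *: delta_mx i j).
  apply/funext => v; rewrite {1}(matrix_sum_delta (F v)) fct_sumE.
  by apply: eq_bigr => i _; rewrite fct_sumE.
apply: differentiable_sum => i; apply: differentiable_sum => j.
exact: differentiableZl.
Qed.

Section Class.
Variables (I : Type) (gen : I -> 'rV[K]_m -> K).

(** A syntactic class, so that its closure under differentiation is an induction once the
    derivatives of the generators belong to it. *)
Inductive rational : ('rV[K]_m -> K) -> Prop :=
| rat_cst c : rational (fun=> c)
| rat_gen i : rational (gen i)
| rat_add f g : rational f -> rational g -> rational (fun u => f u + g u)
| rat_mul f g : rational f -> rational g -> rational (fun u => f u * g u)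
| rat_inv f : rational f -> (forall u, U u -> f u != 0) -> rational (fun u => (f u)^-1).

Definition rational_entries p q (F : 'rV[K]_m -> 'M[K]_(p, q)) :=
  forall i j, rational (fun u => F u i j).
Local Notation rational_mx := rational_entries.

Lemma rat_eq f g : rational f -> (forall u, f u = g u) -> rational g.
Proof. by move=> h /funext <-. Qed.

Lemma rat_sum J (r : seq J) P (F : J -> 'rV[K]_m -> K) :
  (forall j, rational (F j)) -> rational (fun u => \sum_(j <- r | P j) F j u).
Proof.
move=> H; elim: r => [|j r IH].
  by apply: (rat_eq (rat_cst 0)) => u; rewrite big_nil.
have [Pj|Pj] := boolP (P j).
  by apply: (rat_eq (rat_add (H j) IH)) => u; rewrite big_cons Pj.
by apply: (rat_eq IH) => u; rewrite big_cons (negbTE Pj).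
Qed.

Lemma rat_prod J (r : seq J) P (F : J -> 'rV[K]_m -> K) :
  (forall j, rational (F j)) -> rational (fun u => \prod_(j <- r | P j) F j u).
Proof.
move=> H; elim: r => [|j r IH].
  by apply: (rat_eq (rat_cst 1)) => u; rewrite big_nil.
have [Pj|Pj] := boolP (P j).
  by apply: (rat_eq (rat_mul (H j) IH)) => u; rewrite big_cons Pj.
by apply: (rat_eq IH) => u; rewrite big_cons (negbTE Pj).
Qed.

Lemma ratm_cst p q (A : 'M[K]_(p, q)) : rational_mx (fun=> A).
Proof. by move=> i j; apply: rat_cst. Qed.

Lemma ratm_mul p q r (F : 'rV[K]_m -> 'M[K]_(p, q)) (G : 'rV[K]_m -> 'M[K]_(q, r)) :
  rational_mx F -> rational_mx G -> rational_mx (fun u => F u *m G u).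
Proof.
move=> HF HG i j; apply: (@rat_eq (fun u => \sum_k F u i k * G u k j)).
  by apply: rat_sum => k; apply: rat_mul.
by move=> u; rewrite mxE.
Qed.

Lemma ratm_tr p q (F : 'rV[K]_m -> 'M[K]_(p, q)) :
  rational_mx F -> rational_mx (fun u => (F u)^T).
Proof. by move=> HF i j; apply: (rat_eq (HF j i)) => u; rewrite mxE. Qed.

Lemma rat_det p (F : 'rV[K]_m -> 'M[K]_p) :
  rational_mx F -> rational (fun u => \det (F u)).
Proof.
move=> HF; rewrite /determinant; apply: rat_sum => s.
by apply: rat_mul; [apply: rat_cst|apply: rat_prod => i; apply: HF].
Qed.

(** Cramer's formula. The equality is restricted to [U] because [invmx] returns a singular matrix
    unchanged. *)
Lemma ratm_inv p (F : 'rV[K]_m -> 'M[K]_p) : rational_mx F ->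
  (forall u, U u -> F u \in unitmx) ->
  exists2 G, rational_mx G & forall u, U u -> G u = invmx (F u).
Proof.
move=> HF Hu; exists (fun u => (\det (F u))^-1 *: \adj (F u)); last first.
  by move=> u /Hu Fu; rewrite /invmx Fu.
move=> i j; apply: (@rat_eq (fun u => (\det (F u))^-1 *
  ((-1) ^+ (j + i) * \det (row' j (col' i (F u)))))).
  apply: rat_mul.
    apply: rat_inv; first exact: rat_det.
    by move=> u /Hu; rewrite unitmxE unitfE.
  apply: rat_mul; first exact: rat_cst.
  by apply: rat_det => k l; apply: (rat_eq (HF (lift j k) (lift i l))) => u; rewrite !mxE.
by move=> u; rewrite !mxE.
Qed.

Hypothesis gen_diff : forall i u, U u -> differentiable (gen i : 'rV[K]_m -> K^o) u.
Hypothesis gen_rational : forall i v, exists2 g, rational g &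
  forall u, U u -> 'd (gen i : 'rV[K]_m -> K^o) u v = g u.

Lemma rational_diff f : rational f ->
  (forall u, U u -> differentiable (f : 'rV[K]_m -> K^o) u) /\
  forall v, exists2 g, rational g & forall u, U u -> 'd (f : 'rV[K]_m -> K^o) u v = g u.
Proof.
elim=> [c|i|f1 f2 _ [d1 H1] _ [d2 H2]|f1 f2 r1 [d1 H1] r2 [d2 H2]|f1 r1 [d1 H1] n0].
- split=> [u _|v]; first exact: differentiable_cst.
  by exists (fun=> 0); [apply: rat_cst|move=> u _; rewrite diff_cst].
- by split=> [u|v]; [apply: gen_diff|apply: gen_rational].
- split=> [u Uu|v]; first by apply: differentiableD; [apply: d1|apply: d2].
  have [g1 R1 E1] := H1 v; have [g2 R2 E2] := H2 v.
  exists (fun u => g1 u + g2 u); first exact: rat_add.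
  move=> u Uu; have := diffD (d1 u Uu) (d2 u Uu) => /(congr1 (fun h => h v)) H.
  by apply: etrans H _; rewrite -E1 // -E2.
- split=> [u Uu|v]; first by apply: differentiableM; [apply: d1|apply: d2].
  have [g1 R1 E1] := H1 v; have [g2 R2 E2] := H2 v.
  exists (fun u => f1 u * g2 u + f2 u * g1 u).
    by apply: rat_add; apply: rat_mul.
  move=> u Uu; have := diffM (d1 u Uu) (d2 u Uu) => /(congr1 (fun h => h v)) /= ->.
  by rewrite -(E1 u Uu) -(E2 u Uu).
- split=> [u Uu|v]; first by apply: differentiableV; [apply: d1|apply: n0].
  have [g1 R1 E1] := H1 v.
  exists (fun u => (- 1) * ((f1 u)^-1 * (f1 u)^-1 * g1 u)).
    apply: rat_mul; first exact: rat_cst.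
    by apply: rat_mul => //; apply: rat_mul; apply: rat_inv.
  move=> u Uu; have := diffV (d1 u Uu) (n0 u Uu) => /(congr1 (fun h => h v)) /= ->.
  rewrite -(E1 u Uu) mulN1r -mulNr -invfM -expr2. by [].
Qed.

Lemma rational_mx_diff p q (F : 'rV[K]_m -> 'M[K]_(p, q)) : rational_mx F ->
  (forall u, U u -> differentiable F u) /\
  forall v, exists2 G : 'rV[K]_m -> 'M[K]_(p, q), rational_mx G &
    forall u, U u -> 'd F u v = G u.
Proof.
move=> HF.
have dF u : U u -> differentiable F u.
  by move=> Uu; apply: differentiable_mx => i j; have [+ _] := rational_diff (HF i j); apply.
split=> // v.
have /choice[G HG] : forall ij : 'I_p * 'I_q, exists g, rational g /\
    forall u, U u -> 'd (fun u => F u ij.1 ij.2 : K^o) u v = g u.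
  by move=> ij; have [_ /(_ v)[g]] := rational_diff (HF ij.1 ij.2); exists g.
exists (fun u => \matrix_(i, j) G (i, j) u).
  by move=> i j; apply: (rat_eq (HG (i, j)).1) => u; rewrite mxE.
move=> u Uu; apply/matrixP => i j; rewrite mxE (diff_entry v i j (dF u Uu)).
by have [_ ->] := HG (i, j).
Qed.

(** The induction is on functions that agree on [U] with a rational one: a directional derivative is
    rational only there. *)
Lemma rational_mx_Ck k p q (F : 'rV[K]_m -> 'M[K]_(p, q)) :
  (exists2 G, rational_mx G & forall u, U u -> F u = G u) -> Ck k U F.
Proof.
elim: k F => [|k IH] F [G RG FG].
  move=> u Uu; have [dG _] := rational_mx_diff RG.
  have nGF : \forall x \near u, G x = F x.
    by have := open_nbhs_nbhs (conj oU Uu); apply: filterS => x /FG ->.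
  have [/differentiable_continuous + _] := near_eq_diff nGF (dG u Uu).
  exact.
have [dG HG] := rational_mx_diff RG.
have H u : U u -> differentiable F u /\ forall v, 'd F u v = 'd G u v.
  move=> Uu; have nGF : \forall x \near u, G x = F x.
    by have := open_nbhs_nbhs (conj oU Uu); apply: filterS => x /FG ->.
  exact: near_eq_diff nGF (dG u Uu).
split=> [u /H[]//|v]; apply: IH; have [G' RG' E'] := HG v.
exists G'; first exact: RG'.
by move=> u Uu; have [_ dE] := H u Uu; exact: etrans (dE v) (E' u Uu).
Qed.

Lemma rational_smooth p q (F : 'rV[K]_m -> 'M[K]_(p, q)) :
  rational_mx F -> smooth_on U F.
Proof. by move=> HF k; apply: rational_mx_Ck; exists F. Qed.

End Class.

Lemma Ck_sub (V W : normedModType K) k (A B : set V) (f : V -> W) :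
  A `<=` B -> Ck k B f -> Ck k A f.
Proof.
move=> AB; elim: k f => [|k IH] f /=; first by move=> H u /AB; apply: H.
by move=> [H1 H2]; split=> [u /AB|v]; [apply: H1|apply: IH].
Qed.

Section Psi.
Variables (d N : nat) (a : 'I_N -> 'M[K]_d) (s : 'M[K]_(m, N)) (p : 'M[K]_(d, m)).
Variable ps : 'rV[K]_m -> 'rV[K]_d.
Hypothesis ps_unit : forall u, U u -> s *m tan_mx a (ps u) *m p \in unitmx.
Hypothesis ps_diff : forall u, U u -> differentiable ps u.
Hypothesis ps_d : forall u v, U u -> 'd ps u v = v *m slice_mx a s p (ps u).

Local Notation gen := (fun i u => ps u 0 i).
Local Notation rational := (rational gen).
Local Notation rational_mx := (rational_entries gen).

Lemma ratm_ps : rational_mx ps.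
Proof. by move=> i j; rewrite !ord1; apply: (rat_gen gen). Qed.

Lemma ratm_tan_mx F : rational_mx F -> rational_mx (fun u => tan_mx a (F u)).
Proof.
move=> HF i j; apply: (@rat_eq _ gen (fun u => (F u *m a i) 0 j)).
  by apply: ratm_mul => //; apply: ratm_cst.
by move=> u; rewrite !mxE.
Qed.

Lemma ps_gen_diff i u : U u -> differentiable (gen i : 'rV[K]_m -> K^o) u.
Proof.
move=> Uu.
exact: (differentiable_comp (ps_diff Uu) (differentiable_coord (ps u) 0 i)).
Qed.

(** The autonomous equation [ps_d] closes the class: the derivative of a coordinate of the slice is
    built from the slice by products and one matrix inverse. *)
Lemma ps_gen_rational i v : exists2 g, rational g &
  forall u, U u -> 'd (gen i : 'rV[K]_m -> K^o) u v = g u.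
Proof.
have RN : rational_mx (fun u => s *m tan_mx a (ps u) *m p).
  by do 2?apply: ratm_mul; try exact: ratm_cst; exact/ratm_tan_mx/ratm_ps.
have [G RG HG] := ratm_inv RN ps_unit.
exists (fun u => (v *m (G u *m s *m tan_mx a (ps u))) 0 i).
  do 3?apply: ratm_mul; try exact: ratm_cst; first exact: RG.
  exact/ratm_tan_mx/ratm_ps.
by move=> u Uu; rewrite -diff_entry ?ps_d ?HG //; apply: ps_diff.
Qed.

Lemma ps_smooth q r (F : 'rV[K]_m -> 'M[K]_(q, r)) : rational_mx F -> smooth_on U F.
Proof. exact: (rational_smooth ps_gen_diff ps_gen_rational). Qed.

Lemma ps_rational_diff q r (F : 'rV[K]_m -> 'M[K]_(q, r)) u :
  rational_mx F -> U u -> differentiable F u.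
Proof.
by move=> HF; have [+ _] := rational_mx_diff ps_gen_diff ps_gen_rational HF; apply.
Qed.

End Psi.
End Rational.

(** * Cochains of degree one and two *)

Section Tuples.
Variable n : nat.

Lemma tuple1_eta (t : 1.-tuple 'I_n) : t = [tuple tnth t ord0].
Proof. by apply: eq_from_tnth => i; rewrite ord1. Qed.

Lemma tuple2_eta (t : 2.-tuple 'I_n) : t = [tuple tnth t ord0; tnth t ord_max].
Proof.
apply: eq_from_tnth => -[[|[|]] // H]; rewrite [RHS]/tnth /=; congr (tnth t _); exact: val_inj.
Qed.

Lemma tuple3_eta (t : 3.-tuple 'I_n) : exists i j k, t = [tuple i; j; k].
Proof. by case: t => -[|i [|j [|k [|]]]] //= H; exists i, j, k; apply: val_inj. Qed.

Lemma sum_tuple1 (V : nmodType) (F : 1.-tuple 'I_n -> V) :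
  \sum_t F t = \sum_i F [tuple i].
Proof.
rewrite (reindex (fun i : 'I_n => [tuple i])) //.
by exists (fun t => tnth t ord0) => [i _ //|t _]; rewrite -tuple1_eta.
Qed.

Lemma sum_tuple2 (V : nmodType) (F : 2.-tuple 'I_n -> V) :
  \sum_t F t = \sum_i \sum_j F [tuple i; j].
Proof.
rewrite pair_big /= (reindex (fun ij : 'I_n * 'I_n => [tuple ij.1; ij.2])) //.
exists (fun t => (tnth t ord0, tnth t ord_max)) => [[i j] _ //|t _].
by rewrite -tuple2_eta.
Qed.

Lemma cochain2P (T : Type) (f g : {ffun 2.-tuple 'I_n -> T}) :
  (forall i j, f [tuple i; j] = g [tuple i; j]) -> f = g.
Proof. by move=> H; apply/ffunP => t; rewrite (tuple2_eta t). Qed.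

Lemma cochain1P (T : Type) (f g : {ffun 1.-tuple 'I_n -> T}) :
  (forall i, f [tuple i] = g [tuple i]) -> f = g.
Proof. by move=> H; apply/ffunP => t; rewrite (tuple1_eta t). Qed.

End Tuples.

Section SmallPermutations.

Lemma perm1_eq (s : 'S_1) : s = 1%g.
Proof. by apply/permP => i; rewrite !ord1. Qed.

Definition ord3_0 : 'I_3 := @Ordinal 3 0 isT.
Definition ord3_1 : 'I_3 := @Ordinal 3 1 isT.
Definition ord3_2 : 'I_3 := @Ordinal 3 2 isT.

Lemma ord2P (x : 'I_2) : x = ord0 \/ x = ord_max.
Proof. by case: x => [[|[|//]]] h; [left|right]; apply: val_inj. Qed.

Lemma perm2_eq (s : 'S_2) : s = 1%g \/ s = tperm ord0 ord_max.
Proof.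
have H := ord2P.
have [s0|s0] := H (s ord0); [left|right].
  apply/permP => x; rewrite perm1; have [->//|->] := H x.
  by have [s1|//] := H (s ord_max); have := perm_inj (etrans s1 (esym s0)).
apply/permP => x; have [->|->] := H x; first by rewrite tpermL.
by rewrite tpermR; have [//|s1] := H (s ord_max); have := perm_inj (etrans s1 (esym s0)).
Qed.

Definition perms3 : seq 'S_3 :=
  [:: 1%g; tperm ord3_0 ord3_1; tperm ord3_1 ord3_2; tperm ord3_0 ord3_2;
      (tperm ord3_0 ord3_1 * tperm ord3_0 ord3_2)%g;
        (tperm ord3_0 ord3_2 * tperm ord3_0 ord3_1)%g].

Lemma ord3P (x : 'I_3) : [\/ x = ord3_0, x = ord3_1 | x = ord3_2].
Proof.
case: x => [[|[|[|//]]]] h; [apply: Or31|apply: Or32|apply: Or33];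
  exact: val_inj.
Qed.

Lemma perms3_vals :
  [seq (val (s ord3_0), val (s ord3_1), val (s ord3_2)) | s : 'S_3 <- perms3] =
  [:: (0, 1, 2); (1, 0, 2); (0, 2, 1); (2, 1, 0); (1, 2, 0); (2, 0, 1)]%N.
Proof. by rewrite /= !permE /= !permE. Qed.

Lemma perm3_eq (s s' : 'S_3) :
  (val (s ord3_0), val (s ord3_1), val (s ord3_2)) =
    (val (s' ord3_0), val (s' ord3_1), val (s' ord3_2)) ->
  s = s'.
Proof.
move=> [/val_inj h0 /val_inj h1 /val_inj h2]; apply/permP => x.
by case: (ord3P x) => ->.
Qed.

Lemma perms3_uniq : uniq perms3.
Proof.
apply: (@map_uniq _ _ (fun s : 'S_3 => (val (s ord3_0), val (s ord3_1), val (s ord3_2)))).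
by rewrite perms3_vals.
Qed.

Lemma mem_perms3 (s : 'S_3) : s \in perms3.
Proof.
have neq x y : x != y -> val (s x) <> val (s y).
  by move=> xy /val_inj/perm_inj/eqP; rewrite (negbTE xy).
have h01 : val (s ord3_0) <> val (s ord3_1) by apply: neq.
have h02 : val (s ord3_0) <> val (s ord3_2) by apply: neq.
have h12 : val (s ord3_1) <> val (s ord3_2) by apply: neq.
have : (val (s ord3_0), val (s ord3_1), val (s ord3_2)) \in
    [seq (val (s ord3_0), val (s ord3_1), val (s ord3_2)) | s : 'S_3 <- perms3].
  rewrite perms3_vals.
  move: h01 h02 h12; have := ltn_ord (s ord3_0); have := ltn_ord (s ord3_1).
  have := ltn_ord (s ord3_2); rewrite /=.
  move: (nat_of_ord (s ord3_0)) (nat_of_ord (s ord3_1)) (nat_of_ord (s ord3_2)).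
  by case=> [|[|[|]]] // [|[|[|]]] // [|[|[|]]].
by case/mapP => s' s'in /perm3_eq ->.
Qed.

Lemma sum_perm3 (V : nmodType) (F : 'S_3 -> V) :
  \sum_s F s = \sum_(s <- perms3) F s.
Proof.
rewrite [RHS]big_uniq ?perms3_uniq //=; apply: eq_bigl => s; by rewrite mem_perms3.
Qed.

End SmallPermutations.

Section Cochains.
Variables (K : fieldType) (A : falgType K).
Hypothesis mulAC : commutative (@GRing.mul A).
Hypothesis char0 : forall p, p.+1%:R != 0 :> K.
Local Notation n := (\dim {:A}).
Local Notation e := (vbasis {:A}).
Local Notation cochain := (@cochain K A).
Local Notation e_ i := (e`_(nat_of_ord (i : 'I_n))).

Lemma coord_e i j : coord e i (e_ j) = (i == j)%:R.
Proof. by rewrite coord_free ?(basis_free (vbasisP _)) // eq_sym. Qed.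

Lemma coord_sum (x : A) : x = \sum_(i < n) coord e i x *: e_ i.
Proof. exact: coord_vbasis (memvf x). Qed.

Definition ap1 (f : cochain 1) (x : A) : A := capply f [:: x].
Definition ap2 (f : cochain 2) (x y : A) : A := capply f [:: x; y].

Lemma ap1E f x : ap1 f x = \sum_(i < n) coord e i x *: f [tuple i].
Proof.
rewrite /ap1 /capply sum_tuple1; apply: eq_bigr => i _.
by rewrite /monomial big_ord1.
Qed.

Lemma ap2E f x y :
  ap2 f x y = \sum_(i < n) \sum_(j < n) (coord e i x * coord e j y) *: f [tuple i; j].
Proof.
rewrite /ap2 /capply sum_tuple2; apply: eq_bigr => i _; apply: eq_bigr => j _.
by rewrite /monomial big_ord_recl big_ord1.
Qed.

Lemma capply1 f (x : seq A) : capply (f : cochain 1) x = ap1 f x`_0.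
Proof. by rewrite /ap1 /capply; apply: eq_bigr => t _; rewrite /monomial !big_ord1. Qed.

Lemma capply2 f (x : seq A) : capply (f : cochain 2) x = ap2 f x`_0 x`_1.
Proof.
by rewrite /ap2 /capply; apply: eq_bigr => t _; rewrite /monomial !big_ord_recl !big_ord0.
Qed.

Lemma ap1_e f i : ap1 f (e_ i) = f [tuple i].
Proof.
rewrite ap1E (bigD1 i) //= coord_e eqxx scale1r big1 ?addr0 // => j ji.
by rewrite coord_e (negbTE ji) scale0r.
Qed.

Lemma ap2_e f i j : ap2 f (e_ i) (e_ j) = f [tuple i; j].
Proof.
rewrite ap2E (bigD1 i) //= (bigD1 j) //= !coord_e !eqxx mulr1 scale1r.
rewrite big1 => [|k kj]; last by rewrite coord_e (negbTE kj) mulr0 scale0r.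
rewrite addr0 big1 ?addr0 // => k ki; rewrite big1 // => l _.
by rewrite coord_e (negbTE ki) mul0r scale0r.
Qed.

Lemma ap1_linear f : linear (ap1 f).
Proof.
move=> k x y; rewrite !ap1E scaler_sumr -big_split; apply: eq_bigr => i _.
by rewrite linearP scalerDl scalerA.
Qed.
HB.instance Definition _ f := GRing.isLinear.Build K A A _ (ap1 f) (ap1_linear f).

Lemma ap1Z f k x : ap1 f (k *: x) = k *: ap1 f x.
Proof. exact: linearZ. Qed.

Lemma ap2_linear_l f y : linear (fun x => ap2 f x y).
Proof.
move=> k x x'; rewrite !ap2E scaler_sumr -big_split; apply: eq_bigr => i _ /=.
rewrite scaler_sumr -big_split; apply: eq_bigr => j _ /=.
by rewrite linearP mulrDl scalerDl scalerA mulrA.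
Qed.

Lemma ap2_linear_r f x : linear (ap2 f x).
Proof.
move=> k y y'; rewrite !ap2E scaler_sumr -big_split; apply: eq_bigr => i _ /=.
rewrite scaler_sumr -big_split; apply: eq_bigr => j _ /=.
by rewrite linearP mulrDr scalerDl scalerA mulrCA.
Qed.
HB.instance Definition _ f x := GRing.isLinear.Build K A A _ (ap2 f x) (ap2_linear_r f x).

Lemma ap2Dl f x x' y : ap2 f (x + x') y = ap2 f x y + ap2 f x' y.
Proof. by have := ap2_linear_l f y 1 x x'; rewrite /= !scale1r. Qed.

Lemma ap2_0l f y : ap2 f 0 y = 0.
Proof. by have := ap2_linear_l f y (-1) 0 0; rewrite /= !scaleN1r oppr0 addr0 addNr. Qed.

Lemma ap2Zl f k x y : ap2 f (k *: x) y = k *: ap2 f x y.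
Proof. by have := ap2_linear_l f y k x 0; rewrite /= ap2_0l !addr0. Qed.

Lemma ap2Bl f x x' y : ap2 f (x - x') y = ap2 f x y - ap2 f x' y.
Proof. by rewrite ap2Dl -scaleN1r ap2Zl scaleN1r. Qed.

Lemma ap2_suml f I (r : seq I) P (F : I -> A) y :
  ap2 f (\sum_(i <- r | P i) F i) y = \sum_(i <- r | P i) ap2 f (F i) y.
Proof. by apply: (big_morph (fun x => ap2 f x y)); [move=> ? ?; exact: ap2Dl|exact: ap2_0l]. Qed.

Lemma ap1_c k (f g : cochain 1) x : ap1 (k *: f + g) x = k *: ap1 f x + ap1 g x.
Proof.
rewrite !ap1E scaler_sumr -big_split; apply: eq_bigr => i _.
by rewrite !ffunE scalerDr !scalerA mulrC.
Qed.

Lemma ap2_c k (f g : cochain 2) x y : ap2 (k *: f + g) x y = k *: ap2 f x y + ap2 g x y.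
Proof.
rewrite !ap2E scaler_sumr -big_split; apply: eq_bigr => i _ /=.
rewrite scaler_sumr -big_split; apply: eq_bigr => j _ /=.
by rewrite !ffunE scalerDr !scalerA [k * _]mulrC.
Qed.

Lemma ap2_c0 x y : ap2 0 x y = 0.
Proof. by rewrite ap2E big1 // => i _; rewrite big1 // => j _; rewrite ffunE scaler0. Qed.

Lemma ap2P f g : (forall x y, ap2 f x y = ap2 g x y) -> f = g.
Proof. by move=> H; apply: cochain2P => i j; rewrite -!ap2_e. Qed.

Definition mk1 (f : A -> A) : cochain 1 := [ffun t : 1.-tuple 'I_n => f (e_ (tnth t ord0))].
Definition mk2 (f : A -> A -> A) : cochain 2 :=
  [ffun t : 2.-tuple 'I_n => f (e_ (tnth t ord0)) (e_ (tnth t ord_max))].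

Lemma mk1E (f : A -> A) : linear f -> ap1 (mk1 f) =1 f.
Proof.
move=> lf x; pose F := HB.pack_for {linear A -> A} f (GRing.isLinear.Build _ _ _ _ _ lf).
rewrite [in RHS](coord_sum x) -[f]/(F : A -> A) linear_sum ap1E.
by apply: eq_bigr => i _; rewrite linearZ ffunE.
Qed.

Lemma mk2E (f : A -> A -> A) : (forall y, linear (f^~ y)) -> (forall x, linear (f x)) ->
  forall x y, ap2 (mk2 f) x y = f x y.
Proof.
move=> lf rf x y; rewrite ap2E.
pose F z := HB.pack_for {linear A -> A} (f^~ z) (GRing.isLinear.Build _ _ _ _ _ (lf z)).
pose G z := HB.pack_for {linear A -> A} (f z) (GRing.isLinear.Build _ _ _ _ _ (rf z)).
rewrite [in RHS](coord_sum x) -[RHS]/(F y _) linear_sum.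
apply: eq_bigr => i _; rewrite linearZ /=.
rewrite [in RHS](coord_sum y) -[f (e_ i) _]/(G (e_ i) _) linear_sum scaler_sumr.
by apply: eq_bigr => j _; rewrite linearZ scalerA ffunE.
Qed.

Lemma skew2P f : skew f <-> forall x y, ap2 f x y = - ap2 f y x.
Proof.
have step s i j : permute s f [tuple i; j] = f [tuple tnth [tuple i; j] (s k) | k < 2].
  by rewrite ffunE.
have E1 i j : [tuple tnth [tuple i; j] ((1%g : 'S_2) k) | k < 2] = [tuple i; j].
  by apply: eq_from_tnth => k; rewrite tnth_mktuple perm1.
have E2 i j : [tuple tnth [tuple i; j] ((tperm ord0 ord_max : 'S_2) k) | k < 2] = [tuple j; i].
  apply: eq_from_tnth => k; rewrite tnth_mktuple.
  by have [->|->] := ord2P k; rewrite ?tpermL ?tpermR.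
split=> [H x y|H s].
  have Hij i j : f [tuple j; i] = - f [tuple i; j].
    have := H (tperm ord0 ord_max); move=> /ffunP/(_ [tuple i; j]); rewrite step E2 => ->.
    by rewrite ffunE /sgn_perm odd_tperm expr1 scaleN1r.
  rewrite !ap2E exchange_big -sumrN; apply: eq_bigr => i _.
  rewrite -sumrN; apply: eq_bigr => j _.
  by rewrite Hij scalerN mulrC.
apply: cochain2P => i j; rewrite step ffunE /sgn_perm; have [->|->] := perm2_eq s.
  by rewrite E1 odd_perm1 scale1r.
by rewrite E2 odd_tperm expr1 scaleN1r -!ap2_e.
Qed.

Lemma skew1 (f : cochain 1) : skew f.
Proof.
move=> s; rewrite (perm1_eq s) /sgn_perm odd_perm1 scale1r.
apply: cochain1P => i; rewrite ffunE; congr (f _).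
by apply: eq_from_tnth => k; rewrite tnth_mktuple perm1.
Qed.

Lemma L0P f : L A 0 f <-> forall a b, ap1 f (a * b) = a * ap1 f b + ap1 f a * b.
Proof.
split=> [[_ H] a b|H].
  by have := H [::] 0%N a b isT; rewrite !capply1.
split; first exact: skew1.
by move=> x i a b; case: i => // _; rewrite !capply1 !nth_set_nth /= H.
Qed.

Lemma L1P f : L A 1 f <-> (forall x y, ap2 f x y = - ap2 f y x) /\
  forall x a b, ap2 f x (a * b) = a * ap2 f x b + ap2 f x a * b.
Proof.
split=> [[/skew2P sk H]|[sk H]].
  split=> // x a b; have := H [:: x] 1%N a b isT.
  by rewrite !capply2 !nth_set_nth.
split; first exact/skew2P.
move=> x i a b; case: i => [|[|//]] _; rewrite !capply2 !nth_set_nth //=.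
by rewrite sk H opprD (sk _ a) (sk _ b) mulrN mulNr !opprK.
Qed.

Lemma ap2_leibniz_l f x a b : L A 1 f ->
  ap2 f (a * b) x = a * ap2 f b x + ap2 f a x * b.
Proof. by move=> /L1P[sk H]; rewrite sk H opprD (sk b) (sk a) mulrN mulNr. Qed.

(** Minus the Lie derivative of [X] along [l]; it is the unprojected Gerstenhaber bracket of [X] and
    [l]. *)
Definition act (X : cochain 2) (l : cochain 1) : cochain 2 :=
  mk2 (fun x y => ap2 X (ap1 l x) y + ap2 X x (ap1 l y) - ap1 l (ap2 X x y)).

Lemma lin3 (V : lmodType K) k (p1 p2 q1 q2 r1 r2 : V) :
  k *: p1 + p2 + (k *: q1 + q2) - (k *: r1 + r2) = k *: (p1 + q1 - r1) + (p2 + q2 - r2).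
Proof.
by rewrite scalerBr scalerDr opprD !addrA (ACl (1*3*5*2*4*6)%AC).
Qed.

Lemma actE X l x y :
  ap2 (act X l) x y = ap2 X (ap1 l x) y + ap2 X x (ap1 l y) - ap1 l (ap2 X x y).
Proof.
apply: mk2E => [z k u v|z k u v].
  by rewrite (linearP (ap1 l)) !ap2_linear_l /= (linearP (ap1 l)) lin3.
by rewrite (linearP (ap1 l)) !(linearP (ap2 X _)) (linearP (ap1 l)) lin3.
Qed.

Lemma act_Pl k (X Y : cochain 2) (l : cochain 1) : act (k *: X + Y) l = k *: act X l + act Y l.
Proof.
by apply: ap2P => x y; rewrite actE !ap2_c !actE (linearP (ap1 l)) lin3.
Qed.

Lemma act_Pr k X (l l' : cochain 1) : act X (k *: l + l') = k *: act X l + act X l'.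
Proof.
apply: ap2P => x y; rewrite ap2_c !actE !ap1_c (linearP (ap2 X x)).
by rewrite ap2_linear_l /= lin3.
Qed.

Lemma act_skew X l : skew X -> skew (act X l).
Proof.
move=> /skew2P H; apply/skew2P => x y; rewrite !actE (H (ap1 l x)) (H x (ap1 l y)) (H x y).
by rewrite linearN !opprD !opprK addrC [- _ - _]addrC addrC.
Qed.

Lemma act_L X l : L A 1 X -> L A 0 l -> L A 1 (act X l).
Proof.
move=> HX /L0P Hl; have [sk HX2] := (L1P X).1 HX.
apply/L1P; split; first by apply/skew2P/act_skew/skew2P.
move=> x a b; rewrite !actE.
rewrite HX2 Hl linearD /= !HX2 linearD /= !Hl !mulrBr !mulrBl !mulrDr !mulrDl.
set p1 := a * ap2 X (ap1 l x) b; set p2 := ap2 X (ap1 l x) a * b.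
set p3 := a * ap2 X x (ap1 l b); set p4 := ap2 X x a * ap1 l b.
set p5 := ap1 l a * ap2 X x b; set p6 := ap2 X x (ap1 l a) * b.
set p7 := a * ap1 l (ap2 X x b); set p8 := ap1 l (ap2 X x a) * b.
rewrite !opprD !addrA.
have E (V : zmodType) (q1 q2 q3 q4 q5 q6 q7 q8 : V) :
  q1 + q2 + q3 + q4 + q5 + q6 - q7 - q5 - q4 - q8 = q1 + q3 - q7 + q2 + q6 - q8.
  by rewrite (ACl (1*3*7*2*6*10*(4*9)*(5*8))%AC) /= !subrr !addr0.
exact: E.
Qed.

Lemma antisym_skew p (f : {ffun p.-tuple 'I_n -> A}) : skew f -> antisym f = f.
Proof.
move=> H; rewrite /antisym (eq_bigr (fun=> f)) => [|s _]; last first.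
  by rewrite H scalerA /sgn_perm -signr_addb addbb scale1r.
rewrite sumr_const card_Sn -scaler_nat scalerA mulVf ?scale1r //.
by rewrite -(prednK (fact_gt0 p)) char0.
Qed.

Lemma gerst_act (X : cochain 2) (l : cochain 1) :
  gerstenhaber (X : cochain 1.+1) (l : cochain 0.+1) = act X l.
Proof.
apply: cochain2P => i j; rewrite -[in RHS]ap2_e actE ffunE /circ.
rewrite big_ord_recl !big_ord1 /= !muln0 ?mul0n !expr0 !mul1r.
have h := capply1 l [:: e_ i; e_ j]. rewrite /= in h. rewrite [capply l [:: e_ i; e_ j]]h. by [].

Qed.

(** The projection [antisym] fixes skew cochains, so on them the gauge vector field is the linear
    one given by [act]. *)
Lemma dX_act (X : cochain 2) (l : cochain 1) : skew X -> dX X (l : cochain 0.+1) = act X l.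
Proof. by move=> sk; rewrite /dX /bracketG1 gerst_act antisym_skew //; apply: act_skew. Qed.

Definition der_bracket (l l' : cochain 1) : cochain 1 :=
  mk1 (fun x => ap1 l (ap1 l' x) - ap1 l' (ap1 l x)).

Lemma der_bracketE l l' x : ap1 (der_bracket l l') x = ap1 l (ap1 l' x) - ap1 l' (ap1 l x).
Proof.
apply: mk1E => k u v; rewrite !(linearP (ap1 _)).
by rewrite scalerBr opprD addrACA.
Qed.

Lemma ap2_B (f g : cochain 2) x y : ap2 (f - g) x y = ap2 f x y - ap2 g x y.
Proof. by rewrite addrC -scaleN1r ap2_c scaleN1r addrC. Qed.

Lemma act_br_terms (V : zmodType) (p1 p2 p3 p4 p5 p6 p7 p8 p9 q1 q2 q3 : V) :
  (p1 + p6 - p7 + (p5 + p3 - p9) - (p8 + q1 - q3)) -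
  (p2 + p5 - p8 + (p6 + p4 - q1) - (p7 + p9 - q2)) = p1 - p2 + (p3 - p4) - (q2 - q3).
Proof.
rewrite !opprD !opprK !addrA.
rewrite (ACl (1*10*5*14*18*9*(2*13)*(16*3)*(4*11)*(17*6)*(12*7)*(15*8))%AC) /=.
by rewrite !subrr !addr0.
Qed.

(** The gauge action is a right action of the Lie algebra of derivations. *)
Lemma act_bracket X l l' : act (act X l) l' - act (act X l') l = act X (der_bracket l l').
Proof.
apply: ap2P => x y; rewrite ap2_B !actE !der_bracketE ap2Bl (linearB (ap2 X x)).
rewrite !(linearB (ap1 _)) !(linearD (ap1 _)) /=; exact: act_br_terms.
Qed.

Lemma der_bracket_L_terms (V : zmodType) (p1 p2 p3 p4 q1 q2 : V) :
  p1 + p2 + (p3 + p4) - (q1 + p3 + (p2 + q2)) = p1 - q1 + (p4 - q2).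
Proof.
rewrite !opprD !addrA (ACl (1*5*4*8*(2*7)*(3*6))%AC) /=.
by rewrite !subrr !addr0.
Qed.

Lemma der_bracket_L l l' : L A 0 l -> L A 0 l' -> L A 0 (der_bracket l l').
Proof.
move=> /L0P H /L0P H'; apply/L0P => a b; rewrite !der_bracketE H H'.
rewrite !(linearD (ap1 _)) /= !H !H' mulrBr mulrBl; exact: der_bracket_L_terms.
Qed.

(** The Jacobiator with the outer bracket [X] and the inner bracket [Y] kept apart, hence linear in
    each. *)
Definition jac2 (X Y : cochain 2) (x y z : A) : A :=
  ap2 X (ap2 Y x y) z + ap2 X (ap2 Y y z) x + ap2 X (ap2 Y z x) y.
Definition jacobi X := forall x y z, jac2 X X x y z = 0.

End Cochains.

(** * Vanishing of the Gerstenhaber square as the Jacobi identity *)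

Section PoissonBracket.
Variables (K : fieldType) (A : falgType K).
Hypothesis mulAC : commutative (@GRing.mul A).
Hypothesis char0 : forall p, p.+1%:R != 0 :> K.
Local Notation n := (\dim {:A}).
Local Notation e := (vbasis {:A}).
Local Notation cochain := (@cochain K A).
Local Notation chain := (@chain K A).
Local Notation e_ i := (e`_(nat_of_ord (i : 'I_n))).

Lemma gerst_XX (X : cochain 2) (i j k : 'I_n) :
  gerstenhaber (X : cochain 1.+1) (X : cochain 1.+1) [tuple i; j; k] =
  (ap2 X (ap2 X (e_ i) (e_ j)) (e_ k) - ap2 X (e_ i) (ap2 X (e_ j) (e_ k))) *+ 2.
Proof.
rewrite ffunE /circ !big_ord_recl !big_ord0 /= !addr0.
rewrite (_ : (0 * 1)%N = 0%N) // (_ : (bump 0 0 * 1)%N = 1%N) //.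
rewrite !expr0 !expr1 !mul1r !mulN1r opprK.
have h1 := capply2 X [:: e_ i; e_ j; e_ k]; rewrite /= in h1.
rewrite [capply X [:: e_ i; e_ j; e_ k]]h1 mulr2n.
by [].
Qed.

Lemma ap2Nl (X : cochain 2) x y : ap2 X (- x) y = - ap2 X x y.
Proof. by rewrite -scaleN1r ap2Zl scaleN1r. Qed.

Lemma antisym_terms (V : zmodType) (p q r : V) :
  (p + q) *+ 2 + (- ((- p - r) *+ 2) + (- ((- r - q) *+ 2) + (- ((- q - p) *+ 2) +
  ((q + r) *+ 2 + (r + p) *+ 2)))) = (p + q + r) *+ 8.
Proof.
rewrite -!mulNrn -!mulrnDl -[8%N]/(4 * 2)%N mulrnA; congr (_ *+ _).
rewrite !opprD !opprK !addrA (ACl ((1*2*4)*(3*6*5)*(8*7*10)*(12*9*11))%AC) /=.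
by rewrite !mulrS mulr0n addr0 !addrA.
Qed.

(** Each of the six permutations gives an associator, doubled by [gerst_XX]: 24 iterated brackets,
    which skewness collects into 8 copies of the three cyclic ones. The factor 8/6 is invertible in
    characteristic zero. *)
Lemma antisym_gerst_XX (X : cochain 2) (i j k : 'I_n) : skew X ->
  bracketG1 (X : cochain 1.+1) (X : cochain 1.+1) [tuple i; j; k] =
  (3`!%:R)^-1 *: (jac2 X X (e_ i) (e_ j) (e_ k) *+ 8).
Proof.
move=> /skew2P sk; rewrite /bracketG1 /antisym !ffunE sum_ffunE sum_perm3.
congr (_ *: _); rewrite /perms3 !big_cons big_nil addr0.
have P (s : 'S_3) (f : {ffun 3.-tuple 'I_n -> A}) : permute s f [tuple i; j; k] =
    f [tuple tnth [tuple i; j; k] (s ord3_0); tnth [tuple i; j; k] (s ord3_1);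
      tnth [tuple i; j; k] (s ord3_2)].
  by rewrite ffunE; congr (f _); apply: eq_from_tnth => l; rewrite tnth_mktuple;
    case: (ord3P l) => ->.
rewrite ![(_ *: permute _ _) _]ffunE !P /sgn_perm.
rewrite !odd_permM !odd_tperm odd_perm1 /= !expr0 !expr1 !scale1r !scaleN1r.
rewrite !permE /= !permE /=.
rewrite -[tnth [tuple i; j; k] ord3_0]/i -[tnth [tuple i; j; k] ord3_1]/j
  -[tnth [tuple i; j; k] ord3_2]/k.
rewrite !gerst_XX (sk (e_ j) (e_ i)) (sk (e_ k) (e_ j)) (sk (e_ i) (e_ k)) !ap2Nl
  !(linearN (ap2 X _)) /=.
rewrite (sk (e_ i) (ap2 X _ _)) (sk (e_ j) (ap2 X _ _)) (sk (e_ k) (ap2 X _ _)) !opprK.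
exact: antisym_terms.
Qed.

Lemma jac2_cyc (X Y : cochain 2) x y z : jac2 X Y x y z = jac2 X Y y z x.
Proof. by rewrite /jac2 -addrA addrC. Qed.

Lemma jac2_linear (X Y : cochain 2) k x x' y z :
  jac2 X Y (k *: x + x') y z = k *: jac2 X Y x y z + jac2 X Y x' y z.
Proof.
rewrite /jac2 !ap2Dl !ap2Zl !(linearP (ap2 _ _)) !ap2Dl !ap2Zl !scalerDr.
by rewrite !addrA (ACl (1*3*5*2*4*6)%AC).
Qed.

Lemma jac2_0 (X Y : cochain 2) y z : (forall i, jac2 X Y (e_ i) y z = 0) ->
  forall x, jac2 X Y x y z = 0.
Proof.
move=> H x; rewrite (coord_sum x).
have J0 : jac2 X Y 0 y z = 0 by rewrite /jac2 !ap2_0l !linear0 !ap2_0l !addr0.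
elim/big_ind: _ => // [u v hu hv|i _].
  by rewrite -[u]scale1r jac2_linear hu hv scaler0 addr0.
by rewrite -[_ *: _]addr0 jac2_linear H J0 scaler0 addr0.
Qed.

Lemma poisson_structuresP (X : cochain 2) :
  poisson_structures A X <-> L A 1 X /\ jacobi X.
Proof.
split=> -[HX HJ]; split=> //; last first.
  apply/ffunP => t; have [i [j [k ->]]] := tuple3_eta t.
  rewrite (antisym_gerst_XX _ _ _ HX.1) HJ ffunE mul0rn scaler0.
  by [].
have H i j k : jac2 X X (e_ i) (e_ j) (e_ k) = 0.
  have := antisym_gerst_XX i j k HX.1; rewrite HJ ffunE => /esym/eqP.
  rewrite scaler_eq0 invr_eq0 -(prednK (fact_gt0 3)) (negbTE (char0 _)) /=.
  by rewrite -scaler_nat scaler_eq0 (negbTE (char0 _)) => /eqP.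
have [sk _] := (L1P X).1 HX.
have H1 j k x : jac2 X X x (e_ j) (e_ k) = 0 by apply: (jac2_0 (fun i => H i j k)).
have H2 k x y : jac2 X X x y (e_ k) = 0.
  by rewrite jac2_cyc; apply: jac2_0 => j; rewrite -jac2_cyc H1.
move=> x y z; rewrite -jac2_cyc; apply: jac2_0 => k.
by rewrite jac2_cyc H2.
Qed.

End PoissonBracket.

(** * The bivector on the orbits *)

Section Bivector.
Variables (K : fieldType) (A : falgType K).
Hypothesis mulAC : commutative (@GRing.mul A).
Hypothesis char0 : forall p, p.+1%:R != 0 :> K.
Local Notation n := (\dim {:A}).
Local Notation e := (vbasis {:A}).
Local Notation cochain := (@cochain K A).
Local Notation chain := (@chain K A).
Local Notation e_ i := (e`_(nat_of_ord (i : 'I_n))).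
Variable form : A -> A -> K.
Hypothesis hform : frobenius_form form.
Local Notation pairing := (pairing form).

Lemma formC x y : form x y = form y x.
Proof. by case: hform. Qed.

Lemma formP_l k x x' y : form (k *: x + x') y = k * form x y + form x' y.
Proof. by case: hform. Qed.

Lemma formA x y z : form (x * y) z = form x (y * z).
Proof. by case: hform. Qed.

Lemma form0l y : form 0 y = 0.
Proof. by have := formP_l (-1) 0 0 y; rewrite scaler0 addr0 mulN1r addNr. Qed.

Lemma formDl x x' y : form (x + x') y = form x y + form x' y.
Proof. by have := formP_l 1 x x' y; rewrite scale1r mul1r. Qed.

Lemma formZl k x y : form (k *: x) y = k * form x y.
Proof. by have := formP_l k x 0 y; rewrite addr0 form0l addr0. Qed.

Lemma formNl x y : form (- x) y = - form x y.
Proof. by rewrite -scaleN1r formZl mulN1r. Qed.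

Lemma form_suml I (r : seq I) P (F : I -> A) y :
  form (\sum_(i <- r | P i) F i) y = \sum_(i <- r | P i) form (F i) y.
Proof. by apply: (big_morph (form^~ y)) => [u v|]; [exact: formDl|exact: form0l]. Qed.

Lemma form_sumr I (r : seq I) P (F : I -> A) y :
  form y (\sum_(i <- r | P i) F i) = \sum_(i <- r | P i) form y (F i).
Proof. by rewrite formC form_suml; apply: eq_bigr => i _; rewrite formC. Qed.

Lemma formZr k x y : form x (k *: y) = k * form x y.
Proof. by rewrite formC formZl formC. Qed.

Lemma form_mul1 x y : form x y = form (x * y) 1.
Proof. by rewrite formA mulr1. Qed.

Lemma form_represent (phi : A -> K) :
  (forall k x y, phi (k *: x + y) = k * phi x + phi y) ->
  exists a, forall x, form x a = phi x.
Proof.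
move=> Hphi.
pose G : 'M[K]_n := \matrix_(i, j) form (e_ i) (e_ j).
have G1 : G \in unitmx.
  rewrite -row_free_unit -kermx_eq0; apply/eqP/row_matrixP => i; rewrite row0.
  set v := row i _; have vG : v *m G = 0.
    by apply/eqP; rewrite /v -sub_kermx row_sub.
  pose a := \sum_j v 0 j *: e_ j.
  have a0 : a = 0.
    case: hform => _ _ _; apply => b; rewrite (coord_sum b) form_sumr big1 // => j _.
    rewrite formZr form_suml; have := congr1 (fun w : 'rV[K]_n => w 0 j) vG.
    rewrite !mxE => h; rewrite (_ : \sum_(ord3_0 < n) _ = 0) ?mulr0 //.
    by rewrite -[RHS]h; apply: eq_bigr => l _; rewrite formZl [G _ _]mxE.
  apply/rowP => j; rewrite [RHS]mxE.
  by have := coord_sum_free (v 0) j (basis_free (vbasisP {:A})); rewrite -/a a0 linear0.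
pose c : 'cV[K]_n := invmx G *m \col_i phi (e_ i).
exists (\sum_j c j 0 *: e_ j) => x.
have Hc i : form (e_ i) (\sum_j c j 0 *: e_ j) = phi (e_ i).
  have h : (G *m c) i 0 = phi (e_ i) by rewrite mulKVmx // mxE.
  rewrite -h mxE form_sumr; apply: eq_bigr => j _.
  by rewrite formZr [G i j]mxE mulrC.
have phi0 : phi 0 = 0.
  by have := Hphi (-1) 0 0; rewrite scaler0 addr0 mulN1r addNr.
rewrite (coord_sum x) form_suml.
have -> : phi (\sum_(i < n) coord e i x *: e_ i) = \sum_(i < n) coord e i x * phi (e_ i).
  elim/big_rec2: _ => [//|i u v _ <-]; by rewrite Hphi.
by apply: eq_bigr => i _; rewrite formZl Hc.
Qed.

Lemma pairing_P p k (f g : cochain p) c :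
  pairing p (k *: f + g) c = k * pairing p f c + pairing p g c.
Proof.
rewrite /Defs.pairing mulr_sumr -big_split; apply: eq_bigr => t _.
by rewrite !ffunE formP_l.
Qed.

(** Non-degeneracy of the pairing on all cochains, tested coefficient by coefficient through the
    Frobenius form. *)
Lemma pairing_represent p (phi : cochain p -> K) :
  (forall k f g, phi (k *: f + g) = k * phi f + phi g) ->
  exists c, forall f, pairing p f c = phi f.
Proof.
move=> Hphi.
pose dl (t : p.-tuple 'I_n) (x : A) : cochain p := [ffun t' => if t' == t then x else 0].
have dlP t k x y : dl t (k *: x + y) = k *: dl t x + dl t y.
  by apply/ffunP => t'; rewrite !ffunE; case: eqP => // _; rewrite scaler0 addr0.
have /choice[F HF] : forall t, exists a, forall x, form x a = phi (dl t x).
  by move=> t; apply: form_represent => k x y; rewrite dlP Hphi.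
exists [ffun t => F t] => f.
have phi0 : phi 0 = 0.
  by have := Hphi (-1) 0 0; rewrite scaler0 addr0 mulN1r addNr.
have -> : f = \sum_t dl t (f t).
  apply/ffunP => t; rewrite sum_ffunE (bigD1 t) //= ffunE eqxx big1 ?addr0 // => t' tt'.
  by rewrite ffunE eq_sym (negbTE tt').
have -> : phi (\sum_t dl t (f t)) = \sum_t phi (dl t (f t)).
  apply: (big_morph phi) => // u v.
  by have := Hphi 1 u v; rewrite scale1r mul1r.
apply: eq_bigr => t _; rewrite ffunE HF; congr (phi (dl t _)).
by rewrite sum_ffunE (bigD1 t) //= ffunE eqxx big1 ?addr0 // => t' tt';
  rewrite ffunE eq_sym (negbTE tt').
Qed.

Lemma pairing1E f c : pairing 1 f c = \sum_i form (ap1 f (e_ i)) (c [tuple i]).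
Proof. by rewrite /Defs.pairing sum_tuple1; apply: eq_bigr => i _; rewrite ap1_e. Qed.

(** The pairing of [X] with the unshuffled product of [c] and [d], as [pairing_concat] shows. *)
Definition contraction (X : cochain 2) (c d : chain 1) : K :=
  \sum_i \sum_j form (ap2 X (e_ i) (e_ j)) (c [tuple i] * d [tuple j]).
Local Notation BX := contraction.

(** The contraction of [X] with [d] in its second argument. Being a derivation when [X] lies in
    [L A 1], it makes the contraction with a further chain [c] depend only on the pairings of [c]
    with derivations. *)
Definition ham_der (X : cochain 2) (d : chain 1) : cochain 1 :=
  mk1 (fun x => \sum_j d [tuple j] * ap2 X x (e_ j)).

Lemma ham_derE X d x : ap1 (ham_der X d) x = \sum_j d [tuple j] * ap2 X x (e_ j).
Proof.
apply: mk1E => k u v; rewrite scaler_sumr -big_split; apply: eq_bigr => j _ /=.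
by rewrite ap2_linear_l mulrDr scalerAr.
Qed.

Lemma ham_der_L X d : L A 1 X -> L A 0 (ham_der X d).
Proof.
move=> HX; apply/L0P => a b; rewrite !ham_derE mulr_sumr mulr_suml -big_split.
apply: eq_bigr => j _ /=; rewrite ap2_leibniz_l // mulrDr !mulrA; congr (_ + _).
by rewrite (mulAC _ a).
Qed.

Lemma BX_ham_der X c d : BX X c d = pairing 1 (ham_der X d) c.
Proof.
rewrite pairing1E; apply: eq_bigr => i _; rewrite ham_derE form_suml.
apply: eq_bigr => j _; rewrite (mulAC (d _)) formA; congr (form _ _).
exact: mulAC.
Qed.

Lemma BX_skew X c d : L A 1 X -> BX X c d = - BX X d c.
Proof.
move=> /L1P[sk _]; rewrite /BX exchange_big -sumrN; apply: eq_bigr => i _.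
rewrite -sumrN; apply: eq_bigr => j _.
by rewrite sk formNl mulAC.
Qed.

Lemma BX_P X k c c' d : BX X (k *: c + c') d = k * BX X c d + BX X c' d.
Proof.
rewrite /BX mulr_sumr -big_split; apply: eq_bigr => i _ /=.
rewrite mulr_sumr -big_split; apply: eq_bigr => j _ /=.
by rewrite !ffunE mulrDl -scalerAl !(formC (ap2 _ _ _)) formP_l.
Qed.

Lemma BX_X k X Y c d : BX (k *: X + Y) c d = k * BX X c d + BX Y c d.
Proof.
rewrite /BX mulr_sumr -big_split; apply: eq_bigr => i _ /=.
rewrite mulr_sumr -big_split; apply: eq_bigr => j _ /=.
by rewrite ap2_c formP_l.
Qed.

(** The boundary [a x - x a] vanishes by commutativity, the shuffle operator is an empty sum and the
    eigenvalue [2 ^ 1 - 2] is 0. Hence any chain with the right pairings qualifies as a value of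
    [deltaX]. *)
Lemma HHhom0 (c : chain 1) : HHhom A 0 c.
Proof.
have t0 (a : A) x : tensor 0 a x = [ffun=> a].
  by apply/ffunP => t; rewrite !ffunE /monomial big_ord0 scale1r.
split.
  rewrite /boundary big1 // => t _.
  by rewrite big_ord0 addr0 !t0 expr1 scaleN1r mulAC subrr.
exists 0; rewrite /shuffle_operator big_geq // expr1 subrr scale0r subr0.
apply/esym; rewrite /boundary big1 // => t _.
have z a x : a = 0 -> @tensor K A 1 a x = 0.
  by move=> ->; apply/ffunP => t'; rewrite !ffunE scaler0.
rewrite !z ?scaler0 ?ffunE ?mul0r ?mulr0 // addr0 add0r big1 // => i _.
by rewrite z ?scaler0.
Qed.

(** The functional to be represented extends from derivations to all 1-cochains by the formula of
    [act], so [pairing_represent] applies. *)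
Lemma deltaX_exists X (c : chain 2) : L A 1 X -> exists c' : chain 1,
  forall Y, L A 0 Y -> pairing 2 (act X Y) c = pairing 1 Y c'.
Proof.
move=> HX.
have [|c' Hc'] := @pairing_represent 1 (fun Y => pairing 2 (act X Y) c).
  by move=> k f g /=; rewrite act_Pr pairing_P.
by exists c' => Y _; rewrite Hc'.
Qed.

Lemma deltaXP X (c : chain 2) : L A 1 X -> forall Y, L A 0 Y ->
  pairing 2 (act X Y) c = pairing 1 Y (deltaX form X (c : chain 0.+2)).
Proof.
move=> HX Y HY; have [sk _] := HX; have [c' Hc'] := deltaX_exists c HX.
have [_ H] := @xgetPex _ 0 [set c' : chain 0.+1 | HHhom A 0 c' /\
    forall Y : cochain 0.+1, L A 0 Y ->
      pairing 2 (dX X Y) c = pairing 1 Y c'] (ex_intro _ c'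
        (conj (HHhom0 c') (fun Y HY => etrans (congr1 (fun f => pairing 2 f c)
          (dX_act char0 Y sk)) (Hc' Y HY)))).
rewrite -(H Y HY); congr (pairing 2 _ c); exact/esym/dX_act.
Qed.

Lemma pairing_permute p (s : 'S_p) (f c : {ffun p.-tuple 'I_n -> A}) :
  pairing p (permute s f) (permute s c) = pairing p f c.
Proof.
rewrite /Defs.pairing [RHS](reindex (fun t : p.-tuple 'I_n => [tuple tnth t (s i) | i < p])).
  by apply: eq_bigr => t _; rewrite !ffunE.
exists (fun t : p.-tuple 'I_n => [tuple tnth t (s^-1%g i) | i < p]) => t _;
  by apply: eq_from_tnth => i; rewrite !tnth_mktuple ?permKV ?permK.
Qed.

Lemma pairing_tensor p f (a : A) x : pairing p f (tensor p a x) = form (capply f x) a.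
Proof.
rewrite /capply form_suml; apply: eq_bigr => t _.
by rewrite ffunE formZr formZl.
Qed.

Lemma pairing_Zr p k f c : pairing p f (k *: c) = k * pairing p f c.
Proof. by rewrite /Defs.pairing mulr_sumr; apply: eq_bigr => t _; rewrite ffunE formZr. Qed.

Lemma pairing_Zl p k f c : pairing p (k *: f) c = k * pairing p f c.
Proof. by rewrite /Defs.pairing mulr_sumr; apply: eq_bigr => t _; rewrite ffunE formZl. Qed.

Lemma pairing_sumr p I (r : seq I) P f (F : I -> chain p) :
  pairing p f (\sum_(i <- r | P i) F i) = \sum_(i <- r | P i) pairing p f (F i).
Proof.
rewrite /Defs.pairing exchange_big; apply: eq_bigr => t _.
by rewrite sum_ffunE form_sumr.
Qed.

Lemma pairing_concat (X : cochain 2) (c d : chain 1) :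
  pairing 2 X (concat_chain c d) = BX X c d.
Proof.
rewrite /concat_chain pairing_sumr sum_tuple1; apply: eq_bigr => i _.
rewrite pairing_sumr sum_tuple1; apply: eq_bigr => j _.
by rewrite pairing_tensor.
Qed.

(** Both permutations of two letters are shuffles and the skewness of [X] cancels their signs,
    whence the factor 2. *)
Lemma PiXE kappa X (a b : chain 2) : L A 1 X ->
  PiX form kappa X a b = (kappa 1%N 1%N * 2) *
    BX X (deltaX form X (a : chain 0.+2)) (deltaX form X (b : chain 0.+2)).
Proof.
move=> [sk _]; rewrite /PiX /wedge; set c := deltaX _ _ _; set d := deltaX _ _ _.
rewrite pairing_Zr -mulrA; congr (_ * _).
rewrite -pairing_concat; set z := concat_chain c d.
rewrite /shuffle pairing_sumr.
have sh (s : 'S_2) : is_shuffle 1 s.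
  apply/forallP => -[[|[|//]] hi]; apply/forallP => -[[|[|//]] hj] //=.
rewrite (eq_bigl predT) => [|s]; last exact: sh.
rewrite (eq_bigr (fun=> pairing 2 X z)) => [|s _].
  by rewrite sumr_const card_Sn mulr_natl.
by rewrite -[RHS](pairing_permute s) pairing_Zr (sk s) pairing_Zl.
Qed.

Lemma ham_der_comp X c d x : ap1 (ham_der X c) (ap1 (ham_der X d) x) =
  \sum_j \sum_k c [tuple k] * ap2 X (d [tuple j] * ap2 X x (e_ j)) (e_ k).
Proof.
rewrite (ham_derE X d) linear_sum; apply: eq_bigr => j _; exact: ham_derE.
Qed.

Lemma pairing_der_bracket X al be ga : pairing 1 (der_bracket (ham_der X ga) (ham_der X be)) al =
  \sum_i \sum_j \sum_k form
    (ga [tuple k] * ap2 X (be [tuple j] * ap2 X (e_ i) (e_ j)) (e_ k)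
     - be [tuple j] * ap2 X (ga [tuple k] * ap2 X (e_ i) (e_ k)) (e_ j)) (al [tuple i]).
Proof.
rewrite pairing1E; apply: eq_bigr => i _; rewrite der_bracketE !ham_der_comp.
rewrite [X in _ - X]exchange_big -sumrB form_suml; apply: eq_bigr => j _.
by rewrite -sumrB form_suml.
Qed.

Lemma BX_act X al be ga : BX (act X (ham_der X ga)) al be =
  \sum_i \sum_j \sum_k form
    (ap2 X (ga [tuple k] * ap2 X (e_ i) (e_ k)) (e_ j)
     + ap2 X (e_ i) (ga [tuple k] * ap2 X (e_ j) (e_ k))
     - ga [tuple k] * ap2 X (ap2 X (e_ i) (e_ j)) (e_ k)) (al [tuple i] * be [tuple j]).
Proof.
apply: eq_bigr => i _; apply: eq_bigr => j _; rewrite actE !ham_derE.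
by rewrite ap2_suml linear_sum -big_split -sumrB form_suml.
Qed.

(** The letters stand for brackets such as [az] for {a, z} and [xyz] for {{x, y}, z}. Once Leibniz,
    skewness and Jacobi are used up, only commutative arithmetic remains. *)
Lemma jacobi_ring (S : comNzRingType) (a b c xy xz yz xyz yzx az ay bz bx cy cx : S) :
  (c * (b * xyz + bz * xy) - b * (c * (xyz + yzx) + cy * xz)) * a
  + (a * (c * yzx + cx * yz) - c * (a * (- xyz) + az * (- xy))) * b
  + (b * (a * (- (xyz + yzx)) + ay * (- xz)) - a * (b * (- yzx) + bx * (- yz))) * c
  + ((c * (xyz + yzx) + cy * xz) + (c * (- yzx) + (- cx) * yz) - c * xyz) * (a * b)
  + ((a * (- xyz) + az * (- xy)) + (a * (xyz + yzx) + (- ay) * (- xz)) - a * yzx) * (b * c)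
  + ((b * (- yzx) + bx * (- yz)) + (b * (- xyz) + (- bz) * xy) - b * (- (xyz + yzx))) * (c * a)
  = 0.
Proof. by ring. Qed.

Lemma jacobi_terms X a b c x y z : L A 1 X -> jacobi X ->
  (c * ap2 X (b * ap2 X x y) z - b * ap2 X (c * ap2 X x z) y) * a
  + (a * ap2 X (c * ap2 X y z) x - c * ap2 X (a * ap2 X y x) z) * b
  + (b * ap2 X (a * ap2 X z x) y - a * ap2 X (b * ap2 X z y) x) * c
  + (ap2 X (c * ap2 X x z) y + ap2 X x (c * ap2 X y z) - c * ap2 X (ap2 X x y) z) * (a * b)
  + (ap2 X (a * ap2 X y x) z + ap2 X y (a * ap2 X z x) - a * ap2 X (ap2 X y z) x) * (b * c)
  + (ap2 X (b * ap2 X z y) x + ap2 X z (b * ap2 X x y) - b * ap2 X (ap2 X z x) y) * (c * a)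
  = 0.
Proof.
move=> HX J; have [sk lr] := (L1P X).1 HX.
have ll u v w : ap2 X (u * v) w = u * ap2 X v w + ap2 X u w * v by apply: ap2_leibniz_l.
pose S := HB.pack_for comNzRingType A (GRing.PzRing_hasCommutativeMul.Build A mulAC).
(* Jacobi eliminates one iterated bracket and leaves the other two as independent letters. *)
have zxy : ap2 X (ap2 X x z) y = ap2 X (ap2 X x y) z + ap2 X (ap2 X y z) x.
  have := J x y z; rewrite /jac2 (sk z x) ap2Nl => /eqP; rewrite subr_eq0 => /eqP ->.
  by [].
rewrite !ll !lr (sk y x) (sk z x) (sk z y) !ap2Nl !(linearN (ap2 X _)) /=.
rewrite (sk x (ap2 X y z)) (sk y (ap2 X x z)) (sk z (ap2 X x y)) zxy.
rewrite (sk x c) (sk y a) (sk z b) !opprK.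
exact: (@jacobi_ring S a b c (ap2 X x y) (ap2 X x z) (ap2 X y z)
  (ap2 X (ap2 X x y) z) (ap2 X (ap2 X y z) x)
  (ap2 X a z) (ap2 X a y) (ap2 X b z) (ap2 X b x) (ap2 X c y) (ap2 X c x)).
Qed.

Lemma sum3_cyc (V : nmodType) (F : 'I_n -> 'I_n -> 'I_n -> V) :
  \sum_j \sum_k \sum_i F i j k = \sum_i \sum_j \sum_k F i j k.
Proof.
rewrite [RHS]exchange_big; apply: eq_bigr => j _; exact: exchange_big.
Qed.

(* The Hamiltonian direction of [ga] at [X] is [act X (ham_der X ga)]; the sum is the
   Schouten square of the bivector [BX X (delta_X a) (delta_X b)]. *)
Lemma bivector_jacobi X (a b c : cochain 2 -> K) (al be ga : chain 1) :
  L A 1 X -> jacobi X ->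
  (forall k f g, a (k *: f + g) = k * a f + a g) ->
  (forall k f g, b (k *: f + g) = k * b f + b g) ->
  (forall k f g, c (k *: f + g) = k * c f + c g) ->
  (forall l, L A 0 l -> a (act X l) = pairing 1 l al) ->
  (forall l, L A 0 l -> b (act X l) = pairing 1 l be) ->
  (forall l, L A 0 l -> c (act X l) = pairing 1 l ga) ->
  let H d := act X (ham_der X d) in
  (a (act (H ga) (ham_der X be)) - b (act (H ga) (ham_der X al)) + BX (H ga) al be)
  + (b (act (H al) (ham_der X ga)) - c (act (H al) (ham_der X be)) + BX (H al) be ga)
  + (c (act (H be) (ham_der X al)) - a (act (H be) (ham_der X ga)) + BX (H be) ga al) = 0.
Proof.
move=> HX HJ la lb lc Ha Hb Hc H.
have D_L d := ham_der_L d HX.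
have lin (f : cochain 2 -> K) : (forall k g h, f (k *: g + h) = k * f g + f h) ->
    forall g h, f g - f h = f (g - h).
  by move=> lf g h; rewrite [g - h]addrC -scaleN1r lf mulN1r addrC.
(* The two second-order terms in [a] combine into a commutator of gauge actions, which is the action
   of one derivation; on it [a] is computed by the chain [al]. The same holds for [b] and [c]. *)
have ea : a (act (H ga) (ham_der X be)) - a (act (H be) (ham_der X ga)) =
    pairing 1 (der_bracket (ham_der X ga) (ham_der X be)) al.
  by rewrite lin // act_bracket Ha //; apply: der_bracket_L.
have eb : b (act (H al) (ham_der X ga)) - b (act (H ga) (ham_der X al)) =
    pairing 1 (der_bracket (ham_der X al) (ham_der X ga)) be.
  by rewrite lin // act_bracket Hb //; apply: der_bracket_L.
have ec : c (act (H be) (ham_der X al)) - c (act (H al) (ham_der X be)) =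
    pairing 1 (der_bracket (ham_der X be) (ham_der X al)) ga.
  by rewrite lin // act_bracket Hc //; apply: der_bracket_L.
transitivity (pairing 1 (der_bracket (ham_der X ga) (ham_der X be)) al + pairing 1
  (der_bracket (ham_der X al) (ham_der X ga)) be
  + pairing 1 (der_bracket (ham_der X be) (ham_der X al)) ga + BX (H ga) al be + BX (H al) be ga
    + BX (H be) ga al).
  by rewrite -ea -eb -ec; ring.
have F1 := pairing_der_bracket X al be ga; have G1 := BX_act X al be ga.
have F2 := pairing_der_bracket X be ga al; rewrite sum3_cyc in F2.
have F3 := pairing_der_bracket X ga al be; rewrite sum3_cyc in F3; rewrite sum3_cyc in F3.
have G2 := BX_act X be ga al; rewrite sum3_cyc in G2.
have G3 := BX_act X ga al be; rewrite sum3_cyc in G3; rewrite sum3_cyc in G3.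
rewrite F1 F2 F3 G1 G2 G3 -!big_split big1 // => i _ /=.
rewrite -!big_split big1 // => j _ /=; rewrite -!big_split big1 // => k _ /=.
(* Invariance of the form turns the six terms into pairings with 1, so that their sum is taken
   inside [A]. *)
rewrite !(form_mul1 (_ - _)) -!formDl.
by rewrite jacobi_terms ?form0l.
Qed.

End Bivector.

(** * The gauge action in coordinates *)

Section Subspace.
Variable K : fieldType.

(** A subspace of maximal dimension contained in [P] is all of [P]: one more vector of [P] would
    enlarge it. *)
Lemma subspace_vspace (vT : vectType K) (P : vT -> Prop) : P 0 ->
  (forall k u v, P u -> P v -> P (k *: u + v)) ->
  exists V : {vspace vT}, forall v, P v <-> v \in V.
Proof.
move=> P0 PD.
pose Q k := `[< exists V : {vspace vT}, \dim V = k /\ forall v, v \in V -> P v >].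
have exQ : exists k, Q k.
  exists 0%N; apply/asboolP; exists 0%VS; rewrite dimv0; split=> // v.
  by rewrite memv0 => /eqP ->.
have ubQ k : Q k -> (k <= \dim {:vT})%N.
  by move=> /asboolP[V [<- _]]; rewrite dimvS ?subvf.
case: (ex_maxnP exQ ubQ) => k /asboolP[V [dV HV]] kmax.
exists V => v; split=> [Pv|/HV//]; apply: contraT => vV.
have : Q (\dim (V + <[v]>)).
  apply/asboolP; exists (V + <[v]>)%VS; split=> // w /memv_addP[u uV [u' /vlineP[c ->] ->]].
  by rewrite addrC; apply: PD => //; apply: HV.
move=> /kmax; rewrite -dV leqNgt => /negP; case.
have [le_dim eq_dim] := dimv_leqif_sup (addvSl V <[v]>).
by rewrite ltn_neqAle le_dim eq_dim andbT subv_add negb_and subvv -memvE.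
Qed.

End Subspace.

Section Stable.
Variables (R : realType) (K : numFieldType) (nd : norm_data R K).

(** [P] is the kernel of the identity minus a projector, which is the form of [mexp_stable]. *)
Lemma mexp_stableP d (A : 'M[K]_d) (P : 'rV[K]_d -> Prop) y : P 0 ->
  (forall k u v, P u -> P v -> P (k *: u + v)) ->
  (forall v, P v -> P (v *m A)) -> P y -> P (y *m mexp nd A).
Proof.
move=> P0 PD PA Py; have [V HV] := subspace_vspace P0 PD.
have lin : linear (fun v : 'rV[K]_d => v - projv V v).
  by move=> k u v; rewrite linearP scalerBr opprD addrACA.
pose F := HB.pack_for {linear 'rV[K]_d -> 'rV[K]_d} (fun v : 'rV[K]_d => v - projv V v)
  (GRing.isLinear.Build _ _ _ _ _ lin).
have FP v : v *m lin1_mx F = 0 <-> P v.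
  rewrite mul_rV_lin1 /= HV; split=> [/eqP|vV]; last by rewrite projv_id ?subrr.
  by rewrite subr_eq0 => /eqP ->; apply: memv_proj.
by apply/FP; apply: mexp_stable; [move=> v /FP/PA/FP|apply/FP].
Qed.

End Stable.

Section Gauge.
Variables (R : realType) (K : numFieldType) (nd : norm_data R K).
Variable A : falgType K.
Hypothesis mulAC : commutative (@GRing.mul A).
Local Notation cochain := (Defs.cochain A).
Local Notation W := (cochain 2 : vectType K).
Local Notation D := (\dim {:W}).
Local Notation coords := (@coords K W).
Local Notation of_coords := (@of_coords K W).
Local Notation hasd f t D := (hasd nd f t D).
Local Notation mexp := (mexp nd).

Let char0 p : p.+1%:R != 0 :> K.
Proof. by rewrite pnatr_eq0. Qed.

Lemma coordsK : cancel coords of_coords.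
Proof. by apply: passmx.rVofK; apply: vbasisP. Qed.

Lemma of_coordsK : cancel of_coords coords.
Proof. by apply: passmx.vecofK; apply: vbasisP. Qed.

Lemma coordsP k (w w' : W) : coords (k *: w + w') = k *: coords w + coords w'.
Proof. exact: passmx.rVof_linear. Qed.

Lemma of_coordsP k v v' : of_coords (k *: v + v') = k *: of_coords v + of_coords v'.
Proof. exact: passmx.vecof_linear. Qed.

Lemma of_coords0 : of_coords 0 = 0.
Proof. by have := of_coordsP (-1) 0 0; rewrite scaler0 addr0 scaleN1r addNr. Qed.

Lemma coords0 : coords 0 = 0.
Proof. by have := coordsP (-1) 0 0; rewrite scaler0 addr0 scaleN1r addNr. Qed.

Lemma coordsB (w w' : W) : coords (w - w') = coords w - coords w'.
Proof. by rewrite addrC -scaleN1r coordsP scaleN1r addrC. Qed.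

Lemma coords_sum I (r : seq I) (F : I -> K) (G : I -> W) :
  coords (\sum_(i <- r) F i *: G i) = \sum_(i <- r) F i *: coords (G i).
Proof.
by elim: r => [|i r IH]; rewrite ?big_nil ?coords0 // !big_cons coordsP IH.
Qed.

Lemma of_coords_sum I (r : seq I) (F : I -> K) (G : I -> 'rV[K]_D) :
  of_coords (\sum_(i <- r) F i *: G i) = \sum_(i <- r) F i *: of_coords (G i).
Proof.
by elim: r => [|i r IH]; rewrite ?big_nil ?of_coords0 // !big_cons of_coordsP IH.
Qed.

Lemma L_0 p : L A p 0.
Proof.
split.
  by move=> s; apply/ffunP => t; rewrite !ffunE scaler0.
have c0 y : capply (0 : cochain p.+1) y = 0.
  by rewrite /capply big1 // => t _; rewrite ffunE scaler0.
by move=> x i a b _; rewrite !c0 mulr0 mul0r addr0.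
Qed.

Lemma L_P p k (f g : cochain p.+1) : L A p f -> L A p g -> L A p (k *: f + g).
Proof.
move=> [sf mf] [sg mg]; split=> [s|x i a b ip].
  have := sf s; have := sg s => /ffunP hg /ffunP hf; apply/ffunP => t.
  have := hf t; have := hg t; rewrite !ffunE => -> ->.
  by rewrite scalerDr !scalerA mulrC.
have cP y : capply (k *: f + g) y = k *: capply f y + capply g y.
  rewrite /capply scaler_sumr -big_split; apply: eq_bigr => t _.
  by rewrite !ffunE scalerDr !scalerA mulrC.
rewrite !cP mf // mg // mulrDr mulrDl !scalerDr -!scalerAr -!scalerAl.
by rewrite addrACA.
Qed.

Definition actl_fun (l : cochain 1) (v : 'rV[K]_D) : 'rV[K]_D := coords (act (of_coords v) l).

Lemma actl_linear l : linear (actl_fun l).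
Proof. by move=> k u v; rewrite /actl_fun of_coordsP act_Pl coordsP. Qed.
HB.instance Definition _ l := GRing.isLinear.Build K _ _ _ (actl_fun l) (actl_linear l).

Definition act_mx l : 'M[K]_D := lin1_mx (actl_fun l).

Lemma act_mxE l v : v *m act_mx l = coords (act (of_coords v) l).
Proof. by rewrite mul_rV_lin1. Qed.

Lemma derivations_vspace : exists V : {vspace (cochain 1 : vectType K)}, forall l, L A 0 l <-> l
  \in V.
Proof.
apply: subspace_vspace; first exact: L_0.
by move=> k u v; apply: L_P.
Qed.

Definition der_space := projT1 (cid derivations_vspace).
Local Notation N := (\dim der_space).
Definition der_basis (r : 'I_N) : cochain 1 := (vbasis der_space)`_r.
Definition der_comb (c : 'rV[K]_N) : cochain 1 := \sum_r c 0 r *: der_basis r.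

Lemma der_spaceP l : L A 0 l <-> l \in der_space.
Proof. exact: (projT2 (cid derivations_vspace)). Qed.

Lemma der_comb_L c : L A 0 (der_comb c).
Proof.
apply/der_spaceP; apply: memv_suml => r _; apply: memvZ; apply: vbasis_mem.
by rewrite mem_nth // size_tuple.
Qed.

Lemma der_comb_coord l : L A 0 l -> l = der_comb (\row_r coord (vbasis der_space) r l).
Proof.
move=> /der_spaceP/coord_vbasis {1}->; apply: eq_bigr => r _; by rewrite mxE.
Qed.

Definition der_mx (r : 'I_N) : 'M[K]_D := act_mx (der_basis r).
Local Notation gmat := (gen_mx der_mx).

Lemma act_der_comb X c : act X (der_comb c) = \sum_r c 0 r *: act X (der_basis r).
Proof.
rewrite /der_comb; apply: (big_ind2 (fun l Y => act X l = Y)) => [|l Y l' Y' <- <-|r _].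
- by have := act_Pr (-1) X 0 0; rewrite scaler0 addr0 scaleN1r addNr.
- by have := act_Pr 1 X l l'; rewrite !scale1r.
have z : act X 0 = 0 by have := act_Pr (-1) X 0 0; rewrite scaler0 addr0 scaleN1r addNr.
by have := act_Pr (c 0 r) X (der_basis r) 0; rewrite z !addr0.
Qed.

Lemma mul_gmat v c : v *m gmat c = coords (act (of_coords v) (der_comb c)).
Proof.
rewrite act_der_comb /gen_mx mulmx_sumr coords_sum; apply: eq_bigr => r _.
by rewrite -scalemxAr act_mxE.
Qed.

(** Consequence of [act_bracket]; it is the hypothesis under which the orbits of [exp_group] were
    studied. *)
Lemma gmat_bracket c c' : exists c'', gmat c *m gmat c' - gmat c' *m gmat c = gmat c''.
Proof.
have H v a b : v *m gmat a *m gmat b = coords (act (act (of_coords v) (der_comb a)) (der_comb b)).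
  by rewrite !mul_gmat coordsK.
have Lb := der_bracket_L (der_comb_L c) (der_comb_L c').
exists (\row_r coord (vbasis der_space) r (der_bracket (der_comb c) (der_comb c')));
  apply/row_matrixP => i.
rewrite !rowE mulmxBr !mulmxA !H mul_gmat -(der_comb_coord Lb) -act_bracket.
by rewrite coordsB.
Qed.

Lemma has_velocity_hasd (f : K -> W) t w :
  has_velocity f t w <-> hasd (fun s => coords (f s)) t (coords w).
Proof. by split=> [/is_derive_hasd|/hasd_is_derive]; apply. Qed.

Lemma exp_L1 v c : L A 1 (of_coords v) -> L A 1 (of_coords (v *m mexp (gmat c))).
Proof.
apply: (@mexp_stableP _ _ nd _ _ (fun v => L A 1 (of_coords v))) => [|k u w|w].
- by rewrite of_coords0; apply: L_0.
- by rewrite of_coordsP; apply: L_P.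
by move=> Lw; rewrite mul_gmat coordsK; apply: act_L => //; apply: der_comb_L.
Qed.

Local Notation exp_group := (exp_group nd der_mx).

(** On [L A 1] the gauge vector field of a derivation is linear, so by uniqueness its integral
    curves are exponentials. Conversely these exponential curves stay in [L A 1], a subspace
    preserved by the field. *)
Lemma gauge_equivP (X Y : W) : L A 1 X ->
  gauge_equiv X Y <-> exists2 g, exp_group g & coords Y = coords X *m g.
Proof.
move=> LX; split=> [|[g Gg E]].
  elim=> [|l gamma _ [g Gg E] Ll [Lg vel]].
    by exists 1%:M; [exact: Ggen1|rewrite mulmx1].
  have El := der_comb_coord Ll; set c := \row_r _ in El.
  exists (g *m mexp (gmat c)); first exact: GgenS.
  rewrite mulmxA -E.
  have := @ode_uniqueE _ _ nd _ _ (gmat c) (fun s => coords (gamma s)).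
  move=> /(_ _ 1); rewrite scale1r; apply=> t.
  have /has_velocity_hasd := vel t.
  by rewrite (dX_act char0 _ (Lg t).1) mul_gmat coordsK -El.
have {E} -> : Y = of_coords (coords X *m g) by rewrite -E coordsK.
suff : gauge_equiv X (of_coords (coords X *m g)) /\ L A 1 (of_coords (coords X *m g)) by case.
elim: Gg => [|h c _ [IH IHL]]; first by rewrite mulmx1 coordsK; split=> //; apply: gauge_refl.
rewrite mulmxA; split; last exact: exp_L1.
pose gamma (t : K) := of_coords (coords X *m h *m mexp (t *: gmat c)).
have := @gauge_step _ _ X (der_comb c) gamma.
rewrite /gamma scale0r mexp0 mulmx1 scale1r; apply=> //; first exact: der_comb_L.
have Lt t : L A 1 (gamma t) by rewrite /gamma -linearZ; apply: exp_L1.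
split=> // t; apply/has_velocity_hasd; rewrite (dX_act char0 _ (Lt t).1).
have := hasD_mulr (@nK_ge0 _ _ nd) (coords X *m h) (mexp_der nd (gmat c) t).
apply: hasD_eq => [s|s]; first by rewrite of_coordsK.
by rewrite -scalemxAr mulmxA mul_gmat.
Qed.

(** The Jacobiator, quadratic in [X], as a linear map on the tensor square: its value on [v^T *m v]
    is the Jacobiator of [v]. *)
Definition jac_tensor (Z : 'M[K]_D) x y z : A :=
  \sum_k \sum_l Z k l *: jac2 (of_coords (delta_mx 0 k)) (of_coords (delta_mx 0 l)) x y z.

Lemma jac2_Pl k (X X' Y : cochain 2) x y z :
  jac2 (k *: X + X') Y x y z = k *: jac2 X Y x y z + jac2 X' Y x y z.
Proof. by rewrite /jac2 !ap2_c !scalerDr !addrA (ACl (1*3*5*2*4*6)%AC). Qed.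

Lemma jac2_Pr k (X Y Y' : cochain 2) x y z :
  jac2 X (k *: Y + Y') x y z = k *: jac2 X Y x y z + jac2 X Y' x y z.
Proof. by rewrite /jac2 !ap2_c !ap2_linear_l !scalerDr !addrA (ACl (1*3*5*2*4*6)%AC). Qed.

Lemma jac2_suml I (r : seq I) (F : I -> K) (G : I -> 'rV[K]_D) (Y : cochain 2) x y z :
  jac2 (of_coords (\sum_(i <- r) F i *: G i)) Y x y z =
  \sum_(i <- r) F i *: jac2 (of_coords (G i)) Y x y z.
Proof.
have z0 : jac2 (0 : cochain 2) Y x y z = 0 by rewrite /jac2 !ap2_c0 !addr0.
elim: r => [|i r IH]; first by rewrite !big_nil of_coords0.
by rewrite !big_cons of_coordsP jac2_Pl IH.
Qed.

Lemma jac2_sumr I (r : seq I) (F : I -> K) (G : I -> 'rV[K]_D) (X : cochain 2) x y z :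
  jac2 X (of_coords (\sum_(i <- r) F i *: G i)) x y z =
  \sum_(i <- r) F i *: jac2 X (of_coords (G i)) x y z.
Proof.
have z0 : jac2 X (0 : cochain 2) x y z = 0 by rewrite /jac2 !ap2_c0 !ap2_0l !addr0.
elim: r => [|i r IH]; first by rewrite !big_nil of_coords0.
by rewrite !big_cons of_coordsP jac2_Pr IH.
Qed.

Lemma jac_tensor_rank1 v x y z : jac_tensor (v^T *m v) x y z = jac2 (of_coords v) (of_coords v)
  x y z.
Proof.
have E : v = \sum_k v 0 k *: delta_mx 0 k by rewrite {1}[v]row_sum_delta.
rewrite [in RHS]E jac2_suml; apply: eq_bigr => k _; rewrite [of_coords (\sum_i _)]/(of_coords _).
rewrite jac2_sumr scaler_sumr; apply: eq_bigr => l _; rewrite scalerA; congr (_ *: _).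
by rewrite mxE big_ord1 mxE.
Qed.

Lemma jac2_act_term (X Y : cochain 2) l x y z :
  ap2 (act X l) (ap2 Y x y) z + ap2 X (ap2 (act Y l) x y) z =
  ap2 X (ap2 Y (ap1 l x) y) z + ap2 X (ap2 Y x (ap1 l y)) z + ap2 X (ap2 Y x y) (ap1 l z)
  - ap1 l (ap2 X (ap2 Y x y) z).
Proof.
rewrite !actE ap2Bl ap2Dl.
set p1 := ap2 X (ap1 l (ap2 Y x y)) z; set p2 := ap2 X (ap2 Y x y) (ap1 l z).
set p3 := ap1 l _; set p4 := ap2 X (ap2 Y _ _) z; set p5 := ap2 X (ap2 Y x _) z.
by rewrite !addrA (ACl (4*5*2*3*(1*6))%AC) /= subrr addr0.
Qed.

(** Equivariance of the Jacobiator: the terms with [l] between the two brackets cancel in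
    [jac2_act_term]. *)
Lemma jac2_act (X Y : cochain 2) l x y z :
  jac2 (act X l) Y x y z + jac2 X (act Y l) x y z =
  jac2 X Y (ap1 l x) y z + jac2 X Y x (ap1 l y) z + jac2 X Y x y (ap1 l z)
  - ap1 l (jac2 X Y x y z).
Proof.
rewrite /jac2 addrACA (addrACA (ap2 (act X l) _ _)) !jac2_act_term !(linearD (ap1 l)) /=.
by rewrite !opprD !addrA (ACl (1*7*10*2*5*11*3*6*9*4*8*12)%AC).
Qed.

Lemma jac_tensor_act c (Z : 'M[K]_D) x y z :
  jac_tensor ((gmat c)^T *m Z + Z *m gmat c) x y z =
  jac_tensor Z (ap1 (der_comb c) x) y z + jac_tensor Z x (ap1 (der_comb c) y) z + jac_tensor Z x
    y (ap1 (der_comb c) z)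
  - ap1 (der_comb c) (jac_tensor Z x y z).
Proof.
set B := gmat c; pose E k := of_coords (delta_mx 0 k).
have EB r : of_coords (\sum_k B r k *: delta_mx 0 k) = act (E r) (der_comb c).
  rewrite -[RHS]coordsK -mul_gmat -rowE [in RHS](row_sum_delta (row r B)).
  by congr of_coords; apply: eq_bigr => k _; rewrite mxE.
have -> : jac_tensor (B^T *m Z + Z *m B) x y z =
    \sum_k \sum_l Z k l *: (jac2 (act (E k) (der_comb c)) (E l) x y z
                            + jac2 (E k) (act (E l) (der_comb c)) x y z).
  transitivity (\sum_k \sum_l (B^T *m Z) k l *: jac2 (E k) (E l) x y z
    + \sum_k \sum_l (Z *m B) k l *: jac2 (E k) (E l) x y z).
    rewrite -big_split; apply: eq_bigr => k _; rewrite -big_split; apply: eq_bigr => l _.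
    by rewrite [_ k l]mxE scalerDl.
  transitivity (\sum_k \sum_l Z k l *: jac2 (act (E k) (der_comb c)) (E l) x y z
    + \sum_k \sum_l Z k l *: jac2 (E k) (act (E l) (der_comb c)) x y z); last first.
    rewrite -big_split; apply: eq_bigr => k _; rewrite -big_split; apply: eq_bigr => l _.
    exact/esym/scalerDr.
  congr (_ + _).
    rewrite exchange_big [RHS]exchange_big; apply: eq_bigr => l _.
    transitivity (\sum_k \sum_r (Z r l * B r k) *: jac2 (E k) (E l) x y z).
      apply: eq_bigr => k _; rewrite mxE scaler_suml; apply: eq_bigr => r _.
      by rewrite mxE mulrC.
    rewrite exchange_big; apply: eq_bigr => r _; rewrite -EB jac2_suml scaler_sumr.
    by apply: eq_bigr => k _; rewrite scalerA.
  apply: eq_bigr => k _.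
  transitivity (\sum_l \sum_r (Z k r * B r l) *: jac2 (E k) (E l) x y z).
    by apply: eq_bigr => l _; rewrite mxE scaler_suml.
  rewrite exchange_big; apply: eq_bigr => r _; rewrite -EB jac2_sumr scaler_sumr.
  by apply: eq_bigr => l _; rewrite scalerA.
rewrite /jac_tensor -!big_split (linear_sum (ap1 (der_comb c))) /=.
apply: (etrans _ (sumrB _ _ _ _)); apply: eq_bigr => k _.
rewrite -!big_split (linear_sum (ap1 (der_comb c))) /=.
apply: (etrans _ (sumrB _ _ _ _)); apply: eq_bigr => l _.
by rewrite jac2_act ap1Z scalerBr !scalerDr.
Qed.

(** The tensor square of the flow solves the linear equation with matrix [A2]. By [jac_tensor_act]
    the tensors with vanishing Jacobiator form a subspace stable under [A2], hence under its
    exponential. *)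
Lemma exp_jacobi v c : jacobi (of_coords v) -> jacobi (of_coords (v *m mexp (gmat c))).
Proof.
move=> J x y z; set B := gmat c.
pose A2 : 'M[K]_(D * D) := lin_mulmx B^T + lin_mulmxr B.
have A2E (Z : 'M[K]_D) : mxvec Z *m A2 = mxvec (B^T *m Z + Z *m B).
  by rewrite mulmxDr !mul_vec_lin /= linearD.
pose y2 t := mxvec ((v *m mexp (t *: B))^T *m (v *m mexp (t *: B))).
have Hy t : hasd y2 t (y2 t *m A2).
  have H1 := hasD_mulr (@nK_ge0 _ _ nd) v (mexp_der nd B t).
  have H2 := hasD_lin (@nK_ge0 _ _ nd) (@trmx K 1 D) H1.
  have H3 := hasD_lin (@nK_ge0 _ _ nd) mxvec (hasD_mul (@nK_ge0 _ _ nd) H2 H1).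
  apply: hasD_eq H3 => // h; rewrite A2E -[RHS]linearZ; congr (mxvec _).
  rewrite -scalemxAr linearZ /= -scalemxAl -scalemxAr -scalerDr; congr (_ *: _).
  by rewrite !mulmxA !trmx_mul !mulmxA.
have := ode_uniqueE Hy 1; rewrite /y2 scale1r scale0r mexp0 mulmx1 => E.
have P w : (forall x y z, jac_tensor (vec_mx w) x y z = 0) ->
    forall x y z, jac_tensor (vec_mx (w *m mexp (1 *: A2))) x y z = 0.
  rewrite scale1r.
  apply: (@mexp_stableP _ _ nd _ _ (fun w => forall x y z, jac_tensor (vec_mx w) x y z = 0)) =>
    [|k u u' hu hu' x' y' z'|u hu x' y' z'].
  - move=> x' y' z'; rewrite /jac_tensor linear0 big1 // => k _; rewrite big1 // => l _.
    by rewrite mxE scale0r.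
  - transitivity (k *: jac_tensor (vec_mx u) x' y' z' + jac_tensor (vec_mx u') x' y' z').
      rewrite /jac_tensor scaler_sumr -big_split; apply: eq_bigr => i _.
      rewrite scaler_sumr -big_split; apply: eq_bigr => j _.
      by rewrite linearP !mxE scalerDl scalerA.
    by rewrite hu hu' scaler0 addr0.
  by rewrite -[u]vec_mxK A2E mxvecK jac_tensor_act !hu linear0 subr0 !addr0.
have H0 x' y' z' : jac_tensor (vec_mx (mxvec (v^T *m v))) x' y' z' = 0.
  by rewrite mxvecK jac_tensor_rank1 J.
by have := P _ H0 x y z; rewrite -E mxvecK jac_tensor_rank1.
Qed.

Lemma exp_group_poisson (X : W) g : exp_group g -> poisson_structures A X ->
  poisson_structures A (of_coords (coords X *m g)).
Proof.
move=> Gg /(poisson_structuresP char0) H; apply/(poisson_structuresP char0).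
elim: Gg => [|h c _ [IH1 IH2]]; first by rewrite mulmx1 coordsK.
by rewrite mulmxA; split; [apply: exp_L1|apply: exp_jacobi].
Qed.

End Gauge.

(** * The atlas of a gauge orbit *)

Lemma polarized_congr (K : comNzRingType) (n m : nat) (kk k : K) (a b V : 'M[K]_(n, m))
    (x y M : 'M[K]_n) :
  let f := fun (a : 'M[K]_(n, m)) (x : 'M[K]_n) =>
    kk *: ((a^T *m M + V^T *m x) *m V + V^T *m M *m a) in
  f (k *: a + b) (k *: x + y) = k *: f a x + f b y.
Proof.
rewrite /= [(k *: a + b)^T]linearP /= !mulmxDl !mulmxDr -!scalemxAl -!scalemxAr !mulmxDl
  -!scalemxAl.
rewrite !scalerDr !scalerA ![kk * k]mulrC.
by rewrite !addrA (ACl (1*3*5*2*4*6)%AC).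
Qed.

Section Assembly.
Variables (R : realType) (K : numFieldType) (nd : norm_data R K).
Variable A : falgType K.
Hypothesis mulAC : commutative (@GRing.mul A).
Variable form : A -> A -> K.
Hypothesis hform : frobenius_form form.
Variable kappa : nat -> nat -> K.
Local Notation cochain := (Defs.cochain A).
Local Notation chain := (Defs.chain A).
Local Notation W := (cochain 2 : vectType K).
Local Notation D := (\dim {:W}).
Local Notation coords := (@coords K W).
Local Notation of_coords := (@of_coords K W).
Local Notation hasd f t D := (hasd nd f t D).
Local Notation hasJ f u J := (hasJ nd f u J).
Local Notation nM := (@mx_norm1 _ _ nd _ _).
Local Notation nMp := (fun m n => @nM_ge0 _ _ nd m n).
Local Notation mexp := (mexp nd).
Local Notation N := (\dim (der_space A)).
Local Notation a := (@der_mx K A).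
Local Notation exp_group := (exp_group nd a).
Local Notation tan_mx := (tan_mx a).
Local Notation gmat := (gen_mx a).
Local Notation pairing := (pairing form).
Local Notation BX := (contraction form).

Let char0 p : p.+1%:R != 0 :> K.
Proof. by rewrite pnatr_eq0. Qed.

Variable X0 : W.
Hypothesis HX0 : poisson_structures A X0.
Local Notation x0 := (coords X0).
Variables (m : nat) (s : 'M[K]_(m, N)) (p : 'M[K]_(D, m)).
Variables (ps : 'rV[K]_m -> 'rV[K]_D) (r B : R).
Local Notation Smx := (slice_mx a s p).
Hypotheses (r0 : 0 < r) (B0 : 0 <= B) (psX : ps (x0 *m p) = x0).
Hypothesis Hps : forall w, nM (w - x0 *m p) < r ->
    [/\ ps w *m p = w /\ s *m tan_mx (ps w) *m p \in unitmx,
        hasJ ps w (Smx (ps w)),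
        tan_mx (ps w) = tan_mx (ps w) *m p *m Smx (ps w),
        (exists2 g, exp_group g & ps w = x0 *m g)
      & nM (ps w) <= B /\ nM (invmx (s *m tan_mx (ps w) *m p)) <= B].

Definition chart_dom : set 'rV[K]_m := [set w | nM (w - x0 *m p) < r].
Local Notation U := chart_dom.

(** A single slice at [X0] serves the whole orbit: the charts share their domain and differ by right
    translation. *)
Definition chart (g : 'M[K]_D) : param m W := Param U (fun u => of_coords (ps u *m g)).

Definition gauge_atlas : set (param m W) := [set c | exists2 g, exp_group g & c = chart g].

Lemma open_chart_dom : open U.
Proof.
apply: (open_nM (nd := nd)) => u Uu.
exists (r - nM (u - x0 *m p)); first by rewrite subr_gt0.
move=> h hu; rewrite /chart_dom /=; apply: le_lt_trans (nM_tri _ u _ _) _.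
by rewrite ltrBrDr in hu.
Qed.

Lemma ps_unit u : U u -> s *m tan_mx (ps u) *m p \in unitmx.
Proof. by move=> /Hps[[]]. Qed.

Lemma ps_diff_d u : U u -> differentiable ps u /\
  'd ps u = mulmxr (Smx (ps u)) :> (_ -> _).
Proof.
by move=> Uu; have [_ HJ _ _ _] := Hps Uu; apply: (hasD_diff (nd := nd)).
Qed.

Lemma ps_diff u : U u -> differentiable ps u.
Proof. by move=> /ps_diff_d[]. Qed.

Lemma ps_d u v : U u -> 'd ps u v = v *m Smx (ps u).
Proof. by move=> /ps_diff_d[_ ->]. Qed.

Local Notation rational_mx := (@rational_entries K m U _ (fun i u => ps u 0 i) _ _).

Lemma chart_smooth q t (F : 'rV[K]_m -> 'M[K]_(q, t)) : rational_mx F -> smooth_on U F.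
Proof. exact: (ps_smooth open_chart_dom ps_unit ps_diff ps_d). Qed.

Lemma chart_rat q (g : 'M[K]_(D, q)) : rational_mx (fun u => ps u *m g).
Proof. by apply: ratm_mul; [apply: ratm_ps|apply: ratm_cst]. Qed.

Lemma coords_chart g : (fun u => coords (par_map (chart g) u)) = (fun u => ps u *m g).
Proof. by apply/funext => u; rewrite /= of_coordsK. Qed.

Lemma par_diffE g u v : U u -> par_diff (chart g) u v = of_coords (v *m (Smx (ps u) *m g)).
Proof.
move=> Uu; rewrite /par_diff coords_chart; congr of_coords.
have [_ HJ _ _ _] := Hps Uu.
have H : hasJ (fun u => ps u *m g) u (Smx (ps u) *m g).
  by apply: hasD_eq (hasD_mull (@nMp _ _) g HJ) => // h; rewrite mulmxA.
have [_ ->] := hasD_diff (L := mulmxr (Smx (ps u) *m g)) H.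
by [].
Qed.

Lemma Smx_p u : U u -> Smx (ps u) *m p = 1%:M.
Proof.
move=> Uu; rewrite /slice_mx -!mulmxA.
have -> : s *m (tan_mx (ps u) *m p) = s *m tan_mx (ps u) *m p by rewrite mulmxA.
by rewrite mulVmx // ps_unit.
Qed.

(** The relation [T = T p S] of the slice, carried along by equivariance; [invmx g *m p] takes the
    place of [p]. *)
Lemma tangent_key g u : U u -> exp_group g ->
  tan_mx (ps u *m g) *m (invmx g *m p) *m (Smx (ps u) *m g) = tan_mx (ps u *m g).
Proof.
move=> Uu Gg; have [_ _ HT _ _] := Hps Uu; have gu := exp_group_unit Gg.
have [Ad HAd] := tan_mx_Ggen (@gmat_bracket K A) (exp_group_inv Gg).
have E1 : tan_mx (ps u *m g) *m invmx g = Ad *m tan_mx (ps u) by rewrite HAd mulmxK.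
move: HT; move: (Smx (ps u)) => S HT; rewrite !mulmxA E1.
have -> : Ad *m tan_mx (ps u) *m p *m S = Ad *m (tan_mx (ps u) *m p *m S).
  by rewrite !mulmxA.
by rewrite -HT -E1 mulmxKV.
Qed.

Lemma gauge_atlas_param c : gauge_atlas c ->
  immersed_param [set Y | gauge_equiv X0 Y] c.
Proof.
move=> [g Gg ->]; have gu := exp_group_unit Gg; split.
- exact: open_chart_dom.
- by rewrite coords_chart; apply: chart_smooth; apply: chart_rat.
- move=> u v Uu Uv /(can_inj (@of_coordsK K A)) /(congr1 (mulmxr (invmx g))) /=.
  rewrite !mulmxK // => /(congr1 (mulmxr p)) /=.
  by have [[-> _] _ _ _ _] := Hps Uu; have [[-> _] _ _ _ _] := Hps Uv.
- move=> u v Uu; rewrite par_diffE // => /(congr1 coords).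
  rewrite of_coordsK coords0 mulmxA => /(congr1 (mulmxr (invmx g))) /=.
  rewrite mulmxK // mul0mx => /(congr1 (mulmxr p)) /=.
  by rewrite -mulmxA Smx_p // mulmx1 mul0mx.
move=> u Uu /=; apply/(gauge_equivP nd _ HX0.1); rewrite of_coordsK.
have [_ _ _ [h Gh ->] _] := Hps Uu.
by exists (h *m g); [exact: exp_group_mul|rewrite mulmxA].
Qed.

(** Two charts meet where the slice moved by [g *m invmx g'] meets the slice. Openness is
    [translate_open], and the transition map is the projection by [p] of the moved slice, smooth on
    the whole domain. *)
Lemma gauge_atlas_compatible c c' : gauge_atlas c -> gauge_atlas c' -> compatible c c'.
Proof.
move=> [g Gg ->] [g' Gg' ->]; have gu' := exp_group_unit Gg'.
pose h := g *m invmx g'.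
have Gh : exp_group h by apply: exp_group_mul => //; apply: exp_group_inv.
have E u u' : of_coords (ps u' *m g') = of_coords (ps u *m g) <-> ps u *m h = ps u'.
  split=> [/(can_inj (@of_coordsK K A))|].
    by rewrite /h mulmxA => <-; rewrite mulmxK.
  by rewrite /h mulmxA => <-; rewrite mulmxKV.
split.
  apply: (open_nM (nd := nd)) => u [Uu [u' Uu' /E Euu']].
  have [e e0 He] := translate_open (@gmat_bracket K A) B0 Hps Gh Uu Uu' Euu'.
  exists e => // v /He[Uv [v' Uv' Ev]]; split=> //.
  by exists v' => //; apply/E.
exists (fun u => ps u *m (h *m p)); split.
  move=> k; apply: (@Ck_sub _ _ _ _ _ U); first by move=> u [].
  by apply: chart_smooth; apply: chart_rat.
move=> u [Uu [u' Uu' /E Euu']] /=.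
rewrite mulmxA Euu'; have [[-> _] _ _ _ _] := Hps Uu'.
by split=> //; apply/E.
Qed.

Lemma gauge_atlas_countable : exists2 c : nat -> param m W, (forall i, gauge_atlas (c i)) &
  forall w, gauge_equiv X0 w -> exists i, exists2 u, par_dom (c i) u & par_map (c i) u = w.
Proof.
(* Pickling needs a countable type, so the letters are stored as finite functions. *)
pose L i : seq {ffun 'I_N -> nat} := odflt [::] (unpickle i).
pose word (l : seq {ffun 'I_N -> nat}) := gword nd a
  (map (fun (f : {ffun 'I_N -> nat}) (i : 'I_N) => f i) l).
exists (fun i => chart (word (L i))).
  by move=> i; exists (word (L i)) => //; apply: gword_exp_group.
move=> w /(gauge_equivP nd _ HX0.1)[h Gh Ew].
have [l [v Uv Ev]] := countable_cover (@gmat_bracket K A) r0 B0 psX Hps Gh.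
exists (pickle (map (fun f : 'I_N -> nat => [ffun x => f x] : {ffun 'I_N -> nat}) l)), v => //=.
rewrite /L pickleK /= /word -map_comp (_ : map _ l = l); last first.
  rewrite -[RHS]map_id; apply: eq_map => f /=.
  by apply/funext => x; rewrite ffunE.
by rewrite -Ev -Ew coordsK.
Qed.

Lemma gauge_atlas_tangent c u : gauge_atlas c -> par_dom c u ->
  tangent c u = [set dX (par_map c u) (l : cochain 0.+1) | l in L A 0].
Proof.
move=> [g Gg ->] Uu; have gu := exp_group_unit Gg.
have LY : L A 1 (of_coords (ps u *m g)).
  have [_ _ _ [h Gh ->] _] := Hps Uu; rewrite -mulmxA.
  by have [] := exp_group_poisson (exp_group_mul Gh Gg) HX0.
have dXE l : dX (of_coords (ps u *m g)) (l : cochain 0.+1) = act (of_coords (ps u *m g)) l.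
  by apply: dX_act; [exact: char0|case: LY].
apply/seteqP; split=> [_ [v _ <-]|_ [l Ll <-]] /=.
  rewrite par_diffE //.
  have [Ad HAd] := tan_mx_Ggen (@gmat_bracket K A) Gg.
  pose c' := v *m invmx (s *m tan_mx (ps u) *m p) *m s *m Ad.
  exists (der_comb c'); first exact: der_comb_L.
  rewrite dXE -[LHS]coordsK -mul_gmat -tan_mxE /c' -mulmxA -HAd /slice_mx.
  by rewrite !mulmxA.
exists (ps u *m g *m gmat (\row_r coord (vbasis (der_space A)) r l) *m (invmx g *m p)) => //.
rewrite par_diffE // dXE -[RHS]coordsK; congr of_coords.
rewrite {2}(der_comb_coord Ll) -mul_gmat -tan_mxE -mulmxA -mulmxA.
by rewrite (mulmxA (tan_mx _)) tangent_key.
Qed.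

(** Coordinates of derivations extend to functionals on all 1-cochains, hence are given by chains;
    in these chains the contraction becomes the matrix [BXmx]. *)
Lemma der_dual_exists : exists der_dual : 'I_N -> chain 1,
  forall r l, pairing 1 l (der_dual r) = coord (vbasis (der_space A)) r l.
Proof.
have H (i : 'I_N) : exists c : chain 1, forall l, pairing 1 l c = coord (vbasis (der_space A)) i
  l.
  apply: (pairing_represent hform) => k f g; exact: linearP.
by have [F HF] := choice H; exists F.
Qed.

Definition der_dual : 'I_N -> chain 1 := projT1 (cid der_dual_exists).

Lemma der_dualP i l : pairing 1 l (der_dual i) = coord (vbasis (der_space A)) i l.
Proof. exact: (projT2 (cid der_dual_exists)). Qed.

Lemma BX_Pr (X : cochain 2) k c d d' : BX X c (k *: d + d') = k * BX X c d + BX X c d'.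
Proof.
rewrite /contraction mulr_sumr -big_split; apply: eq_bigr => i _ /=.
rewrite mulr_sumr -big_split; apply: eq_bigr => j _ /=.
by rewrite !ffunE mulrDr -scalerAr !(formC hform (ap2 _ _ _)) (formP_l hform).
Qed.

Lemma BX_suml (X : cochain 2) I (l : seq I) (F : I -> K) (G : I -> chain 1) d :
  BX X (\sum_(i <- l) F i *: G i) d = \sum_(i <- l) F i * BX X (G i) d.
Proof.
have z : BX X 0 d = 0.
  by have := BX_P hform X (-1) 0 0 d; rewrite scaler0 addr0 mulN1r addNr.
by elim: l => [|i l IH]; rewrite ?big_nil // !big_cons (BX_P hform) IH.
Qed.

Lemma BX_sumr (X : cochain 2) I (l : seq I) (F : I -> K) (G : I -> chain 1) c :
  BX X c (\sum_(i <- l) F i *: G i) = \sum_(i <- l) F i * BX X c (G i).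
Proof.
have z : BX X c 0 = 0.
  by have := BX_Pr X (-1) c 0 0; rewrite scaler0 addr0 mulN1r addNr.
by elim: l => [|i l IH]; rewrite ?big_nil // !big_cons BX_Pr IH.
Qed.

Lemma pairing1_sumr I (l : seq I) (F : I -> K) (G : I -> chain 1) f :
  pairing 1 f (\sum_(i <- l) F i *: G i) = \sum_(i <- l) F i * pairing 1 f (G i).
Proof.
by rewrite (pairing_sumr hform); apply: eq_bigr => i _; rewrite (pairing_Zr hform).
Qed.

Definition BXmx (y : 'rV[K]_D) : 'M[K]_N :=
  \matrix_(i, j) BX (of_coords y) (der_dual i) (der_dual j).

Lemma BXmx_linear : linear BXmx.
Proof.
by move=> k y y'; apply/matrixP => i j; rewrite !mxE of_coordsP (BX_X hform).
Qed.
HB.instance Definition _ := GRing.isLinear.Build K _ _ _ BXmx BXmx_linear.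

Section Frame.
Variable h : 'M[K]_(D, m).

Definition pcoord j (Y : W) : K := (coords Y *m h) 0 j.

Lemma pcoordP j k (Y Z : cochain 2) : pcoord j (k *: Y + Z) = k * pcoord j Y + pcoord j Z.
Proof. by rewrite /pcoord coordsP mulmxDl -scalemxAl !mxE. Qed.

(** An explicit substitute for [deltaX] of the covector [pcoord j]: it has the same pairings with
    derivations, and it is linear in [Z], so it can be differentiated. *)
Definition frame_chain (Z : W) j : chain 1 := \sum_i pcoord j (act Z (der_basis i)) *: der_dual i.

Lemma pairing_frame_chain Z j l : L A 0 l -> pairing 1 l (frame_chain Z j) = pcoord j (act Z l).
Proof.
move=> Ll; rewrite pairing1_sumr; set c := \row_i coord (vbasis (der_space A)) i l.
rewrite [in RHS](der_comb_coord Ll) -/c act_der_comb.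
have z : pcoord j 0 = 0.
  by have := pcoordP j (-1) 0 0; rewrite scaler0 addr0 mulN1r addNr.
have -> : pcoord j (\sum_i c 0 i *: act Z (der_basis i)) = \sum_i c 0 i * pcoord j
  (act Z (der_basis i)).
  by elim/big_rec2: _ => [//|i u v _ <-]; rewrite pcoordP.
by apply: eq_bigr => i _; rewrite der_dualP mxE mulrC.
Qed.

Lemma tan_mx_pcoord z i j : (tan_mx z *m h) i j = pcoord j (act (of_coords z) (der_basis i)).
Proof.
rewrite /pcoord -act_mxE; transitivity ((row i (tan_mx z) *m h) 0 j).
  by rewrite -row_mul [RHS]mxE.
by rewrite rowK.
Qed.

Lemma BXmx_frame_chain y z z' i j :
  ((tan_mx z *m h)^T *m BXmx y *m (tan_mx z' *m h)) i j =
  BX (of_coords y) (frame_chain (of_coords z) i) (frame_chain (of_coords z') j).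
Proof.
rewrite BX_suml mxE.
transitivity (\sum_t \sum_q pcoord i (act (of_coords z) (der_basis q)) *
   BX (of_coords y) (der_dual q) (der_dual t) * pcoord j (act (of_coords z') (der_basis t))).
  apply: eq_bigr => t _; rewrite mxE mulr_suml; apply: eq_bigr => q _.
  by rewrite mxE [BXmx y q t]mxE !tan_mx_pcoord.
rewrite exchange_big; apply: eq_bigr => q _; rewrite BX_sumr mulr_sumr.
by apply: eq_bigr => t _; rewrite mulrCA mulrC mulrA.
Qed.

End Frame.

Local Notation kk := (kappa 1%N 1%N * 2).

(** Row [i] of the outer factor holds the chart components of the i-th gauge vector field, and
    column [j] the coefficients of the j-th [frame_chain]. The scalar [kk] is the normalisation
    found in [PiXE]. *)
Definition chart_bivector g (u : 'rV[K]_m) : 'M[K]_m :=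
  let y := ps u *m g in
  kk *: ((tan_mx y *m (invmx g *m p))^T *m BXmx y *m (tan_mx y *m (invmx g *m p))).

Lemma chart_bivector_rational g : rational_mx (chart_bivector g).
Proof.
have Rt : rational_mx (fun u => tan_mx (ps u *m g) *m (invmx g *m p)).
  by apply: ratm_mul; [apply/ratm_tan_mx/chart_rat|apply: ratm_cst].
have RB : rational_mx (fun u => BXmx (ps u *m g)).
  move=> i j.
  pose b : 'cV[K]_D := \col_k BX (of_coords (delta_mx 0 k)) (der_dual i) (der_dual j).
  apply: (@rat_eq _ _ _ _ _ (fun u => (ps u *m g *m b) 0 0)).
    by apply: ratm_mul; [apply: chart_rat|apply: ratm_cst].
  move=> u; set y := ps u *m g; rewrite [in RHS](row_sum_delta y) linear_sum summxE mxE.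
  by apply: eq_bigr => k _; rewrite linearZ !mxE.
have R1 := ratm_mul (ratm_mul (ratm_tr Rt) RB) Rt.
move=> i j; apply: (rat_eq (rat_mul (rat_cst _ _ kk) (R1 i j))) => u.
by rewrite [RHS]mxE.
Qed.

Section AtPoint.
Variables (g : 'M[K]_D) (u : 'rV[K]_m).
Hypotheses (Gg : exp_group g) (Uu : U u).
Let h := invmx g *m p.
Let y := ps u *m g.
Let Y : W := of_coords y.
Let S := Smx (ps u) *m g.
Let V := tan_mx y *m h.
Let M := BXmx y.

Lemma chart_poisson : poisson_structures A Y.
Proof.
have [_ _ _ [h' Gh E] _] := Hps Uu; rewrite /Y /y E -mulmxA.
exact: exp_group_poisson (exp_group_mul Gh Gg) HX0.
Qed.

Let LY : L A 1 Y. Proof. by case: chart_poisson. Qed.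
Let JY : jacobi Y. Proof. by have [_] := (poisson_structuresP char0 Y).1 chart_poisson. Qed.

Definition d_bivector (v : 'rV[K]_m) : 'M[K]_m :=
  kk *: (((tan_mx (v *m S) *m h)^T *m M + V^T *m BXmx (v *m S)) *m V
         + V^T *m M *m (tan_mx (v *m S) *m h)).

Lemma d_bivector_linear : linear d_bivector.
Proof.
move=> k v w; rewrite /d_bivector.
have -> : tan_mx ((k *: v + w) *m S) *m h =
    k *: (tan_mx (v *m S) *m h) + tan_mx (w *m S) *m h.
  by rewrite mulmxDl -scalemxAl (linearP (tan_mx : {linear _ -> _})) mulmxDl -scalemxAl.
have -> : BXmx ((k *: v + w) *m S) = k *: BXmx (v *m S) + BXmx (w *m S).
  by rewrite mulmxDl -scalemxAl (linearP (BXmx : {linear _ -> _})).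
exact: polarized_congr.
Qed.
HB.instance Definition _ := GRing.isLinear.Build K _ _ _ d_bivector d_bivector_linear.

Lemma chart_bivector_d : 'd (chart_bivector g) u = d_bivector :> (_ -> _).
Proof.
have [_ HJ _ _ _] := Hps Uu.
have Hy : hasJ (fun u => ps u *m g) u S.
  by apply: hasD_eq (hasD_mull (@nMp _ _) g HJ) => // v; exact: esym (mulmxA _ _ _).
have Ht := hasD_mull (@nMp _ _) h (hasD_lin (@nMp _ _) (tan_mx : {linear _ -> _}) Hy).
have HB := hasD_lin (@nMp _ _) (BXmx : {linear _ -> _}) Hy.
have HT := hasD_lin (@nMp _ _) (@trmx K N m) Ht.
have H := hasD_lin (@nMp _ _) (@GRing.scale K 'M[K]_m kk)
  (hasD_mul (@nMp _ _) (hasD_mul (@nMp _ _) HT HB) Ht).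
have [_ ->] := hasD_diff (L := d_bivector) H.
by [].
Qed.

Lemma chart_bivectorE i j : chart_bivector g u i j = kk * BX Y (frame_chain h Y i)
  (frame_chain h Y j).
Proof. by rewrite /chart_bivector mxE BXmx_frame_chain. Qed.

(** Row [i] of the bivector is the Hamiltonian vector field of the i-th coordinate, and it is a
    gauge direction. The sign comes from exchanging the arguments of the contraction. *)
Lemma chart_hamiltonian i :
  of_coords (row i (chart_bivector g u) *m S) = - kk *: act Y (ham_der Y (frame_chain h Y i)).
Proof.
pose c : 'rV[K]_N := row i (V^T *m M).
have Ec : der_comb c = - ham_der Y (frame_chain h Y i).
  rewrite [ham_der Y _](der_comb_coord (ham_der_L mulAC _ LY)) /der_comb -sumrN;
    apply: eq_bigr => q _.
  rewrite -scaleNr; congr (_ *: _); rewrite [X in - X]mxE -der_dualP -(BX_ham_der mulAC hform).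
  rewrite -(BX_skew mulAC hform _ _ LY) BX_suml !mxE; apply: eq_bigr => t _.
  by rewrite mxE [M t q]mxE tan_mx_pcoord.
have -> : row i (chart_bivector g u) *m S = kk *: (y *m gmat c).
  have tk : V *m S = tan_mx y := tangent_key Uu Gg.
  rewrite -tan_mxE -[in RHS]tk mulmxA scalemxAl; congr (_ *m S).
  by apply/rowP => j; rewrite [RHS]mxE [LHS]mxE [LHS]mxE -row_mul [in RHS]mxE.
rewrite mul_gmat Ec -[RHS]coordsK -/Y; congr of_coords.
have z : act Y 0 = 0 by have := act_Pr (-1) Y 0 0; rewrite scaler0 addr0 scaleN1r addNr.
have -> : act Y (- ham_der Y (frame_chain h Y i)) = - act Y (ham_der Y (frame_chain h Y i)).
  by have := act_Pr (-1) Y (ham_der Y (frame_chain h Y i)) 0; rewrite z !addr0 !scaleN1r.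
have cZ k (Z : W) : coords (k *: Z) = k *: coords Z.
  by have := coordsP k Z 0; rewrite coords0 !addr0.
by rewrite cZ -scaleN1r cZ scaleN1r scalerN scaleNr.
Qed.

(** Product rule in a Hamiltonian direction: differentiating the outer factors gives a gauge action
    applied twice, differentiating the inner one gives the contraction with [H]. This is one of the
    three cyclic groups in [bivector_jacobi]. *)
Lemma d_bivector_hamiltonian i j k :
  d_bivector (row i (chart_bivector g u)) j k = - (kk * kk) *
  (let H := act Y (ham_der Y (frame_chain h Y i)) in
   pcoord h j (act H (ham_der Y (frame_chain h Y k))) - pcoord h k
     (act H (ham_der Y (frame_chain h Y j)))
   + BX H (frame_chain h Y j) (frame_chain h Y k)).
Proof.
rewrite /d_bivector /=; set z := row _ _ *m S; set H := act Y _.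
have EZ : of_coords z = - kk *: H by apply: chart_hamiltonian.
have zl l : act (of_coords z) l = - kk *: act H l.
  have z0 : act (0 : cochain 2) l = 0.
    by have := act_Pl (-1) 0 0 l; rewrite scaler0 addr0 scaleN1r addNr.
  by rewrite EZ; have := act_Pl (- kk) H 0 l; rewrite z0 !addr0.
have pl q l : pcoord h q (act (of_coords z) l) = - kk * pcoord h q (act H l).
  have z0 : pcoord h q 0 = 0.
    by have := pcoordP h q (-1) 0 0; rewrite scaler0 addr0 mulN1r addNr.
  by rewrite zl; have := pcoordP h q (- kk) (act H l) 0; rewrite z0 !addr0.
have DL q : L A 0 (ham_der Y (frame_chain h Y q)) by apply: ham_der_L.
have E1 : BX Y (frame_chain h (of_coords z) j) (frame_chain h Y k) =
    - kk * pcoord h j (act H (ham_der Y (frame_chain h Y k))).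
  by rewrite (BX_ham_der mulAC hform) pairing_frame_chain // pl.
have E2 : BX Y (frame_chain h Y j) (frame_chain h (of_coords z) k) =
    kk * pcoord h k (act H (ham_der Y (frame_chain h Y j))).
  by rewrite (BX_skew mulAC hform _ _ LY) (BX_ham_der mulAC hform) pairing_frame_chain // pl
    mulNr opprK.
have E3 : BX (of_coords z) (frame_chain h Y j) (frame_chain h Y k) = - kk * BX H
  (frame_chain h Y j) (frame_chain h Y k).
  have z0 c d : BX 0 c d = 0.
    by have := BX_X hform (-1) 0 0 c d; rewrite scaler0 addr0 mulN1r addNr.
  by rewrite EZ; have := BX_X hform (- kk) H 0 (frame_chain h Y j) (frame_chain h Y k);
    rewrite z0 !addr0.
transitivity (kk * (- kk * pcoord h j (act H (ham_der Y (frame_chain h Y k)))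
    + - kk * BX H (frame_chain h Y j) (frame_chain h Y k)
    + kk * pcoord h k (act H (ham_der Y (frame_chain h Y j))))); last first.
  move: (pcoord h j _) (pcoord h k _) (BX H _ _) kk => a b d x.
  by ring.
rewrite -E1 -E2 -E3.
rewrite mulmxDl mxE.
congr (kk * _).
rewrite mxE.
congr (_ + _); last exact: BXmx_frame_chain.
by rewrite mxE; congr (_ + _); exact: BXmx_frame_chain.
Qed.

Lemma chart_bivector_schouten i j k :
  \sum_(l < m) (chart_bivector g u i l * 'd (fun v => chart_bivector g v j k : K^o) u
    (delta_mx 0 l : 'rV[K]_m)
    + chart_bivector g u j l * 'd (fun v => chart_bivector g v k i : K^o) u
      (delta_mx 0 l : 'rV[K]_m)
    + chart_bivector g u k l * 'd (fun v => chart_bivector g v i j : K^o) u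
      (delta_mx 0 l : 'rV[K]_m)) = 0.
Proof.
have dP : differentiable (chart_bivector g) u.
  exact: (ps_rational_diff ps_unit ps_diff ps_d (chart_bivector_rational g) Uu).
have E i' j' k' : \sum_(l < m) chart_bivector g u i' l *
    'd (fun v => chart_bivector g v j' k' : K^o) u (delta_mx 0 l : 'rV[K]_m) =
    d_bivector (row i' (chart_bivector g u)) j' k'.
  rewrite [row i' _]row_sum_delta linear_sum summxE; apply: eq_bigr => l _.
  by rewrite linearZ /= [in RHS]mxE [row i' _ 0 l]mxE -diff_entry // chart_bivector_d.
rewrite !big_split; apply: etrans (congr2 _ (congr2 _ (E _ _ _) (E _ _ _)) (E _ _ _)) _.
rewrite (d_bivector_hamiltonian i) (d_bivector_hamiltonian j) (d_bivector_hamiltonian k).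
rewrite /= -!mulrDr.
(* The covectors [a], [b], [c] are the coordinates [j], [k], [i] in this order, so that the
   direction [H ga] is row [i]. *)
rewrite (bivector_jacobi mulAC hform LY JY (pcoordP h j) (pcoordP h k) (pcoordP h i)) ?mulr0 //;
  by move=> l Ll; rewrite pairing_frame_chain.
Qed.

Lemma chart_bivector_skew : (chart_bivector g u)^T = - chart_bivector g u.
Proof.
apply/matrixP => i j; rewrite [LHS]mxE [RHS]mxE !chart_bivectorE.
by rewrite (BX_skew mulAC hform _ _ LY) mulrN.
Qed.

(** A gauge direction [act Y l] is recovered from its chart components, so [deltaX] of a covector
    and the combination [al] of frame chains pair equally with derivations. *)
Lemma PiX_chart (b c : chain 2) :
  PiX form kappa Y b c = \sum_(i < m) \sum_(j < m) chart_bivector g u i j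
    * pairing 2 (par_diff (chart g) u (delta_mx 0 i)) b
    * pairing 2 (par_diff (chart g) u (delta_mx 0 j)) c.
Proof.
pose tau i : W := of_coords (delta_mx 0 i *m S).
have actE l : L A 0 l -> act Y l = \sum_i pcoord h i (act Y l) *: tau i.
  move=> Ll; have Eact : coords (act Y l) = coords (act Y l) *m h *m S.
    have tk : V *m S = tan_mx y := tangent_key Uu Gg.
    rewrite (der_comb_coord Ll) -mul_gmat -tan_mxE -/y; move: (\row_i _) => w.
    rewrite -[in LHS]tk; exact: etrans (mulmxA _ _ _) (congr1 (mulmx^~ S) (mulmxA _ _ _)).
  rewrite -[LHS]coordsK Eact [coords _ *m h]row_sum_delta mulmx_suml.
  transitivity (of_coords (\sum_i pcoord h i (act Y l) *: (delta_mx 0 i *m S))).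
    by congr of_coords; apply: eq_bigr => i _; rewrite -scalemxAl.
  by rewrite of_coords_sum.
pose al (b : chain 2) : chain 1 := \sum_i pairing 2 (tau i) b *: frame_chain h Y i.
have pal (b' : chain 2) l : L A 0 l ->
    pairing 1 l (deltaX form Y (b' : chain 0.+2)) = pairing 1 l (al b').
  move=> Ll; rewrite -(deltaXP mulAC char0 hform b' LY Ll) {1}(actE l Ll).
  rewrite pairing1_sumr.
  have z : pairing 2 0 b' = 0.
    by have := pairing_P hform (-1) 0 0 b'; rewrite scaler0 addr0 mulN1r addNr.
  transitivity (\sum_i pcoord h i (act Y l) * pairing 2 (tau i) b').
    by elim/big_rec2: _ => [//|i v w _ <-]; rewrite (pairing_P hform).
  by apply: eq_bigr => i _; rewrite pairing_frame_chain // mulrC.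
(* One argument is replaced at a time: with the other fixed, the contraction is a pairing with a
   derivation. Skewness brings the second argument to the first place. *)
rewrite (PiXE hform) // (BX_ham_der mulAC hform) pal; last exact: ham_der_L.
rewrite -(BX_ham_der mulAC hform) (BX_skew mulAC hform _ _ LY) (BX_ham_der mulAC hform).
rewrite pal; last exact: ham_der_L.
rewrite -(BX_ham_der mulAC hform) -(BX_skew mulAC hform _ _ LY) BX_suml mulr_sumr.
apply: eq_bigr => i _; rewrite BX_sumr !mulr_sumr; apply: eq_bigr => j _.
rewrite chart_bivectorE !par_diffE // -/S -/(tau i) -/(tau j).
ring.
Qed.

End AtPoint.

Lemma gauge_atlas_poisson :
  induces_poisson_tensor gauge_atlas (HHhom A 1) (pairing 2) (PiX form kappa).
Proof.
move=> c [g Gg ->]; exists (chart_bivector g).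
  split=> [|u Uu|u Uu i j k]; first exact: chart_smooth (chart_bivector_rational g).
    exact: chart_bivector_skew.
  exact: chart_bivector_schouten.
move=> u b c' Uu _ _; exact: PiX_chart.
Qed.

End Assembly.

(** * The theorem over an abstract normed field, then over both fields *)

Section Generic.
Variables (R : realType) (K : numFieldType) (nd : norm_data R K).
Variable A : falgType K.

Lemma gauge_orbit_poisson (mulAC : commutative (@GRing.mul A))
    (form : A -> A -> K) (hform : frobenius_form form) (kappa : nat -> nat -> K)
    (O : set (cochain A 2)) (hO : gauge_orbit O) :
  O `<=` poisson_structures A /\
  exists (m : nat) (atlas : set (param m (cochain A 2))),
    [/\ immersed_submanifold O atlas,
        (forall c u, atlas c -> par_dom c u ->
          tangent c u = [set dX (par_map c u) lambda | lambda in L A 0])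
      & induces_poisson_tensor atlas (HHhom A 1) (pairing form 2)
          (PiX form kappa)].
Proof.
have [X HX ->] := hO; have LX := HX.1; split.
  move=> Y /(gauge_equivP nd _ LX)[g Gg E].
  by rewrite -(coordsK Y) E; exact: exp_group_poisson Gg HX.
have [s [p sXp]] := rank_factor (tan_mx (@der_mx K A) (coords X)).
have [ps [r [B [r0 B0 psX Hps]]]] := chart_exists nd (@gmat_bracket K A) erefl sXp.
exists (\rank (tan_mx (@der_mx K A) (coords X))), (gauge_atlas nd X p ps r); split.
- split.
  + exact (gauge_atlas_param HX Hps).
  + exact (gauge_atlas_compatible B0 Hps).
  + exact (gauge_atlas_countable HX r0 B0 psX Hps).
- exact (gauge_atlas_tangent HX Hps).
- exact (gauge_atlas_poisson mulAC hform kappa HX Hps).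
Qed.

End Generic.

Theorem corollary1p2 (K : numFieldType) (hK : real_or_complex K)
    (A : falgType K) (mulAC : commutative (@GRing.mul A))
    (form : A -> A -> K) (hform : frobenius_form form)
    (kappa : nat -> nat -> K) (hkappa : forall p q, kappa p q != 0)
    (O : set (cochain A 2)) (hO : gauge_orbit O) :
  O `<=` poisson_structures A /\
  exists (m : nat) (atlas : set (param m (cochain A 2))),
    [/\ immersed_submanifold O atlas,
        (forall c u, atlas c -> par_dom c u ->
          tangent c u = [set dX (par_map c u) lambda | lambda in L A 0])
      & induces_poisson_tensor atlas (HHhom A 1) (pairing form 2)
          (PiX form kappa)].
Proof.
have [R [E|E]] := hK.
  have nd : norm_data R K by rewrite E; exact: norm_data_real.
  exact: (gauge_orbit_poisson nd).
have nd : norm_data R K by rewrite E; exact: norm_data_complex.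
exact: (gauge_orbit_poisson nd).
Qed.
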